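(* Let $F(x,y)$ be a biharmonic function in a region $U\subset\mathbb{R}^2$. Let $S_t$, $t\in I=[0,1]$, be an analytic family of circles in the plane. Suppose that for each $t\in I$ we have $S_t\cap U\neq\emptyset$ and the restriction $F|_{S_t\cap U}$ is a restriction of a linear function. Then either $S_t$, $t\in I$, is a pencil of circles, or $$F(x,y)=A\left((x-a)^2+(y-b)^2\right)+\frac{B(x-c)^2+C(x-c)(y-d)+D(y-d)^2}{(x-c)^2+(y-d)^2}$$ for some $a,b,c,d,A,B,C,D\in\mathbb{R}$.
   Context: A region is a connected open set. Biharmonic means $\Delta(\Delta F)=0$. A linear function is a function of the form $\alpha x+\beta y+\gamma$ with real $\alpha,\beta,\gamma$. An analytic family of circles is one given by equations $x^2+y^2+a(t)x+b(t)y+c(t)=0$ whose coefficients depend real-analytically on $t$. A pencil of circles is a set of circles orthogonal to two fixed distinct circles (the fixed ones being allowed to be lines); a family $S_t$ is called a pencil if all its members belong to such a set.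
   Formalization: The formula for F is claimed only up to an added linear function (absorbed if A≠0; needed if A=0, since F=x is linear on every circle but not of the printed form), and only at points of U other than (c,d), where the fraction is undefined. *)

(* Defs.v *)
(* Stdlib reals with Coquelicot. *)
From Stdlib Require Import Reals.
From Coquelicot Require Import Coquelicot.
Open Scope R_scope.

Definition connected {T : UniformSpace} (U : T -> Prop) : Prop :=
  forall V W : T -> Prop,
    open V -> open W ->
    (forall p, U p -> V p \/ W p) ->
    (forall p, U p -> V p -> W p -> False) ->
    (exists p, U p /\ V p) -> (exists p, U p /\ W p) -> False.

Definition region (U : R * R -> Prop) : Prop := open U /\ connected U.

Definition laplacian (F : R -> R -> R) : R -> R -> R :=
  fun x y => partial_derive 2 0 F x y + partial_derive 0 2 F x y.

(* [ex_diff_n F 4 x y] is Coquelicot's "all partial derivatives of order at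
   most 4 exist and are continuous at (x,y)"; so F is of class C^4 on U.
   The values of F outside the open set U are irrelevant. *)
Definition biharmonic_on (U : R * R -> Prop) (F : R -> R -> R) : Prop :=
  forall x y, U (x, y) ->
    ex_diff_n F 4 x y /\ laplacian (laplacian F) x y = 0.

(* On D = [0,1] this is the usual real-analyticity on a closed interval: at an
   endpoint the power series is only compared with f on the side inside D. *)
Definition analytic_on (D : R -> Prop) (f : R -> R) : Prop :=
  forall t0, D t0 ->
    exists (u : nat -> R) (r : posreal),
      forall t, D t -> Rabs (t - t0) < r -> is_pseries u (t - t0) (f t).

Definition unit_interval (t : R) : Prop := 0 <= t <= 1.

(* Coefficients of the equation k (x^2 + y^2) + a x + b y + c = 0. *)
Record circline := Circline { cl_k : R; cl_a : R; cl_b : R; cl_c : R }.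

Definition on_cl (S : circline) (x y : R) : Prop :=
  cl_k S * (x ^ 2 + y ^ 2) + cl_a S * x + cl_b S * y + cl_c S = 0.

(* A genuine circle of positive radius when k <> 0, a genuine line when k = 0. *)
Definition proper (S : circline) : Prop :=
  0 < cl_a S ^ 2 + cl_b S ^ 2 - 4 * cl_k S * cl_c S.

Definition circle (a b c : R) : circline := Circline 1 a b c.

Definition same_curve (S T : circline) : Prop :=
  forall x y, on_cl S x y <-> on_cl T x y.

(* The curves meet, and at every common point their normal vectors, i.e. the
   gradients of the defining equations, are perpendicular. *)
Definition orthogonal (S T : circline) : Prop :=
  (exists x y, on_cl S x y /\ on_cl T x y) /\
  forall x y, on_cl S x y -> on_cl T x y ->
    (2 * cl_k S * x + cl_a S) * (2 * cl_k T * x + cl_a T) +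
    (2 * cl_k S * y + cl_b S) * (2 * cl_k T * y + cl_b T) = 0.

Definition pencil_on (D : R -> Prop) (S : R -> circline) : Prop :=
  exists C1 C2 : circline,
    proper C1 /\ proper C2 /\ ~ same_curve C1 C2 /\
    forall t, D t -> orthogonal (S t) C1 /\ orthogonal (S t) C2.

Definition linear_function (l : R -> R -> R) : Prop :=
  exists alpha beta gamma : R,
    forall x y, l x y = alpha * x + beta * y + gamma.

(* The second term is undefined at (c,d), where Rocq's division returns a junk
   value; identities involving this expression are asserted off (c,d). *)
Definition special_biharmonic (a b c d A B C D : R) (x y : R) : R :=
  A * ((x - a) ^ 2 + (y - b) ^ 2) +
  (B * (x - c) ^ 2 + C * (x - c) * (y - d) + D * (y - d) ^ 2) /
  ((x - c) ^ 2 + (y - d) ^ 2).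

(* The summand l is needed: the hypotheses of the classification are invariant
   under adding a linear function to F, whereas the special form with A = 0 is
   not (F = x is linear on every circle but has no special form).  For A <> 0
   it can be absorbed by changing a, b, B and D. *)
Definition special_form_on (U : R * R -> Prop) (F : R -> R -> R) : Prop :=
  exists (a b c d A B C D : R) (l : R -> R -> R),
    linear_function l /\
    forall x y, U (x, y) -> (x, y) <> (c, d) ->
      F x y = special_biharmonic a b c d A B C D x y + l x y.

(* Main.v *)
(* Write w for the conjugate of z.  On U the functions a = F_zzw and b = F_zz - w a are holomorphic.  Since F is
   linear on each circle, the derivatives of F in the angle and in t show that F_zz and F_zzw are rational in
   e^(i th) along the circles; hence a and b are rational, with a reduced common denominator q.  If q(om) = 0,
   then comparing numerators shows that the reflection of om in S_t does not depend on t (for t in some interval,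
   hence for all t).  If that reflection is not om itself, the coefficients of S_t satisfy two independent affine
   relations and S_t is a pencil; otherwise all circles pass through om, and two such points again give a pencil.
   So outside the case of a pencil, q is constant or a power of z - om, where om lies on all the circles.
   In the angle of a circle a linear function is annihilated by d^3 + d.  For F this says that a certain expression
   in z, rational on U, is real on every S_t.  Comparing its Laurent coefficients with those of its conjugate leaves
   only a = ka / (z - om)^3 and b = - conj om * a, and integration gives the special form. *)
Require Import Defs.
From Stdlib Require Import Reals Lra Lia Psatz Classical.
From Coquelicot Require Import Coquelicot.
From Stdlib Require Import ssreflect.
From mathcomp Require all_boot all_algebra complex Rstruct zify.
Open Scope R_scope.

(** * Derivatives of complex functions *)

(** For each t the linear function is only assumed to exist, so nothing is known about how it varies
    with t, yet F has to be differentiated across the circles. On S_t, F is a trigonometric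
    polynomial of degree one in the angle; for families of bounded degree the t-derivative at fixed
    angle is again of that kind. The angle and t give two directions in the plane. Solving for the
    two Wirtinger derivatives divides by the normal speed of the circle, hence the denominators;
    three rounds lead from F to F_z, F_zz and F_zzw. On S_t one has conj z = conj m + r^2 / (z - m),
    so an identity along an arc can be written with holomorphic functions only and then extends to
    all of U. The denominator so obtained depends on the circle chosen, while the reduced q does
    not; a root of q therefore meets a condition for every t, and this rigidity confines the poles.
    A pole of order three survives because in the reality condition the coefficient p_i of the
    numerator of a, over the denominator of degree n, enters with the factor i + 3 - n. *)

Definition rcd (g : R -> C) (t : R) (d : C) : Prop :=
  is_derive (fun s => Re (g s)) t (Re d) /\ is_derive (fun s => Im (g s)) t (Im d).

Lemma C_eq (z w : C) : Re z = Re w -> Im z = Im w -> z = w.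
Proof. by case: z => x y; case: w => u v /= -> ->. Qed.

Ltac cring := cbv beta; match goal with |- ?a = ?b => change (@eq C a b); ring end.
Ltac cfield := cbv beta; match goal with |- ?a = ?b => change (@eq C a b); field end.

Lemma is_derive_eq (f : R -> R) (x l l' : R) : is_derive f x l -> l = l' -> is_derive f x l'.
Proof. by move=> H <-. Qed.

Lemma rcd_eq g t d d' : rcd g t d -> d = d' -> rcd g t d'.
Proof. by move=> H <-. Qed.

Lemma rcd_ext_loc g g' t d :
  locally t (fun s => g s = g' s) -> rcd g t d -> rcd g' t d.
Proof.
move=> L [H1 H2]; split; [apply: is_derive_ext_loc H1|apply: is_derive_ext_loc H2];
  by apply: filter_imp L => s ->.
Qed.

Lemma rcd_ext g g' t d : (forall s, g s = g' s) -> rcd g t d -> rcd g' t d.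
Proof. by move=> E; apply: rcd_ext_loc; apply: filter_forall. Qed.

Lemma rcd_unique g t d d' : rcd g t d -> rcd g t d' -> d = d'.
Proof.
move=> [H1 H2] [H3 H4]; apply: C_eq.
  by rewrite -(is_derive_unique _ _ _ H1) -(is_derive_unique _ _ _ H3).
by rewrite -(is_derive_unique _ _ _ H2) -(is_derive_unique _ _ _ H4).
Qed.

Lemma rcd_const c t : rcd (fun _ => c) t 0%C.
Proof. by split; apply: is_derive_const. Qed.

Lemma rcd_real f t l : is_derive f t l -> rcd (fun s => RtoC (f s)) t (RtoC l).
Proof. by move=> H; split; [exact: H|apply: is_derive_const]. Qed.

Lemma rcd_plus f g t df dg :
  rcd f t df -> rcd g t dg -> rcd (fun s => f s + g s)%C t (df + dg)%C.
Proof. by move=> [? ?] [? ?]; split; apply: is_derive_plus. Qed.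

Lemma rcd_opp f t df : rcd f t df -> rcd (fun s => - f s)%C t (- df)%C.
Proof. by move=> [? ?]; split; apply: is_derive_opp. Qed.

Lemma rcd_minus f g t df dg :
  rcd f t df -> rcd g t dg -> rcd (fun s => f s - g s)%C t (df - dg)%C.
Proof. by move=> Hf Hg; apply: rcd_plus => //; apply: rcd_opp. Qed.

Lemma rcd_conj f t df : rcd f t df -> rcd (fun s => Cconj (f s)) t (Cconj df).
Proof. by move=> [H1 H2]; split => //; apply: is_derive_opp. Qed.

Lemma rcd_mult f g t df dg :
  rcd f t df -> rcd g t dg -> rcd (fun s => f s * g s)%C t (df * g t + f t * dg)%C.
Proof.
move=> [F1 F2] [G1 G2]; split.
- apply: is_derive_eq.
    apply: (is_derive_minus (fun s => Re (f s) * Re (g s)) (fun s => Im (f s) * Im (g s)));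
    apply: is_derive_mult; eauto; exact: Rmult_comm.
  rewrite /minus /plus /opp /mult /=; rewrite /Re /Im; ring.
- apply: is_derive_eq.
    apply: (is_derive_plus (fun s => Re (f s) * Im (g s)) (fun s => Im (f s) * Re (g s)));
    apply: is_derive_mult; eauto; exact: Rmult_comm.
  rewrite /plus /mult /=; rewrite /Re /Im; ring.
Qed.

Lemma Cnz_norm (z : C) : z <> 0%C -> Re z ^ 2 + Im z ^ 2 <> 0.
Proof.
move=> Hz H; apply: Hz; apply: C_eq => /=; nra.
Qed.

Lemma is_derive_inv_norm (x y : R -> R) (t dx dy : R) :
  is_derive x t dx -> is_derive y t dy -> x t ^ 2 + y t ^ 2 <> 0 ->
  is_derive (fun s => x s / (x s ^ 2 + y s ^ 2)) t
    ((dx * (y t ^ 2 - x t ^ 2) - 2 * x t * y t * dy) / (x t ^ 2 + y t ^ 2) ^ 2) /\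
  is_derive (fun s => - y s / (x s ^ 2 + y s ^ 2)) t
    ((dy * (y t ^ 2 - x t ^ 2) + 2 * x t * y t * dx) / (x t ^ 2 + y t ^ 2) ^ 2).
Proof.
move=> Hx Hy N.
have E1 := is_derive_unique _ _ _ Hx; have E2 := is_derive_unique _ _ _ Hy.
have X1 : ex_derive x t by exists dx.
have X2 : ex_derive y t by exists dy.
by split; (auto_derive; [repeat split; eauto; simpl in N; lra|change (Derive (fun x0 => x x0) t) with (Derive x t); change (Derive (fun x0 => y x0) t) with (Derive y t); rewrite E1 E2; field; simpl in N; lra]).
Qed.

Lemma rcd_inv f t df :
  rcd f t df -> f t <> 0%C -> rcd (fun s => / f s)%C t (- df / (f t * f t))%C.
Proof.
move=> [F1 F2] Hz; have N := Cnz_norm _ Hz.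
have [D1 D2] := is_derive_inv_norm _ _ _ _ _ F1 F2 N.
have N' : Re (f t) * Re (f t) + Im (f t) * Im (f t) <> 0 by move: N => /=; lra.
have E : (- df / (f t * f t) = - df * (Cconj (f t) / RtoC (Re (f t) ^ 2 + Im (f t) ^ 2)) * (Cconj (f t) / RtoC (Re (f t) ^ 2 + Im (f t) ^ 2)))%C.
  have -> : (RtoC (Re (f t) ^ 2 + Im (f t) ^ 2) = f t * Cconj (f t))%C.
    by case: (f t) => u v; apply: C_eq; rewrite /= /Re /Im /=; ring.
  field; split => //; move=> H.
  apply: Hz; move: H; rewrite /Cconj => H; case: H => H1 H2; apply: C_eq => /=; rewrite /Re /Im; lra.
split.
- apply: is_derive_eq; first exact: D1.
  move: N'; rewrite E /Cconj /= /Re /Im /=; case: (f t) => u v /= N'; field; lra.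
- apply: is_derive_eq; first exact: D2.
  move: N'; rewrite E /Cconj /= /Re /Im /=; case: (f t) => u v /= N'; field; lra.
Qed.

Lemma rcd_scal c f t df : rcd f t df -> rcd (fun s => c * f s)%C t (c * df)%C.
Proof.
move=> H; apply: rcd_eq; first by apply: rcd_mult; [apply: rcd_const|exact: H].
by cring.
Qed.

(** Complex differentiability as total real differentiability together with the Cauchy-Riemann
    equations. This form composes directly with curves and can be checked on functions given by
    partial derivatives. *)
Definition cdiff (h : C -> C) (z l : C) : Prop :=
  differentiable_pt_lim (fun x y => Re (h (x, y))) (Re z) (Im z) (Re l) (- Im l) /\
  differentiable_pt_lim (fun x y => Im (h (x, y))) (Re z) (Im z) (Im l) (Re l).

Lemma rcd_comp_2d (f : R -> R -> R) (g : R -> C) t lx ly d :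
  differentiable_pt_lim f (Re (g t)) (Im (g t)) lx ly -> rcd g t d ->
  is_derive (fun s => f (Re (g s)) (Im (g s))) t (lx * Re d + ly * Im d).
Proof.
move=> H [H1 H2]; apply/is_derive_Reals; apply: derivable_pt_lim_comp_2d => //; exact/is_derive_Reals.
Qed.

Lemma rcd_comp h g t l d : cdiff h (g t) l -> rcd g t d -> rcd (fun s => h (g s)) t (l * d)%C.
Proof.
move=> [H1 H2] H; split.
- apply: is_derive_ext; last first.
    apply: is_derive_eq; first exact: (rcd_comp_2d _ _ _ _ _ _ H1 H).
    by rewrite /= /Re /Im; ring.
  by move=> s /=; case: (g s).
- apply: is_derive_ext; last first.
    apply: is_derive_eq; first exact: (rcd_comp_2d _ _ _ _ _ _ H2 H).
    by rewrite /= /Re /Im; ring.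
  by move=> s /=; case: (g s).
Qed.

Lemma Rabs_Re z : Rabs (Re z) <= Cmod z.
Proof. exact: re_le_Cmod. Qed.

Lemma Rabs_Im z : Rabs (Im z) <= Cmod z.
Proof. exact: Rle_trans (Rmax_r _ _) (Rmax_Cmod z). Qed.

Lemma Cmod_le_2max x y m : Rabs x <= m -> Rabs y <= m -> Cmod (x, y) <= 2 * m.
Proof.
move=> H1 H2; have := Cmod_2Rmax (x, y) => /=.
have : sqrt 2 <= 2 by rewrite -{2}(sqrt_square 2); [apply: sqrt_le_1; lra|lra].
have : Rmax (Rabs x) (Rabs y) <= m by apply: Rmax_lub.
have : 0 <= Rmax (Rabs x) (Rabs y) by apply: Rle_trans (Rmax_l _ _); apply: Rabs_pos.
have := sqrt_pos 2; nra.
Qed.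

Lemma Cmod_lt_2max x y m : Rabs x < m -> Rabs y < m -> Cmod (x, y) < 2 * m.
Proof.
move=> H1 H2; apply: Rle_lt_trans (Cmod_le_2max x y (Rmax (Rabs x) (Rabs y)) (Rmax_l _ _) (Rmax_r _ _)) _.
by have := Rmax_lub_lt _ _ _ H1 H2; lra.
Qed.

(** The real differentials are measured in the maximum norm, and a modulus is at most twice that
    norm; this is why [eps] and [del] are halved. *)
Lemma cdiff_eps h z l :
  (forall eps, 0 < eps -> exists del, 0 < del /\ forall k, Cmod k < del ->
     Cmod (h (z + k)%C - h z - l * k)%C <= eps * Cmod k) -> cdiff h z l.
Proof.
move=> H.
suff K : forall eps : posreal, locally_2d (fun u v =>
    Cmod (h (u, v) - h z - l * ((u, v) - z))%C
     <= eps * Rmax (Rabs (u - Re z)) (Rabs (v - Im z))) (Re z) (Im z).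
  split=> eps; case: (K eps) => del Hd; exists del => u v Hu Hv; apply: Rle_trans (Hd u v Hu Hv);
    [apply: Rle_trans (Rabs_Re _)|apply: Rle_trans (Rabs_Im _)]; right; f_equal;
    case: (z) => x y; rewrite /Re /Im /=; ring.
move=> eps; case: (H (eps / 2)); first by have := cond_pos eps; lra.
move=> del [Hd K]; have Hd2 : 0 < del / 2 by lra.
exists (mkposreal _ Hd2) => u v /= Hu Hv.
have E0 : forall p : C, (p = z + (p - z))%C by move=> p; ring.
have E := E0 (u, v).
have L : Cmod ((u, v) - z)%C <= 2 * Rmax (Rabs (u - Re z)) (Rabs (v - Im z)).
  apply: Rle_trans (Cmod_le_2max (u - Re z) (v - Im z) _ (Rmax_l _ _) (Rmax_r _ _)).
  by right; f_equal; case: (z) => x y; apply: C_eq; rewrite /= /Re /Im /=; ring.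
have L2 : Cmod ((u, v) - z)%C < del.
  apply: Rle_lt_trans L _; have : Rmax (Rabs (u - Re z)) (Rabs (v - Im z)) < del / 2 by apply: Rmax_lub_lt.
  lra.
rewrite {1}E; apply: Rle_trans (K _ L2) _.
have := cond_pos eps; nra.
Qed.

Lemma diff2_plus f g x y a b c d :
  differentiable_pt_lim f x y a b -> differentiable_pt_lim g x y c d ->
  differentiable_pt_lim (fun u v => f u v + g u v) x y (a + c) (b + d).
Proof.
move=> Hf Hg.
have H : differentiable_pt_lim (fun u v => u + v) (f x y) (g x y) 1 1.
  move=> eps; exists (mkposreal 1 Rlt_0_1) => u v _ _.
  rewrite (_ : u + v - _ - _ = 0); last by ring.
  rewrite Rabs_R0; apply: Rmult_le_pos; first by left; apply: cond_pos.
  by apply: Rle_trans (Rmax_l _ _); apply: Rabs_pos.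
have := differentiable_pt_lim_comp _ f g x y _ _ _ _ _ _ H Hf Hg.
by rewrite !Rmult_1_l.
Qed.

Lemma diff2_mult f g x y a b c d :
  differentiable_pt_lim f x y a b -> differentiable_pt_lim g x y c d ->
  differentiable_pt_lim (fun u v => f u v * g u v) x y (g x y * a + f x y * c) (g x y * b + f x y * d).
Proof.
move=> Hf Hg.
have H : differentiable_pt_lim (fun u v => u * v) (f x y) (g x y) (g x y) (f x y).
  move=> eps; exists eps => u v Hu Hv.
  rewrite (_ : u * v - _ - _ = (u - f x y) * (v - g x y)); last by ring.
  rewrite Rabs_mult; have := Rmax_r (Rabs (u - f x y)) (Rabs (v - g x y)).
  have := Rabs_pos (u - f x y); have := Rabs_pos (v - g x y).
  have := cond_pos eps; nra.
exact: (differentiable_pt_lim_comp _ f g x y _ _ _ _ _ _ H Hf Hg).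
Qed.

Lemma diff2_opp f x y a b :
  differentiable_pt_lim f x y a b -> differentiable_pt_lim (fun u v => - f u v) x y (- a) (- b).
Proof.
move=> Hf eps; case: (Hf eps) => del Hd; exists del => u v Hu Hv; move: (Hd u v Hu Hv).
by rewrite -(Rabs_Ropp (f u v - _ - _)) (_ : - (f u v - _ - _) = - f u v - - f x y - (- a * (u - x) + - b * (v - y))); last ring.
Qed.

Lemma diff2_eq f x y a b a' b' :
  differentiable_pt_lim f x y a b -> a = a' -> b = b' -> differentiable_pt_lim f x y a' b'.
Proof. by move=> H <- <-. Qed.

Lemma diff2_ext_loc f g x y a b :
  locally_2d (fun u v => f u v = g u v) x y ->
  differentiable_pt_lim f x y a b -> differentiable_pt_lim g x y a b.
Proof.
move=> L H eps; have E := locally_2d_singleton _ _ _ L.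
have := locally_2d_and _ _ _ _ L (H eps).
by apply: locally_2d_impl; apply: locally_2d_forall => u v [<- ]; rewrite -E.
Qed.

Lemma diff2_ext f g x y a b :
  (forall u v, f u v = g u v) -> differentiable_pt_lim f x y a b -> differentiable_pt_lim g x y a b.
Proof. by move=> E; apply: diff2_ext_loc; apply: locally_2d_forall. Qed.

Lemma diff2_const c x y : differentiable_pt_lim (fun _ _ => c) x y 0 0.
Proof.
move=> eps; exists (mkposreal 1 Rlt_0_1) => u v _ _.
rewrite (_ : c - _ - _ = 0); last by ring.
rewrite Rabs_R0; apply: Rmult_le_pos; first by left; apply: cond_pos.
by apply: Rle_trans (Rmax_l _ _); apply: Rabs_pos.
Qed.

Lemma cdiff_eq h z l l' : cdiff h z l -> l = l' -> cdiff h z l'.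
Proof. by move=> H <-. Qed.

Lemma cdiff_plus f g z a b : cdiff f z a -> cdiff g z b -> cdiff (fun u => f u + g u)%C z (a + b)%C.
Proof.
move=> [F1 F2] [G1 G2]; split.
- by apply: (diff2_eq _ _ _ _ _ _ _ (diff2_plus _ _ _ _ _ _ _ _ F1 G1)) => /=; rewrite /Re /Im //=; ring.
- by apply: (diff2_eq _ _ _ _ _ _ _ (diff2_plus _ _ _ _ _ _ _ _ F2 G2)) => /=; rewrite /Re /Im //=; ring.
Qed.

Lemma cdiff_mult f g z a b :
  cdiff f z a -> cdiff g z b -> cdiff (fun u => f u * g u)%C z (a * g z + f z * b)%C.
Proof.
case: z => x y [F1 F2] [G1 G2]; split.
- apply: (diff2_eq _ _ _ _ _ _ _ (diff2_plus _ _ _ _ _ _ _ _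
   (diff2_mult _ _ _ _ _ _ _ _ F1 G1) (diff2_opp _ _ _ _ _ (diff2_mult _ _ _ _ _ _ _ _ F2 G2)))) => /=; rewrite /Re /Im //=; ring.
- apply: (diff2_eq _ _ _ _ _ _ _ (diff2_plus _ _ _ _ _ _ _ _
   (diff2_mult _ _ _ _ _ _ _ _ F1 G2) (diff2_mult _ _ _ _ _ _ _ _ F2 G1))) => /=; rewrite /Re /Im //=; ring.
Qed.

Lemma cdiff_const c z : cdiff (fun _ => c) z 0%C.
Proof. by split; apply: (diff2_eq _ _ _ _ _ _ _ (diff2_const _ _ _)) => /=; ring. Qed.

Lemma cdiff_id z : cdiff (fun u => u) z 1%C.
Proof.
apply: cdiff_eps => eps He; exists 1; split; first lra.
move=> k _; rewrite (_ : (z + k - z - 1 * k = 0)%C); last by cring.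
by rewrite Cmod_0; apply: Rmult_le_pos; [lra|apply: Cmod_ge_0].
Qed.

(* The complex derivative as a total function, read off along the real axis. *)
Definition Cd (h : C -> C) (z : C) : C :=
  (Derive (fun x => Re (h (x, Im z))) (Re z), Derive (fun x => Im (h (x, Im z))) (Re z)).

Lemma rcd_horizontal t y : rcd (fun x => (x, y)) t 1%C.
Proof. by split; [apply: is_derive_id|apply: is_derive_const]. Qed.

Lemma Cd_correct h z l : cdiff h z l -> Cd h z = l.
Proof.
case: z => x y H; have [H1 H2] := rcd_comp h (fun u => (u, y)) x l 1%C H (rcd_horizontal x y).
apply: C_eq.
- by rewrite /Cd {1}/Re [fst _]/=; rewrite (is_derive_unique _ _ _ H1) /= /Re /Im; ring.
- by rewrite /Cd {1}/Im [snd _]/=; rewrite (is_derive_unique _ _ _ H2) /= /Re /Im; ring.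
Qed.

Definition disc (q : C) (r : R) (z : C) : Prop := Cmod (z - q) < r.

Lemma cdiff_ext_disc h g z l r : 0 < r -> (forall u, disc z r u -> h u = g u) -> cdiff h z l -> cdiff g z l.
Proof.
move=> Hr E; have Hr2 : 0 < r / 2 by lra.
have L : locally_2d (fun u v => h (u, v) = g (u, v)) (Re z) (Im z).
  exists (mkposreal _ Hr2) => u v /= Hu Hv; apply: E; rewrite /disc.
  have := Cmod_lt_2max _ _ _ Hu Hv; rewrite (_ : (u - Re z, v - Im z) = ((u, v) - z)%C); last first.
    by case: (z) => a b; apply: C_eq; rewrite /Re /Im /=; ring.
  lra.
by move=> [H1 H2]; split; [apply: diff2_ext_loc H1|apply: diff2_ext_loc H2];
  apply: locally_2d_impl L; apply: locally_2d_forall => u v ->.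
Qed.

(** * Complex power series *)

Definition is_cser (f : nat -> C) (v : C) : Prop :=
  is_series (fun n => Re (f n)) (Re v) /\ is_series (fun n => Im (f n)) (Im v).

Lemma le_div a b c : 0 < c -> a * c <= b -> a <= b / c.
Proof. by move=> Hc H; apply/Rle_div_r. Qed.

Lemma div_le a b c : 0 < c -> a <= b * c -> a / c <= b.
Proof. by move=> Hc H; apply/Rle_div_l. Qed.

Lemma is_series_zero : is_series (fun _ : nat => 0) 0.
Proof.
apply: (is_series_ext (fun n : nat => 0 * 0 ^ n)); first by move=> n; apply: Rmult_0_l.
have := is_series_scal 0 _ _ (is_series_geom 0 _); rewrite /scal /= /mult /= Rmult_0_l; apply.
by rewrite Rabs_R0; lra.
Qed.

Lemma is_cser_ext f g v : (forall n, f n = g n) -> is_cser f v -> is_cser g v.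
Proof. by move=> E [H1 H2]; split; [apply: is_series_ext H1|apply: is_series_ext H2] => n; rewrite E. Qed.

Lemma is_cser_unique f v w : is_cser f v -> is_cser f w -> v = w.
Proof.
move=> [H1 H2] [H3 H4]; apply: C_eq.
  by rewrite -(is_series_unique _ _ H1) -(is_series_unique _ _ H3).
by rewrite -(is_series_unique _ _ H2) -(is_series_unique _ _ H4).
Qed.

Lemma is_cser_plus f g v w : is_cser f v -> is_cser g w -> is_cser (fun n => f n + g n)%C (v + w)%C.
Proof. by move=> [H1 H2] [H3 H4]; split; [apply: (is_series_plus _ _ _ _ H1 H3)|apply: (is_series_plus _ _ _ _ H2 H4)]. Qed.

Lemma is_cser_scal c f v : is_cser f v -> is_cser (fun n => c * f n)%C (c * v)%C.
Proof.
move=> [H1 H2]; split.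
- exact: (is_series_minus _ _ _ _ (is_series_scal (Re c) _ _ H1) (is_series_scal (Im c) _ _ H2)).
- exact: (is_series_plus _ _ _ _ (is_series_scal (Re c) _ _ H2) (is_series_scal (Im c) _ _ H1)).
Qed.

Lemma is_cser_incr f v : is_cser (fun n => f (S n)) v -> is_cser f (v + f 0%nat)%C.
Proof. by move=> [H1 H2]; split; apply: is_series_decr_1; rewrite /plus /opp /=;
 rewrite (_ : forall a b, a + b + - b = a) //; move=> a b; ring. Qed.

Lemma ex_cser (f : nat -> C) (b : nat -> R) :
  (forall n, Cmod (f n) <= b n) -> ex_series b -> exists v, is_cser f v.
Proof.
move=> H Hb.
have [v1 H1] : ex_series (fun n => Re (f n)).
  by apply: ex_series_le Hb => n; apply: Rle_trans (Rabs_Re _) (H n).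
have [v2 H2] : ex_series (fun n => Im (f n)).
  by apply: ex_series_le Hb => n; apply: Rle_trans (Rabs_Im _) (H n).
by exists (v1, v2).
Qed.

Lemma is_series_abs_le (a b : nat -> R) (v B : R) :
  (forall n, Rabs (a n) <= b n) -> is_series a v -> is_series b B -> Rabs v <= B.
Proof.
move=> H Ha Hb; rewrite -(is_series_unique _ _ Ha) -(is_series_unique _ _ Hb).
have X : ex_series (fun n => Rabs (a n)).
  by apply: ex_series_le; [|exists B; exact: Hb] => n; rewrite /norm /= /abs /= Rabs_Rabsolu.
apply: Rle_trans (Series_Rabs _ X) _; apply: Series_le; last by exists B.
by move=> n; split; [apply: Rabs_pos|].
Qed.

Lemma is_cser_le f v b B : (forall n, Cmod (f n) <= b n) -> is_cser f v -> is_series b B -> Cmod v <= 2 * B.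
Proof.
move=> H [H1 H2] Hb; rewrite (surjective_pairing v); apply: Cmod_le_2max.
- by apply: (is_series_abs_le _ _ _ _ _ H1 Hb) => n; apply: Rle_trans (Rabs_Re _) (H n).
- by apply: (is_series_abs_le _ _ _ _ _ H2 Hb) => n; apply: Rle_trans (Rabs_Im _) (H n).
Qed.

(** The twice differentiated geometric series has the coefficients (n + 1)(n + 2), which dominate
    n^2. *)
Lemma ex_series_sqr_geom x : 0 <= x < 1 -> ex_series (fun n => INR n ^ 2 * x ^ n).
Proof.
move=> Hx.
have [-> |Hx0] : x = 0 \/ 0 < x by lra.
  by exists 0; apply: is_series_ext is_series_zero; case=> [|n] /=; ring.
have R1 : CV_radius (fun _ => 1) = Finite 1.
  rewrite (CV_radius_finite_DAlembert (fun _ => 1) 1) ?Rinv_1 //; try lra.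
  by apply: is_lim_seq_ext (is_lim_seq_const 1) => n; rewrite Rdiv_1_r Rabs_R1.
have R2 : CV_radius (PS_derive (PS_derive (fun _ => 1))) = Finite 1 by rewrite !CV_radius_derive.
have H := CV_disk_inside (PS_derive (PS_derive (fun _ => 1))) x.
rewrite R2 in H; have {}H := H ltac:(rewrite /= Rabs_pos_eq; lra).
apply: ex_series_le H => n; rewrite /norm /= /abs /= /PS_derive.
have Hp : 0 <= x ^ n by apply: pow_le; lra.
have Hn := pos_INR n.
rewrite Rabs_pos_eq; last by nra.
rewrite Rabs_pos_eq; last by rewrite !S_INR; apply: Rmult_le_pos => //; nra.
by apply: Rmult_le_compat_r => //; rewrite !S_INR; nra.
Qed.

(** The derivative n z^(n-1) of z^n, generated by the product rule so that no exponent n - 1 has to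
    be read at n = 0. *)
Fixpoint dpow (z : C) (n : nat) : C :=
  match n with O => 0%C | S n => (dpow z n * z + z ^ n)%C end.

Lemma dpowS z n : dpow z (S n) = (RtoC (INR (S n)) * z ^ n)%C.
Proof.
elim: n => [|n IH]; first by rewrite /= ; cring.
rewrite [LHS]/= -/(dpow z (S n)) IH; rewrite (S_INR (S n)) RtoC_plus /=; cring.
Qed.

Lemma dpow_le z s n : Cmod z <= s -> Cmod (dpow z n) * s <= INR n * s ^ n.
Proof.
case: n => [|n] H; first by rewrite /= Cmod_0; lra.
rewrite dpowS Cmod_mult Cmod_R Cmod_pow Rabs_pos_eq; last exact: pos_INR.
have P : Cmod z ^ n <= s ^ n by apply: pow_incr; split => //; apply: Cmod_ge_0.
have Q : 0 <= Cmod z ^ n by apply: pow_le; apply: Cmod_ge_0.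
have S0 : 0 <= s by apply: Rle_trans H; apply: Cmod_ge_0.
have I := pos_INR (S n).
rewrite Rmult_assoc; apply: Rmult_le_compat_l => //=; nra.
Qed.

(** The remainder e_n obeys e_(n+1) = (z + k) e_n + n z^(n-1) k^2, and n^2 + n <= (n + 1)^2 closes
    the induction. The factor s^2 on the left replaces the exponent n - 2. *)
Lemma pow_taylor_le z k s n : Cmod z <= s -> Cmod (z + k) <= s ->
  s ^ 2 * Cmod ((z + k) ^ n - z ^ n - dpow z n * k)%C <= INR n ^ 2 * s ^ n * Cmod k ^ 2.
Proof.
move=> H1 H2; have S0 : 0 <= s by apply: Rle_trans H1; apply: Cmod_ge_0.
elim: n => [|n IH].
  rewrite (_ : ((z + k) ^ 0 - z ^ 0 - dpow z 0 * k = 0)%C); last by rewrite /=; cring.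
  by rewrite Cmod_0 /=; lra.
rewrite (_ : ((z + k) ^ S n - z ^ S n - dpow z (S n) * k =
  (z + k) * ((z + k) ^ n - z ^ n - dpow z n * k) + dpow z n * (k * k))%C); last by rewrite /=; cring.
move: IH; set e := Cmod (_ - _ - _)%C => IH.
have T := Cmod_triangle ((z + k) * ((z + k) ^ n - z ^ n - dpow z n * k))%C (dpow z n * (k * k))%C.
move: T; rewrite !Cmod_mult -/e => T.
have D := dpow_le z s n H1.
have E0 : 0 <= e by apply: Cmod_ge_0.
have K0 := Cmod_ge_0 k. have ZK0 := Cmod_ge_0 (z + k)%C.
have P0 : 0 <= s ^ n by apply: pow_le.
have N0 := pos_INR n.
apply: Rle_trans (Rmult_le_compat_l _ _ _ _ T) _; first by nra.
have A1 : s ^ 2 * (Cmod (z + k) * e) <= s * (INR n ^ 2 * s ^ n * Cmod k ^ 2).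
  have -> : s ^ 2 * (Cmod (z + k) * e) = Cmod (z + k) * (s ^ 2 * e) by ring.
  apply: Rle_trans (Rmult_le_compat_l _ _ _ ZK0 IH) _.
  apply: Rmult_le_compat_r => //; repeat apply: Rmult_le_pos => //; nra.
have A2 : s ^ 2 * (Cmod (dpow z n) * (Cmod k * Cmod k)) <= s * (INR n * s ^ n * Cmod k ^ 2).
  have -> : s ^ 2 * (Cmod (dpow z n) * (Cmod k * Cmod k)) = s * ((Cmod (dpow z n) * s) * Cmod k ^ 2) by ring.
  apply: Rmult_le_compat_l => //; apply: Rmult_le_compat_r => //; nra.
have A3 : 0 <= s * (s ^ n * Cmod k ^ 2) by repeat apply: Rmult_le_pos => //; nra.
rewrite S_INR [s ^ S n]/=; nra.
Qed.

(** The bound on the coefficients is carried along because it gives absolute convergence inside the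
    disc and passes to the derived series on a smaller disc. *)
Definition has_pseries (q : C) (r M : R) (c : nat -> C) (h : C -> C) : Prop :=
  0 < r /\ (forall n, Cmod (c n) * r ^ n <= M) /\
  forall z, disc q r z -> is_cser (fun n => c n * (z - q) ^ n)%C (h z).

Lemma coef_le (c : nat -> C) r M n : 0 < r -> Cmod (c n) * r ^ n <= M -> Cmod (c n) <= M / r ^ n.
Proof. by move=> Hr H; apply: le_div => //; apply: pow_lt. Qed.

(** With s strictly between |z - q| and r, the second order remainders of the terms are dominated by
    a multiple of n^2 (s / r)^n, so the total remainder is O(|k|^2). *)
Lemma has_pseries_cdiff q r M c h : has_pseries q r M c h ->
  forall z, disc q r z -> exists l, is_cser (fun n => RtoC (INR (S n)) * c (S n) * (z - q) ^ n)%C l /\ cdiff h z l.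
Proof.
move=> [Hr [HM Hs]] z; rewrite /disc => Hz.
have M0 : 0 <= M by apply: Rle_trans (HM 0%nat); rewrite /= Rmult_1_r; apply: Cmod_ge_0.
pose s := (Cmod (z - q) + r) / 2.
have Z0 := Cmod_ge_0 (z - q).
have s1 : Cmod (z - q) < s by rewrite /s; lra.
have s2 : s < r by rewrite /s; lra.
have s0 : 0 < s by lra.
pose x := s / r.
have Hx : 0 <= x < 1.
  by split; [apply: Rlt_le; apply: Rdiv_lt_0_compat; lra|apply/Rlt_div_l; lra].
have Ex : forall n, M / r ^ n * s ^ n = M * x ^ n.
  move=> n; rewrite /x /Rdiv Rpow_mult_distr pow_inv; ring.
have [B HB] := ex_series_sqr_geom x Hx.
have B0 : 0 <= B.
  apply: Rle_trans (is_series_abs_le (fun _ => 0) _ 0 B _ is_series_zero HB); first by apply: Rabs_pos.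
  by move=> n; rewrite Rabs_R0; apply: Rmult_le_pos; [apply: pow2_ge_0|apply: pow_le; lra].
have cb : forall n, Cmod (c n) * s ^ n <= M * x ^ n.
  move=> n; rewrite -Ex; apply: Rmult_le_compat_r; first by apply: pow_le; lra.
  exact: coef_le.
have [l Hl] : exists l, is_cser (fun n => c n * dpow (z - q) n)%C l.
  apply: (ex_cser _ (fun n => M / s * (INR n ^ 2 * x ^ n))); last by exists (M / s * B); apply: is_series_scal HB.
  move=> n; rewrite Cmod_mult.
  have D := dpow_le (z - q)%C s n (Rlt_le _ _ s1).
  have I : INR n <= INR n ^ 2.
    case: (n) => [|m]; first by rewrite /=; lra.
    by rewrite S_INR; have := pos_INR m; nra.
  rewrite (_ : M / s * (INR n ^ 2 * x ^ n) = INR n ^ 2 * (M * x ^ n) / s); last by field; lra.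
  apply: le_div => //.
  rewrite Rmult_assoc; apply: Rle_trans (Rmult_le_compat_l _ _ _ (Cmod_ge_0 _) D) _.
  have : INR n * (Cmod (c n) * s ^ n) <= INR n ^ 2 * (M * x ^ n).
    apply: Rmult_le_compat => //; first exact: pos_INR.
    by apply: Rmult_le_pos; [apply: Cmod_ge_0|apply: pow_le; lra].
  lra.
exists l; split.
  have H0 : is_cser (fun n => c (S n) * dpow (z - q) (S n))%C l.
    case: Hl => L1 L2; split.
      apply: (is_series_incr_1 (fun n => Re (c n * dpow (z - q) n)%C)).
      by rewrite (_ : plus _ _ = Re l) //; rewrite /plus /= /Re /=; ring.
    apply: (is_series_incr_1 (fun n => Im (c n * dpow (z - q) n)%C)).
    by rewrite (_ : plus _ _ = Im l) //; rewrite /plus /= /Im /=; ring.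
  by apply: is_cser_ext H0 => n; rewrite dpowS; cring.
apply: cdiff_eps => eps He.
(* The first bound keeps z + k within distance s of q; the second makes the remainder 2 M B |k|^2 /
   s^2 at most eps |k|, with the summand 1 keeping the denominator positive. *)
pose del := Rmin (s - Cmod (z - q)) (eps * s ^ 2 / (2 * M * B + 1)).
have D0 : 0 < 2 * M * B + 1 by nra.
exists del; split.
  apply: Rmin_pos; first lra.
  by apply: Rdiv_lt_0_compat => //; apply: Rmult_lt_0_compat => //; nra.
move=> k Hk.
have k1 : Cmod k < s - Cmod (z - q) by apply: Rlt_le_trans Hk (Rmin_l _ _).
have k2 : Cmod k * (2 * M * B + 1) <= eps * s ^ 2.
  by apply/Rle_div_r => //; apply: Rlt_le; apply: Rlt_le_trans Hk (Rmin_r _ _).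
have zk : Cmod (z - q + k) <= s.
  by apply: Rle_trans (Cmod_triangle _ _) _; lra.
have Ezk : (z + k - q = z - q + k)%C by cring.
have Hzk : disc q r (z + k)%C by rewrite /disc Ezk; lra.
have S1 := Hs _ Hzk; have S2 := Hs _ Hz.
have S3 := is_cser_plus _ _ _ _ S1 (is_cser_plus _ _ _ _ (is_cser_scal (RtoC (-1)) _ _ S2) (is_cser_scal (- k)%C _ _ Hl)).
have E : forall n, (c n * (z + k - q) ^ n + (RtoC (-1) * (c n * (z - q) ^ n) + - k * (c n * dpow (z - q) n)) =
   c n * ((z - q + k) ^ n - (z - q) ^ n - dpow (z - q) n * k))%C.
  by move=> n; rewrite Ezk; cring.
have S4 := is_cser_ext _ _ _ E S3.
have BB : is_series (fun n => M * Cmod k ^ 2 / s ^ 2 * (INR n ^ 2 * x ^ n)) (M * Cmod k ^ 2 / s ^ 2 * B) by apply: is_series_scal HB.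
have : Cmod (h (z + k) - h z - l * k)%C <= 2 * (M * Cmod k ^ 2 / s ^ 2 * B).
  rewrite (_ : (h (z + k) - h z - l * k = h (z + k) + (RtoC (-1) * h z + - k * l))%C); last by cring.
  apply: (is_cser_le _ _ _ _ _ S4 BB) => n; rewrite Cmod_mult.
  have P := pow_taylor_le (z - q) k s n (Rlt_le _ _ s1) zk.
  rewrite (_ : M * Cmod k ^ 2 / s ^ 2 * (INR n ^ 2 * x ^ n) = INR n ^ 2 * (M * x ^ n) * Cmod k ^ 2 / s ^ 2); last by field; lra.
  apply: le_div; first by nra.
  rewrite Rmult_assoc (Rmult_comm _ (s ^ 2)).
  apply: Rle_trans (Rmult_le_compat_l _ _ _ (Cmod_ge_0 _) P) _.
  rewrite (_ : Cmod (c n) * (INR n ^ 2 * s ^ n * Cmod k ^ 2) = INR n ^ 2 * (Cmod (c n) * s ^ n) * Cmod k ^ 2); last by ring.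
  apply: Rmult_le_compat_r; first exact: pow2_ge_0.
  by apply: Rmult_le_compat_l => //; exact: pow2_ge_0.
move/Rle_trans; apply.
rewrite (_ : 2 * (M * Cmod k ^ 2 / s ^ 2 * B) = 2 * M * B * Cmod k * Cmod k / s ^ 2); last by field; lra.
apply: div_le; first nra.
have K0 := Cmod_ge_0 k; nra.
Qed.

Lemma INR_le_pow2 n : INR (S n) <= 2 ^ n.
Proof.
elim: n => [|n IH]; first by rewrite /=; lra.
rewrite S_INR; have : 1 <= 2 ^ n by apply: pow_R1_Rle; lra.
by rewrite [2 ^ S n]/=; lra.
Qed.

(** Halving the radius pays for the new factor: n + 1 <= 2^n. *)
Lemma has_pseries_Cd q r M c h : has_pseries q r M c h ->
  has_pseries q (r / 2) (M / r) (fun n => RtoC (INR (S n)) * c (S n))%C (Cd h).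
Proof.
move=> H; have [Hr [HM Hs]] := H; split; first lra; split.
  move=> n; rewrite Cmod_mult Cmod_R Rabs_pos_eq; last exact: pos_INR.
  apply: le_div => //.
  apply: Rle_trans (HM (S n)).
  rewrite (_ : (r / 2) ^ n = r ^ n / 2 ^ n); last by rewrite /Rdiv Rpow_mult_distr pow_inv.
  have P2 : 0 < 2 ^ n by apply: pow_lt; lra.
  rewrite (_ : INR (S n) * Cmod (c (S n)) * (r ^ n / 2 ^ n) * r = INR (S n) / 2 ^ n * (Cmod (c (S n)) * r ^ S n)); last by rewrite /=; field; lra.
  rewrite -{2}(Rmult_1_l (Cmod (c (S n)) * r ^ S n)); apply: Rmult_le_compat_r.
    by apply: Rmult_le_pos; [apply: Cmod_ge_0|apply: pow_le; lra].
  by apply: div_le => //; rewrite Rmult_1_l; apply: INR_le_pow2.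
move=> z Hz; have Hz' : disc q r z by move: Hz; rewrite /disc; lra.
have [l [Hl Hd]] := has_pseries_cdiff _ _ _ _ _ H z Hz'.
by rewrite (Cd_correct _ _ _ Hd).
Qed.

Lemma has_pseries_center q r M c h : has_pseries q r M c h -> h q = c 0%nat.
Proof.
move=> [Hr [HM Hs]].
have Hq : disc q r q by rewrite /disc (_ : (q - q = 0)%C); [rewrite Cmod_0|cring].
apply: (is_cser_unique _ _ _ (Hs q Hq)).
have E : (c 0%nat = 0 + c 0%nat * (q - q) ^ 0)%C by rewrite /=; cring.
rewrite {1}E; apply: (is_cser_incr (fun n => c n * (q - q) ^ n)%C).
apply: (is_cser_ext (fun _ => 0%C)); first by move=> n; rewrite /=; cring.
by split; exact: is_series_zero.
Qed.

Fixpoint Cdn (k : nat) (h : C -> C) : C -> C := match k with O => h | S k => Cdn k (Cd h) end.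

(** Passing to [Cd h] shifts the coefficients down by one. The radius is halved each time, but only
    k times, and the constant term needs no particular radius. *)
Lemma flat_coef k : forall q r M c h, has_pseries q r M c h -> (forall j, Cdn j h q = 0%C) -> c k = 0%C.
Proof.
elim: k => [|k IH] q r M c h H F.
  by rewrite -(has_pseries_center _ _ _ _ _ H); apply: (F 0%nat).
have E := IH _ _ _ _ _ (has_pseries_Cd _ _ _ _ _ H) (fun j => F (S j)).
have N : RtoC (INR (S k)) <> 0%C by move/RtoC_inj; apply: not_0_INR.
rewrite (_ : c (S k) = / RtoC (INR (S k)) * (RtoC (INR (S k)) * c (S k)))%C; last by field.
by rewrite E; ring.
Qed.

Lemma flat_zero q r M c h : has_pseries q r M c h -> (forall j, Cdn j h q = 0%C) ->
  forall z, disc q r z -> h z = 0%C.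
Proof.
move=> H F z Hz; have [Hr [HM Hs]] := H.
apply: (is_cser_unique _ _ _ (Hs z Hz)).
apply: (is_cser_ext (fun _ => 0%C)); first by move=> n; rewrite (flat_coef n _ _ _ _ _ H F); ring.
by split; exact: is_series_zero.
Qed.

(** * Cauchy formula on circles *)

Notation openU U := (open (T := prod_UniformSpace R_UniformSpace R_UniformSpace) U).
Notation connU U := (connected (T := prod_UniformSpace R_UniformSpace R_UniformSpace) U).

Ltac rring := match goal with |- ?a = ?b => change (@eq R a b); ring end.

Definition ccont (h : C -> C) (z : C) : Prop :=
  continuous (fun p : R * R => Re (h (fst p, snd p))) (Re z, Im z) /\
  continuous (fun p : R * R => Im (h (fst p, snd p))) (Re z, Im z).

Definition rcont (w : R -> C) (t : R) : Prop :=
  continuous (fun s => Re (w s)) t /\ continuous (fun s => Im (w s)) t.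

(** Continuity of the derivative is included so that one may differentiate under the integral sign
    in the proof of the Cauchy formula. *)
Definition hol1 (U : C -> Prop) (h : C -> C) : Prop :=
  forall z, U z -> cdiff h z (Cd h z) /\ ccont (Cd h) z.

Lemma rcd_rcont g t d : rcd g t d -> rcont g t.
Proof. by move=> [H1 H2]; split; apply: ex_derive_continuous; eexists; eassumption. Qed.

Lemma diff2_continuous f x y a b :
  differentiable_pt_lim f x y a b -> continuous (fun p : R * R => f (fst p) (snd p)) (x, y).
Proof.
move=> H; apply/continuity_2d_pt_filterlim; apply: differentiable_continuity_pt.
by exists a, b.
Qed.

Lemma cdiff_ccont h z l : cdiff h z l -> ccont h z.
Proof. by move=> [H1 H2]; split; [apply: (diff2_continuous _ _ _ _ _ H1)|apply: (diff2_continuous _ _ _ _ _ H2)]. Qed.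

Definition CInt (w : R -> C) : C :=
  (RInt (fun t => Re (w t)) 0 (2 * PI), RInt (fun t => Im (w t)) 0 (2 * PI)).

Lemma rcont_ex_RInt w : (forall t, rcont w t) ->
  ex_RInt (fun t => Re (w t)) 0 (2 * PI) /\ ex_RInt (fun t => Im (w t)) 0 (2 * PI).
Proof. by move=> H; split; apply: ex_RInt_continuous => t _; case: (H t). Qed.

Lemma rcont_ext f g t : (forall s, f s = g s) -> rcont f t -> rcont g t.
Proof. by move=> E [H1 H2]; split; [apply: continuous_ext H1|apply: continuous_ext H2] => s; rewrite E. Qed.

Lemma rcont_plus f g t : rcont f t -> rcont g t -> rcont (fun s => f s + g s)%C t.
Proof. by move=> [? ?] [? ?]; split; apply: (continuous_plus (V := R_NormedModule)). Qed.

Lemma rcont_mult f g t : rcont f t -> rcont g t -> rcont (fun s => f s * g s)%C t.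
Proof.
move=> [? ?] [? ?]; split.
  by apply: (continuous_minus (V := R_NormedModule)); apply: (continuous_mult (K := R_AbsRing)).
by apply: (continuous_plus (V := R_NormedModule)); apply: (continuous_mult (K := R_AbsRing)).
Qed.

Lemma rcont_const c t : rcont (fun _ => c) t.
Proof. by split; apply: continuous_const. Qed.

Lemma CInt_ext f g : (forall t, f t = g t) -> CInt f = CInt g.
Proof. by move=> E; rewrite /CInt; congr pair; apply: RInt_ext => t _; rewrite E. Qed.

Lemma CInt_plus f g : (forall t, rcont f t) -> (forall t, rcont g t) ->
  CInt (fun t => f t + g t)%C = (CInt f + CInt g)%C.
Proof.
move=> /rcont_ex_RInt [F1 F2] /rcont_ex_RInt [G1 G2]; apply: C_eq.
  exact: (RInt_plus (V := R_CompleteNormedModule) _ _ _ _ F1 G1).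
exact: (RInt_plus (V := R_CompleteNormedModule) _ _ _ _ F2 G2).
Qed.

Lemma CInt_scal c f : (forall t, rcont f t) -> CInt (fun t => c * f t)%C = (c * CInt f)%C.
Proof.
move=> /rcont_ex_RInt [F1 F2].
have S : forall k g, ex_RInt g 0 (2 * PI) -> RInt (fun t => k * g t) 0 (2 * PI) = k * RInt g 0 (2 * PI).
  by move=> k g Hg; apply: (RInt_scal (V := R_CompleteNormedModule)).
have X : forall k g, ex_RInt g 0 (2 * PI) -> ex_RInt (fun t => k * g t) 0 (2 * PI).
  by move=> k g Hg; apply: (ex_RInt_scal (V := R_CompleteNormedModule)).
apply: C_eq.
  rewrite [LHS]/= (RInt_minus (V := R_CompleteNormedModule) (fun t => Re c * Re (f t)) (fun t => Im c * Im (f t))); try exact: X.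
  by rewrite !S.
rewrite [LHS]/= (RInt_plus (V := R_CompleteNormedModule) (fun t => Re c * Im (f t)) (fun t => Im c * Re (f t))); try exact: X.
by rewrite !S.
Qed.

Lemma CInt_derive W w : (forall t, rcd W t (w t)) -> (forall t, rcont w t) -> W 0 = W (2 * PI) -> CInt w = 0%C.
Proof.
move=> D Cw E; apply: C_eq; apply: is_RInt_unique.
  have := is_RInt_derive (fun t => Re (W t)) (fun t => Re (w t)) 0 (2 * PI) (fun t _ => proj1 (D t)) (fun t _ => proj1 (Cw t)).
  by rewrite E /minus plus_opp_r.
have := is_RInt_derive (fun t => Im (W t)) (fun t => Im (w t)) 0 (2 * PI) (fun t _ => proj2 (D t)) (fun t _ => proj2 (Cw t)).
by rewrite E /minus plus_opp_r.
Qed.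

Definition cis (t : R) : C := (cos t, sin t).

Lemma rcd_cis t : rcd cis t (Ci * cis t)%C.
Proof.
split; rewrite /cis /Re /Im /=.
  by apply: is_derive_eq; [apply: is_derive_cos|ring].
by apply: is_derive_eq; [apply: is_derive_sin|ring].
Qed.

Lemma Cmod_cis t : Cmod (cis t) = 1.
Proof. by rewrite /Cmod /= !Rmult_1_r -sqrt_1; congr sqrt; have := sin2_cos2 t; rewrite /Rsqr; lra. Qed.

Lemma cis_period : cis 0 = cis (2 * PI).
Proof. by rewrite /cis cos_0 sin_0 cos_2PI sin_2PI. Qed.

Lemma cis_neq0 t : cis t <> 0%C.
Proof. by move=> H; have := Cmod_cis t; rewrite H Cmod_0; lra. Qed.

Lemma is_lim_seq_geom_le (a : nat -> R) l B x : 0 <= x < 1 ->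
  (forall n, Rabs (a n - l) <= B * x ^ n) -> is_lim_seq a l.
Proof.
move=> Hx H.
have G : is_lim_seq (fun n => B * x ^ n) 0.
  have := is_lim_seq_scal_l _ B _ (is_lim_seq_geom x _).
  by rewrite /= Rmult_0_r; apply; rewrite Rabs_pos_eq; lra.
have Z : is_lim_seq (fun n => a n - l) 0.
  apply/is_lim_seq_abs_0; apply: (is_lim_seq_le_le (fun _ => 0) _ _ _ _ (is_lim_seq_const 0) G) => n.
  by split; [apply: Rabs_pos|apply: H].
apply: (is_lim_seq_ext (fun n => a n - l + l)); first by move=> n; ring.
by have := is_lim_seq_plus' _ _ _ _ Z (is_lim_seq_const l); rewrite Rplus_0_l.
Qed.

Fixpoint csum (f : nat -> C) (n : nat) : C :=
  match n with O => 0%C | S n => (csum f n + f n)%C end.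

Lemma csumS f n : csum f (S n) = (csum f n + f n)%C.
Proof. by []. Qed.

Lemma csum_sum_n f n : Re (csum f (S n)) = sum_n (fun k => Re (f k)) n /\ Im (csum f (S n)) = sum_n (fun k => Im (f k)) n.
Proof.
elim: n => [|n [IH1 IH2]]; first by rewrite !sum_O /= /Re /Im /=; split; ring.
by rewrite !sum_Sn -IH1 -IH2.
Qed.

Lemma is_cser_geom_le f v B x : 0 <= x < 1 -> (forall n, Cmod (v - csum f n)%C <= B * x ^ n) -> is_cser f v.
Proof.
move=> Hx H.
have B0 : 0 <= B.
  by apply: Rle_trans (Cmod_ge_0 _) _; last by (apply: Rle_trans (H 0%nat) _; rewrite /=; lra).
have K : forall n, Cmod (csum f (S n) - v)%C <= B * x ^ n.
  move=> n; rewrite -Cmod_opp (_ : (- (csum f (S n) - v) = v - csum f (S n))%C); last by ring.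
  apply: Rle_trans (H (S n)) _; apply: Rmult_le_compat_l => //=.
  by have Xn : 0 <= x ^ n; [apply: pow_le; lra|nra].
split; apply: (is_lim_seq_geom_le _ _ B x Hx) => n; apply: Rle_trans (K n).
  by apply: Rle_trans (Rabs_Re _); rewrite -(proj1 (csum_sum_n f n)); right.
by apply: Rle_trans (Rabs_Im _); rewrite -(proj2 (csum_sum_n f n)); right.
Qed.

Lemma rcont_bounded w : (forall t, rcont w t) -> exists m, 0 <= m /\ forall t, 0 <= t <= 2 * PI -> Cmod (w t) <= m.
Proof.
move=> H; have P := PI_RGT_0.
have B : forall f, (forall t, continuous f t) -> exists m, forall t, 0 <= t <= 2 * PI -> Rabs (f t) <= m.
  move=> f Hf.
  have [M [HM _]] := continuity_ab_maj (fun t => Rabs (f t)) 0 (2 * PI) ltac:(lra) (fun t _ => proj2 (continuity_pt_filterlim _ _) (continuous_comp f Rabs t (Hf t) (continuous_Rabs _))).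
  by exists (Rabs (f M)).
have [m1 H1] := B _ (fun t => proj1 (H t)); have [m2 H2] := B _ (fun t => proj2 (H t)).
exists (2 * Rmax (Rabs m1) (Rabs m2)); split.
  by apply: Rmult_le_pos; [lra|apply: Rle_trans (Rmax_l _ _); apply: Rabs_pos].
move=> t Ht; rewrite (surjective_pairing (w t)); apply: Cmod_le_2max.
  by apply: Rle_trans (Rmax_l _ _); apply: Rle_trans (H1 t Ht) (Rle_abs _).
by apply: Rle_trans (Rmax_r _ _); apply: Rle_trans (H2 t Ht) (Rle_abs _).
Qed.

Lemma CInt_le f m : (forall t, rcont f t) -> (forall t, 0 <= t <= 2 * PI -> Cmod (f t) <= m) -> Cmod (CInt f) <= 2 * (2 * PI * m).
Proof.
move=> /rcont_ex_RInt [F1 F2] H; have P := PI_RGT_0.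
by apply: Cmod_le_2max; (apply: Rle_trans; [apply: (abs_RInt_le_const _ _ _ m) => //; [lra|
   move=> t Ht; apply: Rle_trans (H t _) => //; first [apply: Rabs_Re|apply: Rabs_Im]]|lra]).
Qed.

Lemma ccont_comp_2d (h : C -> C) (P : R * R -> C) p :
  ccont h (P p) -> continuous (fun u => Re (P u)) p -> continuous (fun u => Im (P u)) p ->
  continuous (fun u => Re (h (P u))) p /\ continuous (fun u => Im (h (P u))) p.
Proof.
move=> [H1 H2] P1 P2; split.
  apply: (continuous_ext (fun u => Re (h (Re (P u), Im (P u))))); first by move=> u; case: (P u).
  exact: (continuous_comp_2 _ _ (fun x y => Re (h (x, y))) p P1 P2 H1).
apply: (continuous_ext (fun u => Im (h (Re (P u), Im (P u))))); first by move=> u; case: (P u).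
exact: (continuous_comp_2 _ _ (fun x y => Im (h (x, y))) p P1 P2 H2).
Qed.

Lemma Csub_eq0 (a b : C) : (a - b = 0)%C -> a = b.
Proof. by move=> E; rewrite (_ : a = a - b + b)%C; [rewrite E; ring|ring]. Qed.

Lemma Cmult_integral (x y : C) : (x * y = 0)%C -> x = 0%C \/ y = 0%C.
Proof.
move=> H; have [X0|X0] := Classical_Prop.classic (x = 0%C); [by left|right].
by rewrite (_ : y = x * y / x)%C; [rewrite H; cfield|cfield].
Qed.

Lemma Ci_neq0 : Ci <> 0%C.
Proof. by move=> H; have := f_equal Im H; rewrite /=; lra. Qed.

Lemma CpowS (z : C) n : (z ^ S n = z * z ^ n)%C.
Proof. by []. Qed.

Section Cauchy.
Variables (h : C -> C) (R0 rho : R) (q : C).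
Hypothesis Hrho : 0 < rho < R0.
Hypothesis Hh : hol1 (disc q R0) h.

Let ze (t : R) : C := (RtoC rho * cis t)%C.

Local Lemma ze_norm t : Cmod (ze t) = rho.
Proof. by rewrite /ze Cmod_mult Cmod_cis Cmod_R Rabs_pos_eq; lra. Qed.

Local Lemma ze_neq0 t : ze t <> 0%C.
Proof. by move=> E; have := ze_norm t; rewrite E Cmod_0; lra. Qed.

Local Lemma rcd_ze t : rcd ze t (Ci * ze t)%C.
Proof.
apply: rcd_eq; first by apply: rcd_scal; apply: rcd_cis.
by rewrite /ze; cring.
Qed.

Local Lemma rcd_inv_pow n t : rcd (fun s => (/ ze s) ^ n)%C t (- RtoC (INR n) * Ci * (/ ze t) ^ n)%C.
Proof.
elim: n => [|n IH].
  by apply: rcd_eq; [apply: rcd_const|rewrite /=; cring].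
apply: rcd_eq; first by apply: (rcd_mult (fun s => / ze s)%C (fun s => (/ ze s) ^ n)%C); [apply: rcd_inv; [apply: rcd_ze|apply: ze_neq0]|apply: IH].
cbv beta; rewrite S_INR RtoC_plus CpowS; move: ((/ ze t) ^ n)%C (ze t) (ze_neq0 t) => X Y HY.
by cfield.
Qed.

(** An open interval around [0,1], needed for derivatives at its ends. With d = (R0 - rho) / (2 R0),
    |1 - s| + |s| stays below 1 + 2 d, and (1 + 2 d) rho < rho + 2 d R0 = R0 keeps the moving point
    in the disc. *)
Local Notation near01 s := (- ((R0 - rho) / (2 * R0)) < s < 1 + (R0 - rho) / (2 * R0)).

(** A homotopy contracting the circle of radius rho about q, at s = 1, to the point q + z, at s =
    0. *)
Let pt (z : C) (s t : R) : C := (q + (z + RtoC s * (ze t - z)))%C.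

Local Lemma pt_in z s t : Cmod z < rho -> near01 s ->
  disc q R0 (pt z s t).
Proof.
move=> Hz Hs; rewrite /disc /pt.
rewrite (_ : (q + (z + RtoC s * (ze t - z)) - q = RtoC (1 - s) * z + RtoC s * ze t)%C); last first.
  by rewrite RtoC_minus; cring.
apply: Rle_lt_trans (Cmod_triangle _ _) _.
rewrite (Cmod_mult _ z) (Cmod_mult _ (ze t)) !Cmod_R ze_norm.
have D : (R0 - rho) / (2 * R0) * (2 * R0) = R0 - rho by field; lra.
have Z0 := Cmod_ge_0 z; move: D Hs; set d := (R0 - rho) / (2 * R0) => D Hs.
have d0 : 0 < d by nra.
have : Rabs (1 - s) * Cmod z <= Rabs (1 - s) * rho by apply: Rmult_le_compat_l; [apply: Rabs_pos|lra].
have : Rabs (1 - s) + Rabs s < 1 + 2 * d by rewrite /Rabs; case: Rcase_abs; case: Rcase_abs; lra.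
nra.
Qed.

Local Lemma pt_cont z p : continuous (fun u : R * R => Re (pt z (fst u) (snd u))) p /\
  continuous (fun u : R * R => Im (pt z (fst u) (snd u))) p.
Proof.
have F1 : continuous (fun u : R * R => fst u) p by apply: continuous_fst.
have Fc : continuous (fun u : R * R => cos (snd u)) p.
  by apply: (continuous_comp snd cos); [apply: continuous_snd|apply: continuous_cos].
have Fs : continuous (fun u : R * R => sin (snd u)) p.
  by apply: (continuous_comp snd sin); [apply: continuous_snd|apply: continuous_sin].
have M : forall f g : R * R -> R, continuous f p -> continuous g p -> continuous (fun u => f u * g u) p.
  by move=> f g; apply: (continuous_mult (K := R_AbsRing)).
have A : forall f g : R * R -> R, continuous f p -> continuous g p -> continuous (fun u => f u + g u) p.
  by move=> f g; apply: (continuous_plus (V := R_NormedModule)).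
have K : forall c : R, continuous (fun _ : R * R => c) p by move=> c; apply: continuous_const.
split.
- apply: (continuous_ext (fun u => Re q + (Re z + fst u * (rho * cos (snd u) + - Re z)))).
    by move=> u; rewrite /pt /ze /cis /Re /Im /=; ring.
  by apply: (A _ _ (K _)); apply: (A _ _ (K _)); apply: (M _ _ F1); apply: (A _ _ (M _ _ (K _) Fc) (K _)).
- apply: (continuous_ext (fun u => Im q + (Im z + fst u * (rho * sin (snd u) + - Im z)))).
    by move=> u; rewrite /pt /ze /cis /Re /Im /=; ring.
  by apply: (A _ _ (K _)); apply: (A _ _ (K _)); apply: (M _ _ F1); apply: (A _ _ (M _ _ (K _) Fs) (K _)).
Qed.

Local Lemma ze_cont p : continuous (fun u : R * R => Re (ze (snd u))) p /\
  continuous (fun u : R * R => Im (ze (snd u))) p.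
Proof.
have [C1 C2] := rcd_rcont _ _ _ (rcd_ze (snd p)).
split; [apply: (continuous_comp snd (fun t => Re (ze t)))|apply: (continuous_comp snd (fun t => Im (ze t)))] => //;
  apply: continuous_snd.
Qed.

Section Point.
Variable z : C.
Hypothesis Hz : Cmod z < rho.

(** The Cauchy kernel d zeta / (i (zeta - z)) written in the angle. Its denominator cancels the
    factor [ze t - z] that the s-derivative of [pt] produces. *)
Let K (t : R) : C := (ze t / (ze t - z))%C.

Local Lemma den_neq0 t : (ze t - z <> 0)%C.
Proof.
by move/Csub_eq0 => E; have := ze_norm t; rewrite E; lra.
Qed.

Local Lemma K_cont t : rcont K t.
Proof.
apply: rcd_rcont; apply: rcd_mult; first by apply: rcd_ze.
by apply: rcd_inv; [apply: rcd_minus; [apply: rcd_ze|apply: rcd_const]|apply: den_neq0].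
Qed.

Local Lemma K_step t : K t = (1 + z * (/ ze t * K t))%C.
Proof. by rewrite /K; field; split; [apply: den_neq0|apply: ze_neq0]. Qed.

Local Lemma rcd_s s t : near01 s ->
  rcd (fun s => h (pt z s t) * K t)%C s (Cd h (pt z s t) * ze t)%C.
Proof.
move=> Hs; have [D _] := Hh _ (pt_in z s t Hz Hs).
apply: rcd_eq.
  apply: rcd_mult; last exact: rcd_const.
  apply: (rcd_comp h (fun s => pt z s t) s _ _ D).
  by apply: rcd_plus; [apply: rcd_const|apply: rcd_plus; [apply: rcd_const|apply: rcd_mult; [apply: rcd_real; apply: is_derive_id|apply: rcd_const]]].
by rewrite /K /one /=; cfield; apply: den_neq0.
Qed.

Local Lemma dh_cont s t : near01 s ->
  continuous (fun u : R * R => Re (Cd h (pt z (fst u) (snd u)) * ze (snd u))%C) (s, t) /\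
  continuous (fun u : R * R => Im (Cd h (pt z (fst u) (snd u)) * ze (snd u))%C) (s, t).
Proof.
move=> Hs; have [_ Cc] := Hh _ (pt_in z s t Hz Hs).
have [P1 P2] := pt_cont z (s, t).
have [A1 A2] := ccont_comp_2d _ (fun u => pt z (fst u) (snd u)) (s, t) Cc P1 P2.
have [Z1 Z2] := ze_cont (s, t).
split.
  by apply: (continuous_minus (V := R_NormedModule)); apply: (continuous_mult (K := R_AbsRing)).
by apply: (continuous_plus (V := R_NormedModule)); apply: (continuous_mult (K := R_AbsRing)).
Qed.

Local Lemma section_cont (f : R * R -> R) s t : continuous f (s, t) -> continuous (fun t => f (s, t)) t.
Proof.
move=> H; apply: (continuous_comp_2 (fun _ => s) (fun t => t) (fun a b => f (a, b))).
- exact: continuous_const.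
- exact: continuous_id.
- by apply: continuous_ext H; case.
Qed.

Local Lemma dh_rcont s t : near01 s ->
  rcont (fun t => Cd h (pt z s t) * ze t)%C t.
Proof. by move=> Hs; have [H1 H2] := dh_cont s t Hs; split; [apply: (section_cont _ _ _ H1)|apply: (section_cont _ _ _ H2)]. Qed.

Local Lemma pt_rcd s t : rcd (fun t => pt z s t) t (RtoC s * (Ci * ze t))%C.
Proof.
apply: rcd_eq.
  apply: rcd_plus; first exact: rcd_const.
  apply: rcd_plus; first exact: rcd_const.
  by apply: rcd_scal; apply: rcd_minus; [apply: rcd_ze|apply: rcd_const].
by cring.
Qed.

Local Lemma h_rcont s t : near01 s ->
  rcont (fun t => h (pt z s t)) t.
Proof.
move=> Hs; have [D _] := Hh _ (pt_in z s t Hz Hs).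
by apply: rcd_rcont; apply: (rcd_comp h (fun t => pt z s t) t _ _ D (pt_rcd s t)).
Qed.

(** Up to the constant s i, the integrand is the angular derivative of the periodic function h(pt z
    s t). *)
Local Lemma dh_int s : near01 s ->
  CInt (fun t => Cd h (pt z s t) * ze t)%C = 0%C.
Proof.
move=> Hs.
have Zp : ze 0 = ze (2 * PI) by rewrite /ze cis_period.
have Ci2 := Ci_neq0.
(* The primitive divides by s. For s = 0 the value of [Cd h] is constant along the integral, and - i
   times the integrand is a primitive. *)
have [S0|S0] := Req_dec s 0.
  apply: (CInt_derive (fun t => - Ci * (Cd h (pt z s t) * ze t))%C); last by rewrite S0 /pt -Zp; congr (_ * (Cd h _ * _))%C; cring.
    move=> t; apply: (rcd_ext (fun t => - Ci * (Cd h (q + z) * ze t))%C).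
      by move=> u; rewrite S0 /pt; congr (_ * (Cd h _ * _))%C; cring.
    apply: rcd_eq; first by apply: rcd_scal; apply: rcd_scal; apply: rcd_ze.
    rewrite S0 /pt (_ : (q + (z + 0 * (ze t - z)) = q + z)%C); last by cring.
    rewrite (_ : (- Ci * (Cd h (q + z) * (Ci * ze t)) = - (Ci * Ci) * (Cd h (q + z) * ze t))%C); last by cring.
    by rewrite (_ : (Ci * Ci = - 1)%C); [cring|apply: C_eq; rewrite /Re /Im /=; ring].
  by move=> t; apply: dh_rcont.
apply: (CInt_derive (fun t => / (RtoC s * Ci) * h (pt z s t))%C); last by rewrite /pt -Zp.
  move=> t; have [D _] := Hh _ (pt_in z s t Hz Hs).
  apply: rcd_eq; first by apply: rcd_scal; apply: (rcd_comp h (fun t => pt z s t) t _ _ D (pt_rcd s t)).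
  by cfield; split => //; move/RtoC_inj.
by move=> t; apply: dh_rcont.
Qed.

Local Lemma hK_cont s t : near01 s ->
  rcont (fun t => h (pt z s t) * K t)%C t.
Proof. by move=> Hs; apply: rcont_mult; [apply: h_rcont|apply: K_cont]. Qed.

Local Lemma range_locally s : near01 s ->
  locally s (fun s => near01 s).
Proof.
move=> [H1 H2]; apply: filter_and; [exact: (open_gt _ s H1)|exact: (open_lt _ s H2)].
Qed.

Local Lemma CInt_moving s : near01 s ->
  rcd (fun s => CInt (fun t => h (pt z s t) * K t)%C) s 0%C.
Proof.
move=> Hs; have L := range_locally s Hs; have I := dh_int s Hs.
have Der1 : forall s t, near01 s ->
   Derive (fun s => Re (h (pt z s t) * K t)%C) s = Re (Cd h (pt z s t) * ze t)%C.
  by move=> u t Hu; apply: is_derive_unique; case: (rcd_s u t Hu).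
have Der2 : forall s t, near01 s ->
   Derive (fun s => Im (h (pt z s t) * K t)%C) s = Im (Cd h (pt z s t) * ze t)%C.
  by move=> u t Hu; apply: is_derive_unique; case: (rcd_s u t Hu).
have L2 : forall t, locally_2d (fun u v => near01 u) s t.
  by move=> t; case: L => d Hd; exists d => u v Hu _; apply: Hd.
split.
- apply: is_derive_eq.
    apply: (is_derive_RInt_param (fun s t => Re (h (pt z s t) * K t)%C)).
    + by apply: filter_imp L => u Hu t _; eexists; apply: (proj1 (rcd_s u t Hu)).
    + move=> t _.
      apply: (continuity_2d_pt_ext_loc (fun u v => Re (Cd h (pt z u v) * ze v)%C)).
        by have := L2 t; apply: locally_2d_impl; apply: locally_2d_forall => u v Hu; rewrite Der1.
      by apply/continuity_2d_pt_filterlim; apply: (proj1 (dh_cont s t Hs)).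
    + by apply: filter_imp L => u Hu; apply: (proj1 (rcont_ex_RInt _ (fun t => hK_cont u t Hu))).
  rewrite -[RHS](f_equal Re I) /CInt [RHS]/=; apply: RInt_ext => t _; exact: Der1.
- apply: is_derive_eq.
    apply: (is_derive_RInt_param (fun s t => Im (h (pt z s t) * K t)%C)).
    + by apply: filter_imp L => u Hu t _; eexists; apply: (proj2 (rcd_s u t Hu)).
    + move=> t _.
      apply: (continuity_2d_pt_ext_loc (fun u v => Im (Cd h (pt z u v) * ze v)%C)).
        by have := L2 t; apply: locally_2d_impl; apply: locally_2d_forall => u v Hu; rewrite Der2.
      by apply/continuity_2d_pt_filterlim; apply: (proj2 (dh_cont s t Hs)).
    + by apply: filter_imp L => u Hu; apply: (proj2 (rcont_ex_RInt _ (fun t => hK_cont u t Hu))).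
  rewrite -[RHS](f_equal Im I) /CInt [RHS]/=; apply: RInt_ext => t _; exact: Der2.
Qed.

(** The integral over the contracting circles has zero derivative in s, so its values at s = 1 and s
    = 0 agree. *)
Local Lemma Cauchy_const : CInt (fun t => h (q + ze t) * K t)%C = (h (q + z) * CInt K)%C.
Proof.
have d0 : 0 < (R0 - rho) / (2 * R0) by apply: Rdiv_lt_0_compat; lra.
have D : forall s, 0 <= s <= 1 -> rcd (fun s => CInt (fun t => h (pt z s t) * K t)%C) s 0%C.
  by move=> s Hs; apply: CInt_moving; lra.
have -> : CInt (fun t => h (q + ze t) * K t)%C = CInt (fun t => h (pt z 1 t) * K t)%C.
  by apply: CInt_ext => t; congr (h _ * _)%C; rewrite /pt; cring.
have -> : CInt (fun t => h (pt z 1 t) * K t)%C = CInt (fun t => h (pt z 0 t) * K t)%C.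
  apply: C_eq; symmetry.
    exact: (eq_is_derive (fun s => Re (CInt (fun t => h (pt z s t) * K t)%C)) 0 1 (fun s Hs => proj1 (D s Hs)) Rlt_0_1).
  exact: (eq_is_derive (fun s => Im (CInt (fun t => h (pt z s t) * K t)%C)) 0 1 (fun s Hs => proj2 (D s Hs)) Rlt_0_1).
rewrite -CInt_scal; last exact: K_cont.
by apply: CInt_ext => t; congr (h _ * _)%C; rewrite /pt; cring.
Qed.

(** Iterating K = 1 + (z / ze) K expands the kernel as a finite geometric sum with an explicit
    remainder. *)
Local Lemma kernel_expansion (g : R -> C) : (forall t, rcont g t) -> forall N,
  CInt (fun t => g t * K t)%C =
  (csum (fun n => CInt (fun t => g t * (/ ze t) ^ n) * z ^ n) N + z ^ N * CInt (fun t => g t * ((/ ze t) ^ N * K t)))%C.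
Proof.
move=> Hg.
have V : forall n t, rcont (fun s => (/ ze s) ^ n)%C t.
  by move=> n t; apply: rcd_rcont; apply: rcd_inv_pow.
elim=> [|N IH].
  by rewrite [csum _ _]/= Cplus_0_l [(z ^ 0)%C]/= Cmult_1_l; apply: CInt_ext => t /=; cring.
rewrite {}IH.
have -> : CInt (fun t => g t * ((/ ze t) ^ N * K t))%C =
   (CInt (fun t => g t * (/ ze t) ^ N) + z * CInt (fun t => g t * ((/ ze t) ^ S N * K t)))%C.
  rewrite -CInt_scal; last by move=> t; apply: rcont_mult => //; apply: rcont_mult; [apply: V|apply: K_cont].
  rewrite -CInt_plus; last first.
  - by move=> t; apply: rcont_mult; [apply: rcont_const|apply: rcont_mult => //; apply: rcont_mult; [apply: V|apply: K_cont]].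
  - by move=> t; apply: rcont_mult => //; apply: V.
  apply: CInt_ext => t; rewrite {1}K_step CpowS; cring.
by rewrite [csum _ (S N)]/= CpowS; cring.
Qed.

Local Lemma remainder_bound (g : R -> C) m : 0 <= m -> (forall t, rcont g t) ->
  (forall t, 0 <= t <= 2 * PI -> Cmod (g t * K t)%C <= m) ->
  forall N, Cmod (z ^ N * CInt (fun t => g t * ((/ ze t) ^ N * K t)))%C <= 2 * (2 * PI * m) * (Cmod z / rho) ^ N.
Proof.
move=> m0 Hg Hm N; rewrite Cmod_mult Cmod_pow /Rdiv Rpow_mult_distr.
have V : forall n t, rcont (fun s => (/ ze s) ^ n)%C t.
  by move=> n t; apply: rcd_rcont; apply: rcd_inv_pow.
rewrite (_ : 2 * (2 * PI * m) * (Cmod z ^ N * (/ rho) ^ N) = Cmod z ^ N * (2 * (2 * PI * ((/ rho) ^ N * m)))); last by ring.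
apply: Rmult_le_compat_l; first by apply: pow_le; apply: Cmod_ge_0.
apply: CInt_le.
  by move=> t; apply: rcont_mult => //; apply: rcont_mult; [apply: V|apply: K_cont].
move=> t Ht.
rewrite (_ : (g t * ((/ ze t) ^ N * K t) = (/ ze t) ^ N * (g t * K t))%C); last by cring.
rewrite Cmod_mult Cmod_pow Cmod_inv ?ze_norm; last exact: ze_neq0.
by apply: Rmult_le_compat_l; [apply: pow_le; apply: Rlt_le; apply: Rinv_0_lt_compat; lra|apply: Hm].
Qed.

Local Lemma ratio_range : 0 <= Cmod z / rho < 1.
Proof.
split; first by apply: Rmult_le_pos; [apply: Cmod_ge_0|apply: Rlt_le; apply: Rinv_0_lt_compat; lra].
by apply/Rlt_div_l; lra.
Qed.

(** The expansion with g = 1 has only its term n = 0: the powers ze^(-n), n > 0, have periodic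
    primitives. The remainder tends to 0. *)
Local Lemma CInt_kernel : CInt K = RtoC (2 * PI).
Proof.
have V : forall n t, rcont (fun s => (/ ze s) ^ n)%C t.
  by move=> n t; apply: rcd_rcont; apply: rcd_inv_pow.
have Z : forall n, CInt (fun t => 1 * (/ ze t) ^ S n)%C = 0%C.
  move=> n; apply: (CInt_derive (fun t => - / (RtoC (INR (S n)) * Ci) * (/ ze t) ^ S n)%C).
  - move=> t; apply: rcd_eq; first by apply: rcd_scal; apply: rcd_inv_pow.
    have N1 : RtoC (INR (S n)) <> 0%C by move/RtoC_inj; apply: not_0_INR.
    have N2 := Ci_neq0.
    move: ((/ ze t) ^ S n)%C => X; by cfield.
  - by move=> t; apply: rcont_mult; [apply: rcont_const|apply: V].
  - by rewrite /ze cis_period.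
have C0 : CInt (fun t => 1 * (/ ze t) ^ 0)%C = RtoC (2 * PI).
  apply: C_eq; rewrite /CInt /=.
    rewrite (RInt_ext _ (fun _ => 1)); last by move=> t _; rring.
    by rewrite RInt_const /scal /= /mult /=; rring.
  rewrite (RInt_ext _ (fun _ => 0)); last by move=> t _; rring.
  by rewrite RInt_const /scal /= /mult /=; rring.
have SN : forall N, csum (fun n => CInt (fun t => 1 * (/ ze t) ^ n) * z ^ n)%C (S N) = RtoC (2 * PI).
  elim=> [|N IH]; first by rewrite [csum _ _]/= C0 /=; cring.
  by rewrite csumS IH Z; cring.
have [m [m0 Hm]] := rcont_bounded (fun t => 1 * K t)%C (fun t => rcont_mult _ _ _ (rcont_const _ _) (K_cont t)).
have B := remainder_bound (fun _ => 1%C) m m0 (fun t => rcont_const _ t) Hm.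
have E := kernel_expansion (fun _ => 1%C) (fun t => rcont_const _ t).
have E1 : CInt K = CInt (fun t => 1 * K t)%C by apply: CInt_ext => t; cring.
have D : forall N, Cmod (CInt K - RtoC (2 * PI))%C <= 2 * (2 * PI * m) * (Cmod z / rho) ^ S N.
  move=> N; apply: Rle_trans (B (S N)); right; congr Cmod; rewrite E1 {1}(E (S N)) SN; cring.
have L0 : is_lim_seq (fun N => 2 * (2 * PI * m) * (Cmod z / rho) ^ S N) 0.
  have G := is_lim_seq_scal_l _ (2 * (2 * PI * m)) _ (is_lim_seq_geom (Cmod z / rho) ltac:(rewrite Rabs_pos_eq; have := ratio_range; lra)).
  by rewrite /= Rmult_0_r in G; apply: (proj1 (is_lim_seq_incr_1 (fun N => 2 * (2 * PI * m) * (Cmod z / rho) ^ N) _) G).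
have C1 : Cmod (CInt K - RtoC (2 * PI))%C <= 0.
  exact: (is_lim_seq_le (fun _ => Cmod (CInt K - RtoC (2 * PI))%C) _ (Finite _) (Finite 0) D (is_lim_seq_const _) L0).
have C2 : (CInt K - RtoC (2 * PI))%C = 0%C.
  by apply: Cmod_eq_0; apply: Rle_antisym => //; apply: Cmod_ge_0.
exact: Csub_eq0.
Qed.

Local Lemma Cauchy_series :
  is_cser (fun n => / RtoC (2 * PI) * CInt (fun t => h (q + ze t) * (/ ze t) ^ n) * z ^ n)%C (h (q + z)%C).
Proof.
have P : RtoC (2 * PI) <> 0%C by move/RtoC_inj; have := PI_RGT_0; lra.
have Hg : forall t, rcont (fun t => h (q + ze t)%C) t.
  move=> t; apply: (rcont_ext (fun t => h (pt z 1 t))); first by move=> s; congr h; rewrite /pt; cring.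
  by apply: h_rcont; have : 0 < (R0 - rho) / (2 * R0) by [apply: Rdiv_lt_0_compat; lra]; lra.
have [m [m0 Hm]] := rcont_bounded (fun t => h (q + ze t) * K t)%C (fun t => rcont_mult _ _ _ (Hg t) (K_cont t)).
have B := remainder_bound _ m m0 Hg Hm.
apply: (is_cser_geom_le _ _ (Cmod (/ RtoC (2 * PI)) * (2 * (2 * PI * m))) (Cmod z / rho)); first exact: ratio_range.
move=> N.
have SN : forall f c n, csum (fun n => c * f n * z ^ n)%C n = (c * csum (fun n => f n * z ^ n) n)%C.
  by move=> f c; elim=> [|n IH] /=; [cring|rewrite IH; cring].
rewrite SN.
have E := kernel_expansion _ Hg N; rewrite Cauchy_const CInt_kernel in E.
have -> : h (q + z)%C = (/ RtoC (2 * PI) * (h (q + z) * RtoC (2 * PI)))%C by field.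
rewrite E (_ : forall a b c, (c * (a + b) - c * a = c * b)%C); last by move=> a b c; cring.
by rewrite Cmod_mult Rmult_assoc; apply: Rmult_le_compat_l; [apply: Cmod_ge_0|apply: B].
Qed.
End Point.

(** The coefficients are the Cauchy integrals over the circle of radius rho; bounding h on that
    circle gives a single M for all n. *)
Lemma hol1_has_pseries : exists M c, has_pseries q rho M c h.
Proof.
have Hg : forall t, rcont (fun t => h (q + ze t)%C) t.
  move=> t; apply: (rcont_ext (fun t => h (pt 0 1 t))); first by move=> s; congr h; rewrite /pt; cring.
  apply: h_rcont; first by rewrite Cmod_0; lra.
  by have : 0 < (R0 - rho) / (2 * R0) by [apply: Rdiv_lt_0_compat; lra]; lra.
have [m [m0 Hm]] := rcont_bounded _ Hg.
exists (Cmod (/ RtoC (2 * PI)) * (2 * (2 * PI * m))), (fun n => / RtoC (2 * PI) * CInt (fun t => h (q + ze t) * (/ ze t) ^ n))%C.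
split; first by case: Hrho.
split.
  move=> n; rewrite Cmod_mult Rmult_assoc; apply: Rmult_le_compat_l; first exact: Cmod_ge_0.
  have rn : 0 < rho ^ n by apply: pow_lt; lra.
  have B : Cmod (CInt (fun t => h (q + ze t) * (/ ze t) ^ n))%C <= 2 * (2 * PI * (m * / rho ^ n)).
    apply: CInt_le; first by move=> t; apply: rcont_mult => //; apply: rcd_rcont; apply: rcd_inv_pow.
    move=> t Ht; rewrite Cmod_mult Cmod_pow Cmod_inv ?ze_norm; last exact: ze_neq0.
    rewrite pow_inv; apply: Rmult_le_compat_r; first by apply: Rlt_le; apply: Rinv_0_lt_compat.
    exact: Hm.
  apply: Rle_trans (Rmult_le_compat_r _ _ _ (Rlt_le _ _ rn) B) _; right; field; lra.
move=> z Hz; have := Cauchy_series _ Hz.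
by rewrite (_ : (q + (z - q) = z)%C); [|cring].
Qed.
End Cauchy.

(** * Identity theorem on regions *)

Lemma open_disc (U : C -> Prop) q : openU U -> U q ->
  exists r, 0 < r /\ forall z, disc q r z -> U z.
Proof.
move=> HU Hq; case: (HU q Hq) => eps He; exists eps; split; first exact: cond_pos.
move=> z Hz; apply: He; split; rewrite /ball /= /AbsRing_ball /abs /= /minus /plus /opp /=.
  by apply: Rle_lt_trans Hz; exact: (Rabs_Re (z - q)%C).
by apply: Rle_lt_trans Hz; exact: (Rabs_Im (z - q)%C).
Qed.

Lemma disc_open (U : C -> Prop) :
  (forall q, U q -> exists r, 0 < r /\ forall z, disc q r z -> U z) ->
  openU U.
Proof.
move=> H q Hq; case: (H q Hq) => r [Hr K].
have Hr2 : 0 < r / 2 by lra.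
exists (mkposreal _ Hr2) => z [B1 B2]; apply: K; rewrite /disc.
have := Cmod_lt_2max _ _ _ B1 B2; rewrite /minus /plus /opp /=.
rewrite (_ : (fst z + - fst q, snd z + - snd q) = (z - q)%C) //; lra.
Qed.

Lemma disc_center q r : 0 < r -> disc q r q.
Proof. by move=> Hr; rewrite /disc (_ : (q - q = 0)%C); [rewrite Cmod_0|cring]. Qed.

Lemma disc_sub q r z : disc q r z -> exists s, 0 < s /\ forall u, disc z s u -> disc q r u.
Proof.
rewrite /disc => H; exists (r - Cmod (z - q)); split; first lra.
move=> u Hu; rewrite (_ : (u - q = (u - z) + (z - q))%C); last by cring.
by apply: Rle_lt_trans (Cmod_triangle _ _) _; lra.
Qed.

Lemma ccont_disc h z : ccont h z -> forall eps, 0 < eps ->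
  exists r, 0 < r /\ forall u, disc z r u -> Cmod (h u - h z) < eps.
Proof.
move=> [H1 H2] eps He; have He2 : 0 < eps / 2 by lra.
have [d1 D1] := proj1 (filterlim_locally _ _) H1 (mkposreal _ He2).
have [d2 D2] := proj1 (filterlim_locally _ _) H2 (mkposreal _ He2).
exists (Rmin d1 d2); split; first by apply: Rmin_pos; apply: cond_pos.
move=> u Hu.
have K1 : Cmod (u - z) < d1 by apply: Rlt_le_trans Hu (Rmin_l _ _).
have K2 : Cmod (u - z) < d2 by apply: Rlt_le_trans Hu (Rmin_r _ _).
have B1 := D1 u (conj (Rle_lt_trans _ _ _ (Rabs_Re _) K1) (Rle_lt_trans _ _ _ (Rabs_Im _) K1)).
have B2 := D2 u (conj (Rle_lt_trans _ _ _ (Rabs_Re _) K2) (Rle_lt_trans _ _ _ (Rabs_Im _) K2)).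
have := Cmod_lt_2max _ _ _ B1 B2; rewrite /minus /plus /opp /=.
rewrite (_ : (Re (h (fst u, snd u)) + - _, _) = (h u - h z)%C); first by lra.
by case: (u) => a b; case: (z).
Qed.

Lemma ccont_ext_disc h g z r : 0 < r -> (forall u, disc z r u -> h u = g u) -> ccont h z -> ccont g z.
Proof.
move=> Hr E; have Hr2 : 0 < r / 2 by lra.
have L : locally ((Re z, Im z) : R * R) (fun u => h (fst u, snd u) = g (fst u, snd u)).
  exists (mkposreal _ Hr2) => u [B1 B2]; apply: E; rewrite /disc.
  have := Cmod_lt_2max _ _ _ B1 B2; rewrite /minus /plus /opp /=.
  by move=> K; apply: (Rlt_le_trans _ _ _ (K : Cmod ((fst u, snd u) - z)%C < 2 * (r / 2))); lra.
by move=> [H1 H2]; split; [apply: continuous_ext_loc H1|apply: continuous_ext_loc H2];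
  apply: filter_imp L => u ->.
Qed.

Lemma ccont_plus f g z : ccont f z -> ccont g z -> ccont (fun u => f u + g u)%C z.
Proof. by move=> [? ?] [? ?]; split; apply: (continuous_plus (V := R_NormedModule)). Qed.

Lemma ccont_mult f g z : ccont f z -> ccont g z -> ccont (fun u => f u * g u)%C z.
Proof.
move=> [? ?] [? ?]; split.
  by apply: (continuous_minus (V := R_NormedModule)); apply: (continuous_mult (K := R_AbsRing)).
by apply: (continuous_plus (V := R_NormedModule)); apply: (continuous_mult (K := R_AbsRing)).
Qed.

Lemma ccont_const c z : ccont (fun _ => c) z.
Proof. by split; apply: continuous_const. Qed.

Section Region.
Variable U : C -> Prop.
Hypothesis HU : openU U.

Lemma hol1_intro h h' : (forall z, U z -> cdiff h z (h' z)) -> (forall z, U z -> ccont h' z) -> hol1 U h.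
Proof.
move=> D K z Hz; rewrite (Cd_correct _ _ _ (D z Hz)); split; first exact: D.
have [r [Hr Hd]] := open_disc U z HU Hz.
by apply: (ccont_ext_disc h' _ z r Hr _ (K z Hz)) => u Hu; rewrite (Cd_correct _ _ _ (D u (Hd u Hu))).
Qed.

Lemma hol1_const c : hol1 U (fun _ => c).
Proof. by apply: (hol1_intro _ (fun _ => 0%C)) => z _; [apply: cdiff_const|apply: ccont_const]. Qed.

Lemma hol1_id : hol1 U (fun z => z).
Proof. by apply: (hol1_intro _ (fun _ => 1%C)) => z _; [apply: cdiff_id|apply: ccont_const]. Qed.

Lemma hol1_plus f g : hol1 U f -> hol1 U g -> hol1 U (fun z => f z + g z)%C.
Proof.
move=> F G; apply: (hol1_intro _ (fun z => Cd f z + Cd g z)%C) => z Hz;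
  case: (F z Hz) => ? ?; case: (G z Hz) => ? ?; by [apply: cdiff_plus|apply: ccont_plus].
Qed.

Lemma hol1_mult f g : hol1 U f -> hol1 U g -> hol1 U (fun z => f z * g z)%C.
Proof.
move=> F G; apply: (hol1_intro _ (fun z => Cd f z * g z + f z * Cd g z)%C) => z Hz;
  case: (F z Hz) => F1 F2; case: (G z Hz) => G1 G2; first exact: cdiff_mult.
by apply: ccont_plus; apply: ccont_mult => //; [apply: (cdiff_ccont _ _ _ G1)|apply: (cdiff_ccont _ _ _ F1)].
Qed.

Lemma hol1_analytic h q : hol1 U h -> U q -> exists r M c, has_pseries q r M c h.
Proof.
move=> H Hq; have [r [Hr Hd]] := open_disc U q HU Hq.
have [M [c K]] := hol1_has_pseries h r (r / 2) q ltac:(lra) (fun z Hz => H z (Hd z Hz)).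
by exists (r / 2), M, c.
Qed.

(** The power series is differentiated twice, since [hol1] also asks that the derivative of [Cd h]
    be continuous. *)
Lemma hol1_Cd h : hol1 U h -> hol1 U (Cd h).
Proof.
move=> H z Hz; have [r [M [c K]]] := hol1_analytic h z H Hz.
have K1 := has_pseries_Cd _ _ _ _ _ K; have K2 := has_pseries_Cd _ _ _ _ _ K1.
have [l1 [_ D1]] := has_pseries_cdiff _ _ _ _ _ K1 z (disc_center _ _ (proj1 K1)).
have [l2 [_ D2]] := has_pseries_cdiff _ _ _ _ _ K2 z (disc_center _ _ (proj1 K2)).
by split; [rewrite (Cd_correct _ _ _ D1)|apply: (cdiff_ccont _ _ _ D2)].
Qed.

Lemma hol1_Cdn j : forall h, hol1 U h -> hol1 U (Cdn j h).
Proof. by elim: j => [|j IH] h H //=; apply: IH; apply: hol1_Cd. Qed.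

Lemma Cdn_zero_disc j : forall (h : C -> C) q r, (forall z, disc q r z -> h z = 0%C) -> forall z, disc q r z -> Cdn j h z = 0%C.
Proof.
elim: j => [|j IH] h q r H z Hz; first exact: H.
apply: (IH (Cd h) q r) => // u Hu; apply: Cd_correct.
have [s [Hs Hd]] := disc_sub _ _ _ Hu.
apply: (cdiff_ext_disc (fun _ => 0%C) _ _ _ s Hs); last exact: cdiff_const.
by move=> v Hv; rewrite H //; apply: Hd.
Qed.

(** The points where all derivatives vanish form an open set by the power series, and the other
    points of U form an open set by continuity of the derivatives. *)
Lemma identity_flat (h : C -> C) p : connU U ->
  hol1 U h -> U p -> (forall j, Cdn j h p = 0%C) -> forall z, U z -> h z = 0%C.
Proof.
move=> conn H Hp Fp z Hz; apply: NNPP => Nz.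
apply: (conn (fun u => U u /\ forall j, Cdn j h u = 0%C) (fun u => U u /\ exists j, Cdn j h u <> 0%C)).
- apply: disc_open => q [Hq Fq]; have [r [M [c K]]] := hol1_analytic h q H Hq.
  have [s [Hs Hd]] := open_disc U q HU Hq.
  exists (Rmin r s); split; first by apply: Rmin_pos => //; case: K.
  move=> u Hu; split; first by apply: Hd; apply: Rlt_le_trans Hu (Rmin_r _ _).
  move=> j; apply: (Cdn_zero_disc j h q r); first exact: (flat_zero _ _ _ _ _ K Fq).
  by apply: Rlt_le_trans Hu (Rmin_l _ _).
- apply: disc_open => q [Hq [j Nq]].
  have [Dq _] := hol1_Cdn j h H q Hq.
  have [r [Hr Hd]] := ccont_disc _ _ (cdiff_ccont _ _ _ Dq) _ (proj1 (Cmod_gt_0 _) Nq).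
  have [s [Hs Hd2]] := open_disc U q HU Hq.
  exists (Rmin r s); split; first exact: Rmin_pos.
  move=> u Hu; split; first by apply: Hd2; apply: Rlt_le_trans Hu (Rmin_r _ _).
  exists j => E; have := Hd u (Rlt_le_trans _ _ _ Hu (Rmin_l _ _)).
  by rewrite E (_ : (0 - Cdn j h q = - Cdn j h q)%C); [rewrite Cmod_opp; lra|cring].
- move=> u Hu; have [F|F] := classic (forall j, Cdn j h u = 0%C); first by left.
  by right; split => //; apply: not_all_ex_not.
- by move=> u Hu [_ F] [_ [j N]]; apply: N.
- by exists p.
- by exists z; split => //; split => //; exists 0%nat.
Qed.

(** Differentiating h(g(t)) = 0 gives h'(g) g' = 0, and the velocity is not zero; so h' vanishes on
    the same arc. *)
Lemma arc_flat j : forall (h : C -> C) (g d : R -> C) a b, hol1 U h ->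
  (forall t, a < t < b -> U (g t) /\ rcd g t (d t) /\ d t <> 0%C /\ h (g t) = 0%C) ->
  forall t, a < t < b -> Cdn j h (g t) = 0%C.
Proof.
elim: j => [|j IH] h g d a b H A t Ht; first by have [_ [_ [_ ?]]] := A t Ht.
apply: (IH (Cd h) g d a b) => //; first exact: hol1_Cd.
move=> s Hs; have [A1 [A2 [A3 A4]]] := A s Hs; do ! split => //; try exact: A2.
have [D _] := H _ A1.
have R1 := rcd_comp h g s _ _ D A2.
have R2 : rcd (fun s => h (g s)) s 0%C.
  apply: (rcd_ext_loc (fun _ => 0%C)); last exact: rcd_const.
  have L : locally s (fun s => a < s < b) by apply: filter_and; [exact: (open_gt _ s (proj1 Hs))|exact: (open_lt _ s (proj2 Hs))].
  by apply: filter_imp L => u Hu; have [_ [_ [_ ->]]] := A u Hu.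
have E := rcd_unique _ _ _ _ R1 R2.
by rewrite (_ : Cd h (g s) = Cd h (g s) * d s / d s)%C; [rewrite E; cfield|cfield].
Qed.

Lemma identity_arc (h : C -> C) (g d : R -> C) a b : connU U ->
  hol1 U h -> a < b ->
  (forall t, a < t < b -> U (g t) /\ rcd g t (d t) /\ d t <> 0%C /\ h (g t) = 0%C) ->
  forall z, U z -> h z = 0%C.
Proof.
move=> conn H Hab A; have Hm : a < (a + b) / 2 < b by lra.
apply: (identity_flat h (g ((a + b) / 2)) conn H (proj1 (A _ Hm))) => j.
exact: (arc_flat j h g d a b H A).
Qed.

(** Radial segments inside a disc show that f is locally constant; connectedness does the rest. The
    hypothesis quantifies over all curves because the Wirtinger rules are stated along curves. *)
Lemma constant_on_region (f : C -> R) p z :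
  connU U ->
  (forall g t d, U (g t) -> rcd g t d -> is_derive (fun s => f (g s)) t 0) ->
  U p -> U z -> f z = f p.
Proof.
move=> conn D Hp Hz; apply: NNPP => Nz.
have L : forall q, U q -> exists r, 0 < r /\ forall u, disc q r u -> U u /\ f u = f q.
  move=> q Hq; have [r [Hr Hd]] := open_disc U q HU Hq; exists r; split => // u Hu; split; first exact: Hd.
  pose g := fun s : R => (q + RtoC s * (u - q))%C.
  have E0 : g 0 = q by rewrite /g; cring.
  have E1 : g 1 = u by rewrite /g; cring.
  rewrite -E1 -E0; symmetry; apply: (eq_is_derive (fun s => f (g s))); last exact: Rlt_0_1.
  move=> s Hs; apply: (D g s (u - q)%C).
    apply: Hd; rewrite /disc (_ : (g s - q = RtoC s * (u - q))%C); last by rewrite /g; cring.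
    rewrite Cmod_mult Cmod_R Rabs_pos_eq; last by lra.
    by apply: Rle_lt_trans Hu; have := Cmod_ge_0 (u - q); nra.
  apply: rcd_eq.
    apply: rcd_plus; first exact: rcd_const.
    by apply: rcd_mult; [apply: rcd_real; apply: is_derive_id|apply: rcd_const].
  by rewrite /one /=; cring.
apply: (conn (fun u => U u /\ f u = f p) (fun u => U u /\ f u <> f p)).
- apply: disc_open => q [Hq E]; have [r [Hr Hd]] := L q Hq; exists r; split => // u Hu.
  by have [? ->] := Hd u Hu.
- apply: disc_open => q [Hq E]; have [r [Hr Hd]] := L q Hq; exists r; split => // u Hu.
  by have [? ->] := Hd u Hu.
- by move=> u Hu; have [F|F] := classic (f u = f p); [left|right].
- by move=> u Hu [_ F] [_ N].
- by exists p.
- by exists z.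
Qed.

Lemma constant_on_region_C (f : C -> C) p z :
  connU U ->
  (forall g t d, U (g t) -> rcd g t d -> rcd (fun s => f (g s)) t 0%C) ->
  U p -> U z -> f z = f p.
Proof.
move=> conn D Hp Hz; apply: C_eq.
  apply: (constant_on_region (fun u => Re (f u))) => // g t d H1 H2; exact: (proj1 (D g t d H1 H2)).
apply: (constant_on_region (fun u => Im (f u))) => // g t d H1 H2; exact: (proj2 (D g t d H1 H2)).
Qed.
End Region.

(** * Wirtinger derivatives of a biharmonic function *)

Definition D1 (f : R -> R -> R) : R -> R -> R := fun x y => Derive (fun u => f u y) x.
Definition D2 (f : R -> R -> R) : R -> R -> R := fun x y => Derive (fun v => f x v) y.

Lemma diff2_D1 f x y a b : differentiable_pt_lim f x y a b -> D1 f x y = a.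
Proof. by case/differentiable_pt_lim_unique. Qed.

Lemma diff2_D2 f x y a b : differentiable_pt_lim f x y a b -> D2 f x y = b.
Proof. by case/differentiable_pt_lim_unique. Qed.

Lemma diff2_scal k f x y a b :
  differentiable_pt_lim f x y a b -> differentiable_pt_lim (fun u v => k * f u v) x y (k * a) (k * b).
Proof.
move=> H; apply: (diff2_eq _ _ _ _ _ _ _ (diff2_mult _ _ _ _ _ _ _ _ (diff2_const k x y) H)); ring.
Qed.

Lemma diff2_fst x y : differentiable_pt_lim (fun u v => u) x y 1 0.
Proof. by apply: differentiable_pt_lim_proj1_0; apply/is_derive_Reals; apply: is_derive_id. Qed.

Lemma diff2_snd x y : differentiable_pt_lim (fun u v => v) x y 0 1.
Proof.
move=> eps; exists (mkposreal 1 Rlt_0_1) => u v _ _.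
rewrite (_ : v - y - (0 * (u - x) + 1 * (v - y)) = 0); last by ring.
rewrite Rabs_R0; apply: Rmult_le_pos; first by left; apply: cond_pos.
by apply: Rle_trans (Rmax_l _ _); apply: Rabs_pos.
Qed.

(* With w the conjugate of z: dF = 2 Re (Fz dz), dFz = (w a + b) dz + L dw and dL = 2 Re (a dz), so that Fz, L, a
   and b are the Wirtinger derivatives F_z, F_zw, F_zzw and F_zz - w F_zzw. *)
Definition dF_rule (U : C -> Prop) (F : R -> R -> R) (Fz : C -> C) : Prop :=
  forall g t d, U (g t) -> rcd g t d -> is_derive (fun s => F (Re (g s)) (Im (g s))) t
    (2 * Re (Fz (g t) * d)%C).
Definition dFz_rule (U : C -> Prop) (Fz a b : C -> C) (L : C -> R) : Prop :=
  forall g t d, U (g t) -> rcd g t d -> rcd (fun s => Fz (g s)) t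
    ((Cconj (g t) * a (g t) + b (g t)) * d + RtoC (L (g t)) * Cconj d)%C.
Definition dL_rule (U : C -> Prop) (L : C -> R) (a : C -> C) : Prop :=
  forall g t d, U (g t) -> rcd g t d -> is_derive (fun s => L (g s)) t (2 * Re (a (g t) * d)%C).

Section Jets.
Variable U : R * R -> Prop.
Hypothesis HU : openU U.

Definition Ck (n : nat) (f : R -> R -> R) : Prop := forall x y, U (x, y) -> ex_diff_n f n x y.

Lemma U_locally_2d x y : U (x, y) -> locally_2d (fun u v => U (u, v)) x y.
Proof. by move=> H; apply/locally_2d_locally; apply: filter_imp (HU _ H); case. Qed.

Lemma Ck_D1 n f : Ck (S n) f -> Ck n (D1 f).
Proof. by move=> H x y Hxy; have [_ [_ [_ [? _]]]] := H x y Hxy. Qed.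

Lemma Ck_D2 n f : Ck (S n) f -> Ck n (D2 f).
Proof. by move=> H x y Hxy; have [_ [_ [_ [_ ?]]]] := H x y Hxy. Qed.

Lemma Ck_continuous n f x y : Ck n f -> U (x, y) -> continuity_2d_pt f x y.
Proof. by case: n => [|n] H Hxy; have [? _] := H x y Hxy. Qed.

Lemma Ck_diff n f x y : Ck (S n) f -> U (x, y) -> differentiable_pt_lim f x y (D1 f x y) (D2 f x y).
Proof.
move=> H Hxy; apply/filterdiff_differentiable_pt_lim.
apply: (is_derive_filterdiff f x y (D1 f)).
- have L := proj1 (locally_2d_locally _ _ _) (U_locally_2d x y Hxy).
  apply: filter_imp L => -[u v] Huv; apply: Derive_correct.
  by have [_ [? _]] := H u v Huv.
- by apply: Derive_correct; have [_ [_ [? _]]] := H x y Hxy.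
- by apply/continuity_2d_pt_filterlim; apply: (Ck_continuous n _ x y (Ck_D1 _ _ H) Hxy).
Qed.

Lemma Ck_comm n f x y : Ck (S (S n)) f -> U (x, y) -> D1 (D2 f) x y = D2 (D1 f) x y.
Proof.
move=> H Hxy; apply: Schwarz.
- apply: locally_2d_impl (U_locally_2d x y Hxy); apply: locally_2d_forall => u v Huv.
  have [_ [H1 [H2 [H3 H4]]]] := H u v Huv.
  by have [_ [_ [X1 _]]] := H3; have [_ [X2 _]] := H4.
- exact: (Ck_continuous n _ x y (Ck_D1 _ _ (Ck_D2 _ _ H)) Hxy).
- exact: (Ck_continuous n _ x y (Ck_D2 _ _ (Ck_D1 _ _ H)) Hxy).
Qed.

Variable F : R -> R -> R.
Hypothesis HF : biharmonic_on U F.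

Local Lemma F4 : Ck 4 F.
Proof. by move=> x y Hxy; case: (HF x y Hxy). Qed.

Let L1 : R -> R -> R := fun x y => D1 (D1 (D1 F)) x y + D1 (D2 (D2 F)) x y.
Let L2 : R -> R -> R := fun x y => D2 (D1 (D1 F)) x y + D2 (D2 (D2 F)) x y.

Local Lemma C11 : Ck 2 (D1 (D1 F)). Proof. exact: (Ck_D1 _ _ (Ck_D1 _ _ F4)). Qed.
Local Lemma C22 : Ck 2 (D2 (D2 F)). Proof. exact: (Ck_D2 _ _ (Ck_D2 _ _ F4)). Qed.
Local Lemma C12 : Ck 2 (D1 (D2 F)). Proof. exact: (Ck_D1 _ _ (Ck_D2 _ _ F4)). Qed.

Local Lemma lap_diff x y : U (x, y) -> differentiable_pt_lim (laplacian F) x y (L1 x y) (L2 x y).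
Proof.
move=> Hxy; exact: (diff2_plus _ _ _ _ _ _ _ _ (Ck_diff _ _ _ _ C11 Hxy) (Ck_diff _ _ _ _ C22 Hxy)).
Qed.

Local Lemma L1_diff x y : U (x, y) -> differentiable_pt_lim L1 x y
  (D1 (D1 (D1 (D1 F))) x y + D1 (D1 (D2 (D2 F))) x y) (D2 (D1 (D1 (D1 F))) x y + D2 (D1 (D2 (D2 F))) x y).
Proof.
move=> Hxy; exact: (diff2_plus _ _ _ _ _ _ _ _ (Ck_diff _ _ _ _ (Ck_D1 _ _ C11) Hxy) (Ck_diff _ _ _ _ (Ck_D1 _ _ C22) Hxy)).
Qed.

Local Lemma L2_diff x y : U (x, y) -> differentiable_pt_lim L2 x y
  (D1 (D2 (D1 (D1 F))) x y + D1 (D2 (D2 (D2 F))) x y) (D2 (D2 (D1 (D1 F))) x y + D2 (D2 (D2 (D2 F))) x y).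
Proof.
move=> Hxy; exact: (diff2_plus _ _ _ _ _ _ _ _ (Ck_diff _ _ _ _ (Ck_D2 _ _ C11) Hxy) (Ck_diff _ _ _ _ (Ck_D2 _ _ C22) Hxy)).
Qed.

Local Lemma L12 x y : U (x, y) -> D1 L2 x y = D2 L1 x y.
Proof.
move=> Hxy; rewrite (diff2_D1 _ _ _ _ _ (L2_diff x y Hxy)).
rewrite (diff2_D2 _ _ _ _ _ (L1_diff x y Hxy)).
by rewrite -(Ck_comm _ _ x y C11 Hxy) -(Ck_comm _ _ x y C22 Hxy).
Qed.

Local Lemma L_harmonic x y : U (x, y) -> D1 L1 x y = - D2 L2 x y.
Proof.
move=> Hxy; case: (HF x y Hxy) => _.
have -> : laplacian (laplacian F) x y = D1 (D1 (laplacian F)) x y + D2 (D2 (laplacian F)) x y by [].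
have -> : D1 (D1 (laplacian F)) x y = D1 L1 x y.
  apply: Derive_ext_loc.
  have L := locally_2d_1d_const_y _ _ _ (U_locally_2d x y Hxy).
  apply: filter_imp L => u Hu; exact: (diff2_D1 _ _ _ _ _ (lap_diff u y Hu)).
have -> : D2 (D2 (laplacian F)) x y = D2 L2 x y.
  apply: Derive_ext_loc.
  have L := locally_2d_1d_const_x _ _ _ (U_locally_2d x y Hxy).
  apply: filter_imp L => v Hv; exact: (diff2_D2 _ _ _ _ _ (lap_diff x v Hv)).
by lra.
Qed.

Local Lemma L1_diff' x y : U (x, y) -> differentiable_pt_lim L1 x y (D1 L1 x y) (D2 L1 x y).
Proof.
move=> Hxy; have D := L1_diff x y Hxy; by rewrite (diff2_D1 _ _ _ _ _ D) (diff2_D2 _ _ _ _ _ D).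
Qed.

Local Lemma L2_diff' x y : U (x, y) -> differentiable_pt_lim L2 x y (D1 L2 x y) (D2 L2 x y).
Proof.
move=> Hxy; have D := L2_diff x y Hxy; by rewrite (diff2_D1 _ _ _ _ _ D) (diff2_D2 _ _ _ _ _ D).
Qed.

Local Lemma cont_pair (f : R -> R -> R) x y : U (x, y) -> continuity_2d_pt f x y ->
  continuous (fun p : R * R => f (fst p) (snd p)) (x, y).
Proof. by move=> _ H; apply/continuity_2d_pt_filterlim. Qed.

Local Lemma D1L1_cont x y : U (x, y) -> continuous (fun p : R * R => D1 L1 (fst p) (snd p)) (x, y).
Proof.
move=> Hxy.
apply: (continuous_ext_loc _ (fun p : R * R => D1 (D1 (D1 (D1 F))) (fst p) (snd p) + D1 (D1 (D2 (D2 F))) (fst p) (snd p))).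
  have L := proj1 (locally_2d_locally _ _ _) (U_locally_2d x y Hxy).
  by apply: filter_imp L => -[u v] Huv; rewrite /fst /snd; rewrite -(diff2_D1 _ _ _ _ _ (L1_diff u v Huv)).
apply: (continuous_plus (V := R_NormedModule)); apply: cont_pair => //.
  exact: (Ck_continuous _ _ _ _ (Ck_D1 _ _ (Ck_D1 _ _ C11)) Hxy).
exact: (Ck_continuous _ _ _ _ (Ck_D1 _ _ (Ck_D1 _ _ C22)) Hxy).
Qed.

Local Lemma D1L2_cont x y : U (x, y) -> continuous (fun p : R * R => D1 L2 (fst p) (snd p)) (x, y).
Proof.
move=> Hxy.
apply: (continuous_ext_loc _ (fun p : R * R => D1 (D2 (D1 (D1 F))) (fst p) (snd p) + D1 (D2 (D2 (D2 F))) (fst p) (snd p))).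
  have L := proj1 (locally_2d_locally _ _ _) (U_locally_2d x y Hxy).
  by apply: filter_imp L => -[u v] Huv; rewrite /fst /snd; rewrite -(diff2_D1 _ _ _ _ _ (L2_diff u v Huv)).
apply: (continuous_plus (V := R_NormedModule)); apply: cont_pair => //.
  exact: (Ck_continuous _ _ _ _ (Ck_D1 _ _ (Ck_D2 _ _ C11)) Hxy).
exact: (Ck_continuous _ _ _ _ (Ck_D1 _ _ (Ck_D2 _ _ C22)) Hxy).
Qed.

(** This is F_zzw, the z-derivative of the quarter Laplacian. It is holomorphic because the
    Laplacian is harmonic: the Cauchy-Riemann equations are [L12] and [L_harmonic]. *)
Let a : C -> C := fun z => (L1 (fst z) (snd z) / 8, - L2 (fst z) (snd z) / 8).
Let a' : C -> C := fun z => (D1 L1 (fst z) (snd z) / 8, - D1 L2 (fst z) (snd z) / 8).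

Local Lemma a_cdiff z : U z -> cdiff a z (a' z).
Proof.
case: z => x y Hxy; split.
- apply: (diff2_ext (fun u v => / 8 * L1 u v)); first by move=> u v; rewrite /a /=; field.
  apply: (diff2_eq _ _ _ _ _ _ _ (diff2_scal (/ 8) _ _ _ _ _ (L1_diff' x y Hxy))).
    by rewrite /a' /Re /=; field.
  by rewrite /a' /Im /= L12 //; field.
- apply: (diff2_ext (fun u v => - / 8 * L2 u v)); first by move=> u v; rewrite /a /=; field.
  apply: (diff2_eq _ _ _ _ _ _ _ (diff2_scal (- / 8) _ _ _ _ _ (L2_diff' x y Hxy))).
    by rewrite /a' /Im /=; field.
  by rewrite /a' /Re /= L_harmonic //; field.
Qed.

Local Lemma a'_ccont z : U z -> ccont a' z.
Proof.
case: z => x y Hxy; split; rewrite /a' /Re /Im /=.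
- apply: (continuous_mult (K := R_AbsRing)); [exact: D1L1_cont|exact: continuous_const].
- apply: (continuous_mult (K := R_AbsRing)); [|exact: continuous_const].
  apply: (continuous_opp (V := R_NormedModule)); exact: D1L2_cont.
Qed.

Local Lemma a_hol1 : hol1 U a.
Proof. exact: (hol1_intro _ HU _ _ a_cdiff a'_ccont). Qed.

Let Fzz : C -> C := fun z =>
  ((D1 (D1 F) (fst z) (snd z) - D2 (D2 F) (fst z) (snd z)) / 4, - D1 (D2 F) (fst z) (snd z) / 2).
Let b : C -> C := fun z => (Fzz z - Cconj z * a z)%C.
(** The x-derivative of [Fzz]; the x-derivative b' of b then follows from the product rule. The
    conjugate of z is spelled out in b' so that continuity splits into coordinates. *)
Let P' : C -> C := fun z =>
  ((D1 (D1 (D1 F)) (fst z) (snd z) - D1 (D2 (D2 F)) (fst z) (snd z)) / 4, - D1 (D1 (D2 F)) (fst z) (snd z) / 2).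
Let b' : C -> C := fun z => (P' z + - 1 * a z + - 1 * (RtoC (fst z) + - (Ci * RtoC (snd z))) * a' z)%C.

Local Lemma comm_third x y : U (x, y) ->
  D2 (D1 (D1 F)) x y = D1 (D1 (D2 F)) x y /\ D2 (D1 (D2 F)) x y = D1 (D2 (D2 F)) x y.
Proof.
move=> Hxy; split; last by rewrite -(Ck_comm _ _ x y (Ck_D2 _ _ F4) Hxy).
rewrite -(Ck_comm _ _ x y (Ck_D1 _ _ F4) Hxy); apply: Derive_ext_loc.
have L := locally_2d_1d_const_y _ _ _ (U_locally_2d x y Hxy).
by apply: filter_imp L => u Hu; rewrite (Ck_comm _ _ u y F4 Hu).
Qed.

Local Lemma b_cdiff z : U z -> cdiff b z (b' z).
Proof.
case: z => x y Hxy; have [T1 T2] := comm_third x y Hxy.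
have [A1 A2] := a_cdiff (x, y) Hxy.
have DP := diff2_scal (/ 4) _ _ _ _ _ (diff2_plus _ _ _ _ _ _ _ _ (Ck_diff _ _ _ _ C11 Hxy) (diff2_opp _ _ _ _ _ (Ck_diff _ _ _ _ C22 Hxy))).
have DQ := diff2_scal (- / 2) _ _ _ _ _ (Ck_diff _ _ _ _ C12 Hxy).
have X := diff2_fst x y; have Y := diff2_snd x y.
split.
- apply: (diff2_ext (fun u v => / 4 * (D1 (D1 F) u v + - D2 (D2 F) u v) + - (u * Re (a (u, v)) + v * Im (a (u, v))))).
    by move=> u v; rewrite /b /Fzz /Re /=; field.
  apply: (diff2_eq _ _ _ _ _ _ _ (diff2_plus _ _ _ _ _ _ _ _ DP (diff2_opp _ _ _ _ _
    (diff2_plus _ _ _ _ _ _ _ _ (diff2_mult _ _ _ _ _ _ _ _ X A1) (diff2_mult _ _ _ _ _ _ _ _ Y A2))))).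
    by rewrite /b' /P' /a /a' /Re /Im /=; field.
  by rewrite /b' /P' /a /a' /Re /Im /= /L2 T1; field.
- apply: (diff2_ext (fun u v => - / 2 * D1 (D2 F) u v + - (u * Im (a (u, v)) + - (v * Re (a (u, v)))))).
    by move=> u v; rewrite /b /Fzz /Im /=; field.
  apply: (diff2_eq _ _ _ _ _ _ _ (diff2_plus _ _ _ _ _ _ _ _ DQ (diff2_opp _ _ _ _ _
    (diff2_plus _ _ _ _ _ _ _ _ (diff2_mult _ _ _ _ _ _ _ _ X A2) (diff2_opp _ _ _ _ _ (diff2_mult _ _ _ _ _ _ _ _ Y A1)))))).
    by rewrite /b' /P' /a /a' /Re /Im /=; field.
  by rewrite /b' /P' /a /a' /Re /Im /= /L1 T2; field.
Qed.

Local Lemma b'_ccont z : U z -> ccont b' z.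
Proof.
case: z => x y Hxy.
have Hc : forall f : R -> R -> R, Ck 1 f -> continuous (fun p : R * R => f (fst p) (snd p)) (x, y).
  by move=> f H; apply: cont_pair => //; apply: (Ck_continuous _ _ _ _ H Hxy).
have Cs : forall k (f : R * R -> R), continuous f (x, y) -> continuous (fun p => f p / k) (x, y).
  by move=> k f H; apply: (continuous_mult (K := R_AbsRing)) => //; apply: continuous_const.
apply: ccont_plus.
  apply: ccont_plus.
    split; rewrite /P' /Re /Im /=; apply: Cs.
      by apply: (continuous_minus (V := R_NormedModule)); apply: Hc; [apply: (Ck_D1 _ _ C11)|apply: (Ck_D1 _ _ C22)].
    by apply: (continuous_opp (V := R_NormedModule)); apply: Hc; apply: (Ck_D1 _ _ C12).
  by apply: ccont_mult; [apply: ccont_const|apply: (cdiff_ccont _ _ _ (a_cdiff _ Hxy))].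
apply: ccont_mult; last exact: a'_ccont.
apply: ccont_mult; first exact: ccont_const.
split; rewrite /Re /Im /=.
  apply: (continuous_ext (fun p : R * R => fst p)); first by move=> p; rring.
  exact: continuous_fst.
apply: (continuous_ext (fun p : R * R => - snd p)); first by move=> p; rring.
by apply: (continuous_opp (V := R_NormedModule)); apply: continuous_snd.
Qed.

Local Lemma b_hol1 : hol1 U b.
Proof. exact: (hol1_intro _ HU _ _ b_cdiff b'_ccont). Qed.

Lemma biharmonic_wirtinger : exists (Fz a b : C -> C) (L : C -> R),
  dF_rule U F Fz /\
  dFz_rule U Fz a b L /\
  dL_rule U L a /\
  hol1 U a /\ hol1 U b.
Proof.
(* F_z = (F_x - i F_y) / 2, and F_zw is a quarter of the Laplacian. *)
exists (fun z => (D1 F (fst z) (snd z) / 2, - D2 F (fst z) (snd z) / 2)), a, b, (fun z => laplacian F (fst z) (snd z) / 4).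
have Hg : forall (g : R -> C) t, U (g t) -> U (Re (g t), Im (g t)).
  by move=> g t; case: (g t).
split; [|split; [|split; [|split; [exact: a_hol1|exact: b_hol1]]]].
- move=> g t d Ht Hd; apply: is_derive_eq.
    exact: (rcd_comp_2d F g t _ _ d (Ck_diff _ _ _ _ F4 (Hg _ _ Ht)) Hd).
  by rewrite /= /Re /Im; field.
- move=> g t d Ht Hd.
  have E : (Cconj (g t) * a (g t) + b (g t) = Fzz (g t))%C by rewrite /b; cring.
  rewrite E.
  have K1 := rcd_comp_2d _ g t _ _ d (Ck_diff _ _ _ _ (Ck_D1 _ _ F4) (Hg _ _ Ht)) Hd.
  have K2 := rcd_comp_2d _ g t _ _ d (Ck_diff _ _ _ _ (Ck_D2 _ _ F4) (Hg _ _ Ht)) Hd.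
  have Ec := Ck_comm _ _ _ _ F4 (Hg _ _ Ht).
  have El : laplacian F (fst (g t)) (snd (g t)) = D1 (D1 F) (fst (g t)) (snd (g t)) + D2 (D2 F) (fst (g t)) (snd (g t)) by [].
  split.
    apply: (is_derive_ext (fun s => / 2 * D1 F (Re (g s)) (Im (g s)))); first by move=> s; rewrite /Re /Im /=; field.
    apply: is_derive_eq; first exact: (is_derive_scal _ _ (/ 2) _ K1).
    by rewrite -Ec El /Fzz /scal /= /mult /= /Re /Im /=; field.
  apply: (is_derive_ext (fun s => - / 2 * D2 F (Re (g s)) (Im (g s)))); first by move=> s; rewrite /Re /Im /=; field.
  apply: is_derive_eq; first exact: (is_derive_scal _ _ (- / 2) _ K2).
  by rewrite El /Fzz /scal /= /mult /= /Re /Im /=; field.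
- move=> g t d Ht Hd.
  have K := rcd_comp_2d _ g t _ _ d (lap_diff _ _ (Hg _ _ Ht)) Hd.
  apply: (is_derive_ext (fun s => / 4 * laplacian F (Re (g s)) (Im (g s)))); first by move=> s; rewrite /Re /Im /=; field.
  apply: is_derive_eq; first exact: (is_derive_scal _ _ (/ 4) _ K).
  by rewrite /a /Re /Im /=; field.
Qed.
End Jets.

(** * Pencils and analytic coefficients *)

(** At common points the product of the gradients is the bilinear expression of the hypothesis plus
    multiples of the two equations. Because [orthogonal] also demands a common point, one has to be
    constructed. *)
Lemma circle_orthogonal a b c T :
  proper (circle a b c) -> proper T ->
  a * cl_a T + b * cl_b T - 2 * c * cl_k T - 2 * cl_c T = 0 ->
  orthogonal (circle a b c) T.
Proof.
case: T => k p q s; rewrite /proper /circle /orthogonal /on_cl /= => P1 P2 O; split; last first.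
  move=> x y E1 E2.
  have -> : (2 * 1 * x + a) * (2 * k * x + p) + (2 * 1 * y + b) * (2 * k * y + q) =
    2 * (k * (x * (x * 1) + y * (y * 1)) + p * x + q * y + s)
    + 2 * k * (1 * (x * (x * 1) + y * (y * 1)) + a * x + b * y + c) + (a * p + b * q - 2 * c * k - 2 * s) by ring.
  by rewrite E1 E2 O; ring.
pose r2 := (a * a + b * b) / 4 - c.
pose g1 := p - k * a; pose g2 := q - k * b.
pose G := g1 * g1 + g2 * g2.
(* With the origin at the centre, a point X of the circle lies on T exactly when g . X = - 2 k r2,
   the radical axis. That line meets the circle because 4 k^2 r2 < |g|^2, which is the properness of
   T. *)
have r0 : 0 < r2 by rewrite /r2; lra.
have EG : G = 4 * k * k * r2 + (p * p + q * q - 4 * k * s).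
  have -> : s = (a * p + b * q - 2 * c * k) / 2 by lra.
  by rewrite /G /g1 /g2 /r2; field.
have G1 : 4 * k * k * r2 < G by lra.
have G0 : 0 < G by have := Rle_0_sqr k; rewrite /Rsqr; nra.
pose w2 := (r2 - 4 * k * k * r2 * r2 / G) / G.
have W0 : 0 <= w2.
  apply: Rmult_le_pos; last by apply: Rlt_le; apply: Rinv_0_lt_compat.
  suff : 4 * k * k * r2 * r2 / G <= r2 by lra.
  by apply: div_le => //; nra.
pose w := sqrt w2.
have W2 : w * w = w2 by apply: sqrt_sqrt.
have W3 : w * w * G = r2 - 4 * k * k * r2 * r2 / G by rewrite W2 /w2; field; lra.
(* The foot of the perpendicular from the centre to the radical axis, moved along the axis by half
   of the chord. *)
pose X := - 2 * k * r2 / G * g1 - w * g2; pose Y := - 2 * k * r2 / G * g2 + w * g1.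
have N : X * X + Y * Y = r2.
  have -> : X * X + Y * Y = 4 * k * k * r2 * r2 / (G * G) * (g1 * g1 + g2 * g2) + w * w * (g1 * g1 + g2 * g2) by rewrite /X /Y; field; lra.
  by rewrite -/G W3; field; lra.
have D : g1 * X + g2 * Y = - 2 * k * r2.
  have -> : g1 * X + g2 * Y = - 2 * k * r2 / G * (g1 * g1 + g2 * g2) by rewrite /X /Y; field; lra.
  by rewrite -/G; field; lra.
exists (- a / 2 + X), (- b / 2 + Y); split.
  have -> : 1 * ((- a / 2 + X) * ((- a / 2 + X) * 1) + (- b / 2 + Y) * ((- b / 2 + Y) * 1)) + a * (- a / 2 + X) + b * (- b / 2 + Y) + c = X * X + Y * Y - r2.
    by rewrite /r2; field.
  by rewrite N; ring.
have -> : k * ((- a / 2 + X) * ((- a / 2 + X) * 1) + (- b / 2 + Y) * ((- b / 2 + Y) * 1)) + p * (- a / 2 + X) + q * (- b / 2 + Y) + s =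
  k * (X * X + Y * Y) + (g1 * X + g2 * Y) + k * r2 - (a * p + b * q - 2 * c * k - 2 * s) / 2.
  by rewrite /g1 /g2 /r2; field.
by rewrite N D O; field.
Qed.

Definition lin_indep4 (a1 b1 c1 d1 a2 b2 c2 d2 : R) : Prop :=
  forall x y, x * a1 + y * a2 = 0 -> x * b1 + y * b2 = 0 -> x * c1 + y * c2 = 0 -> x * d1 + y * d2 = 0 -> x = 0 /\ y = 0.

(** Equal curves have proportional equations. For a circle, eliminating the quadratic part leaves an
    affine function that vanishes at the four extreme points of the circle; for two lines, two
    points of one of them suffice. *)
Lemma proper_same_curve_dep S T : proper S -> proper T -> same_curve S T ->
  ~ lin_indep4 (cl_k S) (cl_a S) (cl_b S) (cl_c S) (cl_k T) (cl_a T) (cl_b T) (cl_c T).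
Proof.
have circ : forall k a b c k' a' b' c', k <> 0 -> proper (Circline k a b c) ->
   (forall x y, on_cl (Circline k a b c) x y -> on_cl (Circline k' a' b' c') x y) ->
   k' * a - k * a' = 0 /\ k' * b - k * b' = 0 /\ k' * c - k * c' = 0.
  move=> k a b c k' a' b' c' k0; rewrite /proper /on_cl /= => P H.
  pose r := sqrt ((a * a + b * b - 4 * k * c) / (4 * k * k)).
  have kk : 0 < k * k by nra.
  have r2 : r * r = (a * a + b * b - 4 * k * c) / (4 * k * k).
    by apply: sqrt_sqrt; apply: Rlt_le; apply: Rdiv_lt_0_compat; lra.
  have r0 : 0 < r by apply: sqrt_lt_R0; apply: Rdiv_lt_0_compat; lra.
  have on : forall X Y, X * X + Y * Y = r * r ->
    (k' * a - k * a') * (- a / (2 * k) + X) + (k' * b - k * b') * (- b / (2 * k) + Y) + (k' * c - k * c') = 0.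
    move=> X Y E.
    have E1 : k * ((- a / (2 * k) + X) * ((- a / (2 * k) + X) * 1) + (- b / (2 * k) + Y) * ((- b / (2 * k) + Y) * 1)) + a * (- a / (2 * k) + X) + b * (- b / (2 * k) + Y) + c = 0.
      have -> : k * ((- a / (2 * k) + X) * ((- a / (2 * k) + X) * 1) + (- b / (2 * k) + Y) * ((- b / (2 * k) + Y) * 1)) + a * (- a / (2 * k) + X) + b * (- b / (2 * k) + Y) + c
        = k * (X * X + Y * Y) - (a * a + b * b - 4 * k * c) / (4 * k) by field.
      by rewrite E r2; field.
    have E2 := H _ _ E1; move: E1 E2; set x := _ + X; set y := _ + Y => E1 E2.
    have : k' * 0 - k * 0 = 0 by ring.
    by rewrite -{1}E1 -E2; lra.
  have e1 := on r 0 ltac:(ring); have e2 := on (- r) 0 ltac:(ring).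
  have e3 := on 0 r ltac:(ring); have e4 := on 0 (- r) ltac:(ring).
  have A0 : k' * a - k * a' = 0 by apply: (Rmult_eq_reg_r r); lra.
  have B0 : k' * b - k * b' = 0 by apply: (Rmult_eq_reg_r r); lra.
  by do ! split => //; move: e1; rewrite A0 B0; lra.
case: S => k a b c; case: T => k' a' b' c' P P' E I.
have [k0|k0] := Req_dec k 0; last first.
  have [A [B D]] := circ _ _ _ _ k' a' b' c' k0 P (fun x y => proj1 (E x y)).
  have [_ N] := I k' (- k) ltac:(rewrite /=; lra) ltac:(rewrite /=; lra) ltac:(rewrite /=; lra) ltac:(rewrite /=; lra).
  lra.
have [k0'|k0'] := Req_dec k' 0; last first.
  have [A [B D]] := circ _ _ _ _ k a b c k0' P' (fun x y => proj2 (E x y)).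
  have [N _] := I k' (- k) ltac:(rewrite /=; lra) ltac:(rewrite /=; lra) ltac:(rewrite /=; lra) ltac:(rewrite /=; lra).
  lra.
move: P P' E I; rewrite /proper /same_curve /on_cl /lin_indep4 /= k0 k0' => P P' E I.
have n0 : 0 < a * a + b * b by lra.
(* The foot of the perpendicular from the origin to the first line; the second point is its
   translate along the direction (-b, a). *)
pose x0 := - c * a / (a * a + b * b); pose y0 := - c * b / (a * a + b * b).
have e1 : a' * x0 + b' * y0 + c' = 0.
  have [K _] := E x0 y0; suff : 0 * (x0 * (x0 * 1) + y0 * (y0 * 1)) + a * x0 + b * y0 + c = 0 by move/K; lra.
  by rewrite /x0 /y0; field; lra.
have e2 : a' * (x0 - b) + b' * (y0 + a) + c' = 0.
  have [K _] := E (x0 - b) (y0 + a); suff : 0 * ((x0 - b) * ((x0 - b) * 1) + (y0 + a) * ((y0 + a) * 1)) + a * (x0 - b) + b * (y0 + a) + c = 0 by move/K; lra.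
  by rewrite /x0 /y0; field; lra.
have D : b' * a = a' * b by lra.
have n1 : a' * a' + b' * b' <> 0 by lra.
have ec : c' * (a * a + b * b) = c * (a' * a + b' * b).
  have -> : c' = - (a' * x0 + b' * y0) by lra.
  by rewrite /x0 /y0; field; lra.
have i1 : (a' * a + b' * b) * a + - (a * a + b * b) * a' = b * (b' * a - a' * b) by ring.
have i2 : (a' * a + b' * b) * b + - (a * a + b * b) * b' = a * (a' * b - b' * a) by ring.
have [N1 N2] := I (a' * a + b' * b) (- (a * a + b * b)) ltac:(lra) ltac:(rewrite i1 D; ring) ltac:(rewrite i2 D; ring) ltac:(lra).
lra.
Qed.

(** An affine relation among the coefficients is orthogonality to a fixed circle or line, provided
    that the latter is proper. Two independent relations span a plane of such conditions, in which
    two distinct proper members must be found. *)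
Lemma pencil_of_relations (D : R -> Prop) (a b c : R -> R) (a1 b1 c1 d1 a2 b2 c2 d2 : R) :
  lin_indep4 a1 b1 c1 d1 a2 b2 c2 d2 ->
  (forall t, D t -> proper (circle (a t) (b t) (c t))) ->
  (forall t, D t -> a1 * a t + b1 * b t + c1 * c t + d1 = 0) ->
  (forall t, D t -> a2 * a t + b2 * b t + c2 * c t + d2 = 0) ->
  pencil_on D (fun t => circle (a t) (b t) (c t)).
Proof.
move=> I P E1 E2.
pose T x y := Circline (- (x * c1 + y * c2) / 2) (x * a1 + y * a2) (x * b1 + y * b2) (- (x * d1 + y * d2) / 2).
pose N x y := (x * a1 + y * a2) ^ 2 + (x * b1 + y * b2) ^ 2 - (x * c1 + y * c2) * (x * d1 + y * d2).
have PT : forall x y, 0 < N x y -> proper (T x y).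
  by move=> x y; rewrite /N /proper /T /=; lra.
(* The form a^2 + b^2 - c d has only one negative direction, so it is positive somewhere on every
   plane: on the vectors with c + d = 0 it equals a^2 + b^2 + c^2. *)
have [x [y Hxy]] : exists x y, 0 < N x y.
  have pos : forall x y, (x <> 0 \/ y <> 0) -> (x * c1 + y * c2) + (x * d1 + y * d2) = 0 -> 0 < N x y.
    move=> x y n0 E; apply: Rnot_le_lt => L.
    have Ed : x * d1 + y * d2 = - (x * c1 + y * c2) by lra.
    move: L; rewrite /N Ed => L.
    have sq0 : forall p q r : R, ~ 0 < p ^ 2 + q ^ 2 - r * - r -> p = 0 /\ q = 0 /\ r = 0.
      by move=> p q r Hn; repeat split; nra.
    have [Z1 [Z2 Z3]] := sq0 _ _ _ (Rle_not_lt _ _ L).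
    have [] := I x y Z1 Z2 Z3 ltac:(lra); lra.
  have [Z|Z] := classic (c1 + d1 = 0 /\ c2 + d2 = 0).
    by exists 1, 0; apply: pos; [left; lra|lra].
  exists (c2 + d2), (- (c1 + d1)); apply: pos; last by ring.
  apply: NNPP => K; apply: Z; split; apply: NNPP => K'; apply: K; [right|left]; lra.
(* The second member is a small perturbation of the first in the perpendicular direction (y, -x),
   which makes it independent. N changes by at most e M, since e <= 1, and 2 e M <= N x y keeps it
   positive. *)
pose M := Rabs (N (x + y) (y - x) - N x y - N y (- x)) + Rabs (N y (- x)) + 1.
have M0 : 0 < M by rewrite /M; have := Rabs_pos (N (x + y) (y - x) - N x y - N y (- x)); have := Rabs_pos (N y (- x)); lra.
pose e := Rmin 1 (N x y / (2 * M)).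
have e0 : 0 < e by apply: Rmin_pos; [lra|apply: Rdiv_lt_0_compat; lra].
have e1 : e <= 1 by apply: Rmin_l.
have e2 : e * (2 * M) <= N x y by apply/Rle_div_r; [lra|apply: Rmin_r].
have xy0 : 0 < x * x + y * y.
  apply: Rnot_le_lt => L; have X0 : x = 0 by nra. have Y0 : y = 0 by nra.
  by move: Hxy; rewrite X0 Y0 /N; lra.
have Hxy' : 0 < N (x + e * y) (y - e * x).
  have -> : N (x + e * y) (y - e * x) = N x y + e * (N (x + y) (y - x) - N x y - N y (- x)) + e * e * N y (- x) by rewrite /N; ring.
  move: e2; rewrite /M; set u := N (x + y) _ - _ - _; set v := N y (- x) => e2.
  have := Rle_abs (- u); have := Rle_abs (- v); rewrite !Rabs_Ropp.
  have := Rabs_pos u; have := Rabs_pos v; nra.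
have orth : forall u v t, D t -> 0 < N u v -> orthogonal (circle (a t) (b t) (c t)) (T u v).
  move=> u v t Ht Hn; apply: circle_orthogonal; [exact: P|exact: PT|].
  rewrite /T /=; have := E1 t Ht; have := E2 t Ht => X1 X2.
  have -> : a t * (u * a1 + v * a2) + b t * (u * b1 + v * b2) - 2 * c t * (- (u * c1 + v * c2) / 2) - 2 * (- (u * d1 + v * d2) / 2)
     = u * (a1 * a t + b1 * b t + c1 * c t + d1) + v * (a2 * a t + b2 * b t + c2 * c t + d2) by field.
  by rewrite X1 X2; ring.
exists (T x y), (T (x + e * y) (y - e * x)); split; first exact: PT.
split; first exact: PT.
split; last by move=> t Ht; split; apply: orth.
move=> same; apply: (proper_same_curve_dep _ _ (PT _ _ Hxy) (PT _ _ Hxy') same).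
move=> u v /=; rewrite /T /= => K1 K2 K3 K4.
have [Z1 Z2] := I (u * x + v * (x + e * y)) (u * y + v * (y - e * x)) ltac:(lra) ltac:(lra) ltac:(lra) ltac:(lra).
have V : v * (e * (x * x + y * y)) = 0.
  have -> : v * (e * (x * x + y * y)) = y * (u * x + v * (x + e * y)) - x * (u * y + v * (y - e * x)) by ring.
  by rewrite Z1 Z2; ring.
have V0 : v = 0 by case: (Rmult_integral _ _ V) => //; nra.
split => //; move: Z1 Z2; rewrite V0 => Z1 Z2.
have : u * (x * x + y * y) = 0.
  have -> : u * (x * x + y * y) = x * (u * x + 0 * (x + e * y)) + y * (u * y + 0 * (y - e * x)) by ring.
  by rewrite Z1 Z2; ring.
by case/Rmult_integral => K; lra.
Qed.

(** Only positive y are used because the analytic functions may be tested on one side of a point.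
    Continuity at 0 kills the constant term; then one divides by y. *)
Lemma zero_pseries_coef n : forall (v : nat -> R) del, 0 < del ->
  (forall y, 0 < y < del -> is_pseries v y 0) -> v n = 0.
Proof.
have base : forall (v : nat -> R) del, 0 < del -> (forall y, 0 < y < del -> is_pseries v y 0) -> v 0%nat = 0.
  move=> v del Hd H.
  have Rad : Rbar_lt (Rabs 0) (CV_radius v).
    have Hh : 0 < del / 2 < del by lra.
    apply: (Rbar_lt_le_trans _ (Rabs (del / 2))); first by rewrite /= Rabs_R0 Rabs_pos_eq; lra.
    apply: Rbar_not_lt_le => L; apply: (CV_disk_outside _ _ L).
    apply: ex_series_lim_0; exists 0.
    by move: (H _ Hh); rewrite /is_pseries; apply: is_series_ext => k; rewrite pow_n_pow /scal /= /mult /=; ring.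
  have Cn := PSeries_continuity _ _ Rad.
  rewrite -(PSeries_0 v); apply: NNPP => Nz.
  have Np : 0 < Rabs (PSeries v 0) by apply: Rabs_pos_lt.
  have [al [Hal K]] := Cn _ Np.
  pose y := Rmin del al / 2.
  have m0 : 0 < Rmin del al by apply: Rmin_pos.
  have y1 : 0 < y < del by rewrite /y; have := Rmin_l del al; lra.
  have y2 : y < al by rewrite /y; have := Rmin_r del al; lra.
  have := K y; rewrite /D_x /no_cond /R_dist /= (is_pseries_unique _ _ _ (H y y1)).
  rewrite /Rdist Rminus_0_l Rabs_Ropp Rminus_0_r (Rabs_pos_eq y); last by lra.
  move=> Kk; suff : Rabs (PSeries v 0) < Rabs (PSeries v 0) by lra.
  by apply: Kk; split => //; split => //; lra.
elim: n => [|n IH] v del Hd H; first exact: base H.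
apply: (IH (PS_decr_1 v) del Hd) => y Hy.
have := is_pseries_decr_1 v y (/ y) 0 ltac:(by rewrite /mult /one /=; field; lra) (H y Hy).
rewrite (base v del Hd H); rewrite (_ : scal _ _ = 0) //.
by rewrite /scal /= /mult /= /plus /opp /=; ring.
Qed.

(** A supremum argument along the segment from the midpoint m of the given interval to s. At the
    supremum f vanishes on the side of m, so its local power series is zero there and f also
    vanishes a little further on. *)
Lemma analytic_identity f t1 t2 : analytic_on unit_interval f -> 0 <= t1 < t2 -> t2 <= 1 ->
  (forall t, t1 < t < t2 -> f t = 0) -> forall t, unit_interval t -> f t = 0.
Proof.
move=> An H1 H2 Z s Hs.
pose m := (t1 + t2) / 2.
have Hm : t1 < m < t2 by rewrite /m; lra.
pose g x := m + x * (s - m).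
have gI : forall x, 0 <= x <= 1 -> unit_interval (g x).
  move=> x Hx; move: Hs; rewrite /unit_interval /g => Hs'.
  have P1 : 0 <= (1 - x) * m by apply: Rmult_le_pos; lra.
  have P2 : 0 <= x * s by apply: Rmult_le_pos; lra.
  have P3 : 0 <= (1 - x) * (1 - m) by apply: Rmult_le_pos; lra.
  have P4 : 0 <= x * (1 - s) by apply: Rmult_le_pos; lra.
  lra.
pose E x := 0 <= x <= 1 /\ forall y, 0 <= y <= x -> f (g y) = 0.
have g0 : g 0 = m by rewrite /g; ring.
have E0 : E 0.
  split; first lra.
  move=> y Hy; have -> : y = 0 by lra.
  by rewrite g0; apply: Z.
have bE : bound E by exists 1 => x [[_ ?] _].
have [sg [ub lub]] := completeness E bE (ex_intro _ 0 E0).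
have sg0 : 0 <= sg by apply: ub.
have sg1 : sg <= 1 by apply: lub => x [[_ ?] _].
have below : forall y, 0 <= y < sg -> f (g y) = 0.
  move=> y Hy; apply: NNPP => N.
  suff : sg <= y by lra.
  apply: lub => x [Hx K]; apply: Rnot_lt_le => L; apply: N; apply: K; lra.
have [u [r K]] := An (g sg) (gI sg (conj sg0 sg1)).
(* A Lipschitz constant of g, increased by 1 so that it can be a divisor even when s = m. *)
pose kap := Rabs (s - m) + 1.
have kap0 : 0 < kap by rewrite /kap; have := Rabs_pos (s - m); lra.
have near : forall y, 0 <= y <= 1 -> Rabs (y - sg) < r / kap -> is_pseries u (g y - g sg) (f (g y)).
  move=> y Hy L; apply: K; first exact: gI.
  have -> : g y - g sg = (y - sg) * (s - m) by rewrite /g; ring.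
  rewrite Rabs_mult; apply: (Rle_lt_trans _ (Rabs (y - sg) * kap)).
    by apply: Rmult_le_compat_l; [apply: Rabs_pos|rewrite /kap; lra].
  by apply/Rlt_div_r.
have r0 := cond_pos r.
have rk : 0 < r / kap by apply: Rdiv_lt_0_compat.
(* The series is rewritten in the parameter of the segment, pointing back towards m. The factor (m -
   s)^n is kept, so the degenerate segment s = m needs no separate treatment. *)
have U0 : forall n, u n * (m - s) ^ n = 0.
  move=> n.
  have [Sp|Sz] : 0 < sg \/ sg = 0 by lra.
    apply: (zero_pseries_coef n (fun n => u n * (m - s) ^ n) (Rmin sg (r / kap))); first exact: Rmin_pos.
    move=> y [y0 y1]; have y2 := Rlt_le_trans _ _ _ y1 (Rmin_l _ _); have y3 := Rlt_le_trans _ _ _ y1 (Rmin_r _ _).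
    have := near (sg - y) ltac:(lra); rewrite below; last by lra.
    rewrite (_ : sg - y - sg = - y) ?Rabs_Ropp ?Rabs_pos_eq; [|lra|ring].
    move=> /(_ y3); rewrite /is_pseries; apply: is_series_ext => k.
    rewrite !pow_n_pow /scal /= /mult /= (_ : g (sg - y) - g sg = y * (m - s)); last by rewrite /g; ring.
    by rewrite Rpow_mult_distr; rring.
  (* the expansion point is the midpoint, around which f vanishes on both sides *)
  apply: (zero_pseries_coef n (fun n => u n * (m - s) ^ n) (Rmin ((t2 - t1) / (2 * kap)) (r / kap))).
    by apply: Rmin_pos => //; apply: Rdiv_lt_0_compat; lra.
  move=> y [y0 y1]; have y2 := Rlt_le_trans _ _ _ y1 (Rmin_l _ _); have y3 := Rlt_le_trans _ _ _ y1 (Rmin_r _ _).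
  have y4 : y * (2 * kap) < t2 - t1 by apply/Rlt_div_r => //; lra.
  have y5 : y * kap < r by apply/Rlt_div_r.
  have B : Rabs (y * (m - s)) <= y * kap.
    rewrite Rabs_mult Rabs_pos_eq; last by lra.
    by apply: Rmult_le_compat_l; [lra|rewrite /kap Rabs_minus_sym; lra].
  have y6 : y * kap < (t2 - t1) / 2 by lra.
  have B2 := Rabs_def2 _ _ (Rle_lt_trans _ _ _ B y6).
  have Em : m = (t1 + t2) / 2 by [].
  have Hy : t1 < m + y * (m - s) < t2 by lra.
  have := K (m + y * (m - s)) ltac:(rewrite /unit_interval; lra).
  rewrite Sz g0 Z // (_ : m + y * (m - s) - m = y * (m - s)); last by ring.
  move=> /(_ (Rle_lt_trans _ _ _ B y5)); rewrite /is_pseries; apply: is_series_ext => k.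
  by rewrite !pow_n_pow /scal /= /mult /= Rpow_mult_distr; rring.
have near0 : forall y, 0 <= y <= 1 -> Rabs (y - sg) < r / kap -> f (g y) = 0.
  move=> y Hy L; have := near y Hy L; rewrite /is_pseries => S.
  have S0 : is_series (fun k => scal (pow_n (g y - g sg) k) (u k)) 0.
    apply: is_series_ext is_series_zero => k.
    rewrite pow_n_pow /scal /= /mult /= (_ : g y - g sg = (sg - y) * (m - s)); last by rewrite /g; ring.
    by rewrite Rpow_mult_distr Rmult_assoc (Rmult_comm _ (u k)) U0 Rmult_0_r.
  by rewrite -(is_series_unique _ _ S) -(is_series_unique _ _ S0).
have sgE : sg = 1.
  apply: Rle_antisym => //; apply: Rnot_lt_le => L.
  pose d := Rmin (1 - sg) (r / kap / 2).
  have d0 : 0 < d by apply: Rmin_pos; lra.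
  have d1 : d <= 1 - sg by apply: Rmin_l.
  have d2 : d <= r / kap / 2 by apply: Rmin_r.
  suff : sg + d <= sg by lra.
  apply: ub; split; first lra.
  move=> y Hy; have [L1|L1] := Rlt_le_dec y sg; first by apply: below; lra.
  by apply: near0; [lra|rewrite Rabs_pos_eq; lra].
have := near0 1 ltac:(lra) ltac:(rewrite sgE Rminus_diag Rabs_R0; lra).
by rewrite /g (_ : m + 1 * (s - m) = s) //; ring.
Qed.

Lemma analytic_plus f g : analytic_on unit_interval f -> analytic_on unit_interval g ->
  analytic_on unit_interval (fun t => f t + g t).
Proof.
move=> F G t0 H0; have [u [r Ku]] := F t0 H0; have [v [s Kv]] := G t0 H0.
have m0 : 0 < Rmin r s by apply: Rmin_pos; apply: cond_pos.
exists (PS_plus u v), (mkposreal _ m0) => t Ht /= L; apply: is_pseries_plus.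
  by apply: Ku => //; apply: Rlt_le_trans L (Rmin_l _ _).
by apply: Kv => //; apply: Rlt_le_trans L (Rmin_r _ _).
Qed.

Lemma analytic_scal k f : analytic_on unit_interval f -> analytic_on unit_interval (fun t => k * f t).
Proof.
move=> F t0 H0; have [u [r Ku]] := F t0 H0; exists (PS_scal k u), r => t Ht L.
by apply: (is_pseries_scal (K := R_AbsRing)); [apply: Rmult_comm|apply: Ku].
Qed.

Lemma analytic_const k : analytic_on unit_interval (fun _ => k).
Proof.
move=> t0 H0; exists (fun n => match n with O => k | _ => 0 end), (mkposreal 1 Rlt_0_1) => t _ _.
rewrite /is_pseries; apply: is_series_decr_1; rewrite /= /scal /= /mult /= /plus /opp /one /= (_ : k + - (1 * k) = 0); last by ring.
by apply: is_series_ext is_series_zero => n; rewrite Rmult_0_r.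
Qed.

Lemma analytic_derivable f t : analytic_on unit_interval f -> 0 < t < 1 ->
  ex_derive f t /\ ex_derive (Derive f) t.
Proof.
move=> F Ht; have [u [r K]] := F t ltac:(rewrite /unit_interval; lra).
have r0 := cond_pos r.
pose e := Rmin r (Rmin t (1 - t)).
have e0 : 0 < e by apply: Rmin_pos => //; apply: Rmin_pos; lra.
have e1 : e <= r by apply: Rmin_l.
have e2 : e <= t by apply: Rle_trans (Rmin_r _ _) (Rmin_l _ _).
have e3 : e <= 1 - t by apply: Rle_trans (Rmin_r _ _) (Rmin_r _ _).
have Ke : forall y, Rabs (y - t) < e -> is_pseries u (y - t) (f y).
  move=> y Hy; have := Rabs_def2 _ _ Hy => B.
  by apply: K; [rewrite /unit_interval; lra|lra].
have Rad : Rbar_le (e / 2) (CV_radius u).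
  apply: Rbar_not_lt_le => L; have Pe : e / 2 = Rabs (e / 2) by rewrite Rabs_pos_eq; lra.
  rewrite Pe in L; apply: (CV_disk_outside _ _ L).
  apply: ex_series_lim_0; exists (f (t + e / 2)).
  have := Ke (t + e / 2); rewrite (_ : t + e / 2 - t = e / 2); last by ring.
  rewrite -Pe => /(_ ltac:(lra)); rewrite /is_pseries; apply: is_series_ext => k.
  by rewrite pow_n_pow /scal /= /mult /=; ring.
have in_rad : forall y (v : nat -> R), CV_radius v = CV_radius u -> Rabs (y - t) < e / 2 -> Rbar_lt (Rabs (y - t)) (CV_radius v).
  by move=> y v -> Hy; apply: Rbar_lt_le_trans Rad.
have lin : forall y, is_derive (fun y => y - t) y 1.
  by move=> y; auto_derive => //; ring.
have D : forall y, Rabs (y - t) < e / 2 -> is_derive f y (PSeries (PS_derive u) (y - t)).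
  move=> y Hy; apply: (is_derive_ext_loc (fun y => PSeries u (y - t))).
    have Hd : 0 < e / 2 - Rabs (y - t) by lra.
    exists (mkposreal _ Hd) => x Hx; apply: is_pseries_unique; apply: Ke.
    rewrite (_ : x - t = (x - y) + (y - t)); last by ring.
    have := Rabs_triang (x - y) (y - t); move: Hx; rewrite /ball /= /AbsRing_ball /abs /minus /plus /opp /=.
    rewrite -/(Rminus x y); lra.
  have := is_derive_comp (PSeries u) (fun y => y - t) y _ _ (is_derive_PSeries u (y - t) (in_rad y u eq_refl Hy)) (lin y).
  by rewrite /scal /= /mult /= Rmult_1_l.
have tt : Rabs (t - t) < e / 2 by rewrite Rminus_diag Rabs_R0; lra.
split; first by eexists; apply: D.
apply: (ex_derive_ext_loc (fun y => PSeries (PS_derive u) (y - t))).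
  have Hd : 0 < e / 2 by lra.
  exists (mkposreal _ Hd) => x Hx; symmetry; apply: is_derive_unique; apply: D.
  by move: Hx; rewrite /ball /= /AbsRing_ball /abs /minus /plus /opp /=.
eexists; apply: (is_derive_comp (PSeries (PS_derive u)) (fun y => y - t) t _ _ _ (lin t)).
apply: is_derive_PSeries; apply: in_rad => //; exact: CV_radius_derive.
Qed.

(** * Reflections of a point in the circles *)

Lemma locally_interval t1 t2 t : t1 < t < t2 -> locally t (fun s => t1 < s < t2).
Proof. by move=> [H1 H2]; apply: filter_and; [exact: (open_gt _ t H1)|exact: (open_lt _ t H2)]. Qed.

Lemma locally_subinterval (P : R -> Prop) t1 t2 t : t1 < t < t2 -> locally t P ->
  exists s1 s2, t1 <= s1 < s2 /\ s2 <= t2 /\ s1 < t < s2 /\ forall s, s1 < s < s2 -> P s.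
Proof.
move=> Ht [d Hd]; have d0 := cond_pos d.
exists (Rmax t1 (t - d)), (Rmin t2 (t + d)).
have A1 := Rmax_l t1 (t - d); have A2 := Rmax_r t1 (t - d).
have B1 := Rmin_l t2 (t + d); have B2 := Rmin_r t2 (t + d).
have A3 : Rmax t1 (t - d) < t by apply: Rmax_lub_lt; lra.
have B3 : t < Rmin t2 (t + d) by apply: Rmin_glb_lt; lra.
do ! split => //; try lra.
move=> s Hs; apply: Hd; rewrite /ball /= /AbsRing_ball /abs /minus /plus /opp /=.
by apply: Rabs_def1; lra.
Qed.

Lemma rcont_neq0_near g t : rcont g t -> g t <> 0%C -> locally t (fun s => g s <> 0%C).
Proof.
move=> [H1 H2] N.
have [R0|R0] := Req_dec (Re (g t)) 0; last first.
  have L := continuous_comp (fun s => Re (g s)) Rabs t H1 (continuous_Rabs _).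
  have P : 0 < Rabs (Re (g t)) by apply: Rabs_pos_lt.
  have := L _ (open_gt 0 _ P); rewrite /filtermap; apply: filter_imp => s /= K E.
  by move: K; rewrite E /= Rabs_R0; lra.
have I0 : Im (g t) <> 0 by move=> I0; apply: N; apply: C_eq.
have L := continuous_comp (fun s => Im (g s)) Rabs t H2 (continuous_Rabs _).
have P : 0 < Rabs (Im (g t)) by apply: Rabs_pos_lt.
have := L _ (open_gt 0 _ P); rewrite /filtermap; apply: filter_imp => s /= K E.
by move: K; rewrite E /= Rabs_R0; lra.
Qed.

Lemma rcd0_const g t1 t2 : (forall t, t1 < t < t2 -> rcd g t 0%C) ->
  forall s t, t1 < s < t2 -> t1 < t < t2 -> g s = g t.
Proof.
move=> H.
have K : forall s t, t1 < s < t2 -> t1 < t < t2 -> s < t -> g s = g t.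
  move=> s t Hs Ht L; apply: C_eq.
    apply: (eq_is_derive (fun u => Re (g u))) => // u Hu; apply: (proj1 (H u _)); lra.
  apply: (eq_is_derive (fun u => Im (g u))) => // u Hu; apply: (proj2 (H u _)); lra.
move=> s t Hs Ht; case: (Rtotal_order s t) => [L|[->|L]] //; first exact: K.
by symmetry; exact: K.
Qed.

Section Poles.
Variables (t1 t2 : R) (m m1 m2 : R -> C) (r r1 r2 : R -> R).
Hypothesis Hm : forall t, t1 < t < t2 -> rcd m t (m1 t).
Hypothesis Hm1 : forall t, t1 < t < t2 -> rcd m1 t (m2 t).
Hypothesis Hr : forall t, t1 < t < t2 -> is_derive r t (r1 t).
Hypothesis Hr1 : forall t, t1 < t < t2 -> is_derive r1 t (r2 t).

(* The image of om under the reflection in the circle (conjugated); its derivative vanishes exactly when om is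
   a point of the complexified envelope. *)
Let refl (om : C) (t : R) : C := (Cconj (m t) + RtoC (r t * r t) / (om - m t))%C.
Let drefl (om : C) (t : R) : C :=
  (Cconj (m1 t) + (RtoC (2 * (r t * r1 t)) / (om - m t) + RtoC (r t * r t) * m1 t / ((om - m t) * (om - m t))))%C.

Local Lemma rcd_refl om t : t1 < t < t2 -> m t <> om -> rcd (refl om) t (drefl om t).
Proof.
move=> Ht N.
have N' : (om - m t)%C <> 0%C by move=> /Csub_eq0 E; apply: N.
apply: rcd_eq.
  apply: rcd_plus; first by apply: rcd_conj; apply: Hm.
  apply: rcd_mult.
    apply: rcd_real; apply: is_derive_mult; [exact: Hr|exact: Hr|exact: Rmult_comm].
  by apply: rcd_inv => //; apply: rcd_minus; [exact: rcd_const|exact: Hm].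
have -> : RtoC (plus (mult (r1 t) (r t)) (mult (r t) (r1 t))) = RtoC (2 * (r t * r1 t)).
  by congr RtoC; rewrite /plus /mult /=; ring.
by rewrite /drefl; cfield.
Qed.

Local Lemma drefl_cont om t : t1 < t < t2 -> m t <> om -> rcont (drefl om) t.
Proof.
move=> Ht N.
have N' : (om - m t)%C <> 0%C by move=> /Csub_eq0 E; apply: N.
have D : rcd (fun t => om - m t)%C t (0 - m1 t)%C by apply: rcd_minus; [exact: rcd_const|exact: Hm].
have D2 : rcd (fun t => RtoC (r t * r t)) t (RtoC (r1 t * r t + r t * r1 t)).
  by apply: rcd_real; apply: is_derive_mult; [exact: Hr|exact: Hr|exact: Rmult_comm].
have D1 : rcd (fun t => RtoC (2 * (r t * r1 t))) t (RtoC (2 * (r1 t * r1 t + r t * r2 t))).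
  by apply: rcd_real; apply: is_derive_scal; apply: is_derive_mult; [exact: Hr|exact: Hr1|exact: Rmult_comm].
apply: rcont_plus; first by apply: rcd_rcont; apply: rcd_conj; exact: Hm1.
apply: rcont_plus.
  by apply: rcont_mult; apply: rcd_rcont; [exact: D1|apply: rcd_inv D _].
apply: rcont_mult.
  by apply: rcont_mult; apply: rcd_rcont; [exact: D2|exact: Hm1].
apply: rcd_rcont; apply: rcd_inv; first by apply: rcd_mult; exact: D.
by case/Cmult_integral.
Qed.

(** The first alternative is (om - m)^3 times the derivative of the reflection of om; the second,
    divided by om - m, reads refl * P + Q = 0. So the reflection is either stationary or equal to -
    Q / P, hence constant on some interval. *)
Lemma pole_alternative (om P Q : C) : t1 < t2 -> (P = 0%C -> Q = 0%C -> False) ->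
  (forall t, t1 < t < t2 ->
    ((om - m t) * (m1 t * RtoC (r t * r t) + (RtoC (2 * (r t * r1 t)) * (om - m t) + Cconj (m1 t) * ((om - m t) * (om - m t)))) = 0)%C \/
    ((Cconj (m t) * (om - m t) + RtoC (r t * r t)) * P + (om - m t) * Q = 0)%C) ->
  exists s1 s2, t1 <= s1 < s2 /\ s2 <= t2 /\
   ((forall t, s1 < t < s2 -> m t = om) \/
    exists W, forall t, s1 < t < s2 -> ((W - Cconj (m t)) * (om - m t) = RtoC (r t * r t))%C).
Proof.
move=> H12 NPQ alt.
have [All|[t Ht]] : (forall t, t1 < t < t2 -> m t = om) \/ exists t, t1 < t < t2 /\ m t <> om.
  have [K|K] := classic (exists t, t1 < t < t2 /\ m t <> om); [by right|left => t Ht].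
  by apply: NNPP => N; apply: K; exists t.
  by exists t1, t2; do ! split; try lra; left.
case: Ht => Ht N.
have near : forall t, t1 < t < t2 -> m t <> om -> locally t (fun s => t1 < s < t2 /\ m s <> om).
  move=> s Hs Ns; apply: filter_and; first exact: locally_interval.
  have D : rcd (fun t => m t - om)%C s (m1 s - 0)%C by apply: rcd_minus; [exact: Hm|exact: rcd_const].
  have := rcont_neq0_near _ _ (rcd_rcont _ _ _ D) _; move/(_ (fun E => Ns (Csub_eq0 _ _ E))).
  by apply: filter_imp => u Nu E; apply: Nu; rewrite E; cring.
have sol : forall s W, m s <> om -> refl om s = W -> ((W - Cconj (m s)) * (om - m s) = RtoC (r s * r s))%C.
  move=> s W Ns <-; rewrite /refl; cfield.
  by move=> /Csub_eq0 E; apply: Ns.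
have [s1 [s2 [L1 [L2 [L3 L4]]]]] := locally_subinterval _ _ _ _ Ht (near t Ht N).
(* The two alternatives may be mixed over t. Where the derivative is nonzero it stays so on an
   interval, and there only the second alternative is left. *)
have [All|[u [Hu Nu]]] : (forall u, s1 < u < s2 -> drefl om u = 0%C) \/ exists u, s1 < u < s2 /\ drefl om u <> 0%C.
  have [K|K] := classic (exists u, s1 < u < s2 /\ drefl om u <> 0%C); [by right|left => u Hu].
  by apply: NNPP => Nu; apply: K; exists u.
  exists s1, s2; do ! split; try lra; right; exists (refl om t) => s Hs.
  apply: sol; first by case: (L4 s Hs).
  apply: (rcd0_const (refl om) s1 s2) => // v Hv; rewrite -(All v Hv).
  by have [Hv1 Hv2] := L4 v Hv; apply: rcd_refl.
have [Hu1 Hu2] := L4 u Hu.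
have L5 := rcont_neq0_near _ _ (drefl_cont om u Hu1 Hu2) Nu.
have [v1 [v2 [V1 [V2 [V3 V4]]]]] := locally_subinterval _ _ _ _ Hu L5.
have alt2 : forall v, v1 < v < v2 -> (refl om v * P + Q = 0)%C.
  move=> v Hv; have Hv' : s1 < v < s2 by lra.
  have [W1 W2] := L4 v Hv'; have W3 := V4 v Hv.
  have W4 : (om - m v)%C <> 0%C by move=> /Csub_eq0 E; apply: W2.
  case: (alt v W1) => E.
    case: W3; rewrite /drefl (_ : (_ + _)%C = (om - m v) * (m1 v * RtoC (r v * r v) + (RtoC (2 * (r v * r1 v)) * (om - m v) + Cconj (m1 v) * ((om - m v) * (om - m v)))) / ((om - m v) * (om - m v) * (om - m v)))%C; last by cfield.
    by rewrite E; cfield.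
  rewrite /refl (_ : (_ + _)%C = ((Cconj (m v) * (om - m v) + RtoC (r v * r v)) * P + (om - m v) * Q) / (om - m v))%C; last by cfield.
  by rewrite E; cfield.
(* If P were 0, the relation would force Q = 0, against coprimality. *)
have P0 : P <> 0%C.
  move=> P0; apply: NPQ => //; have := alt2 u V3; rewrite P0 => E.
  by rewrite (_ : Q = refl om u * 0 + Q)%C; [rewrite E|cring].
exists v1, v2; do ! split; try lra; right; exists (- Q / P)%C => v Hv.
apply: sol; first by apply: (proj2 (L4 v _)); lra.
have E := alt2 v Hv; rewrite (_ : refl om v = ((refl om v * P + Q) - Q) / P)%C; last by cfield.
by rewrite E; cfield.
Qed.
End Poles.

Section Relations.
Variables (a b c : R -> R) (m : R -> C) (r : R -> R).
(** An affine relation valid for all t. [NP] expresses that the circles do not form a pencil, [AE]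
    that a relation on a subinterval extends by analyticity. *)
Let relI a1 b1 c1 d1 := forall t, unit_interval t -> a1 * a t + b1 * b t + c1 * c t + d1 = 0.
Hypothesis NP : forall a1 b1 c1 d1 a2 b2 c2 d2, lin_indep4 a1 b1 c1 d1 a2 b2 c2 d2 ->
  relI a1 b1 c1 d1 -> relI a2 b2 c2 d2 -> False.
Hypothesis AE : forall s1 s2 a1 b1 c1 d1, 0 <= s1 < s2 -> s2 <= 1 ->
  (forall t, s1 < t < s2 -> a1 * a t + b1 * b t + c1 * c t + d1 = 0) -> relI a1 b1 c1 d1.
Hypothesis Em : forall t, m t = (- a t / 2, - b t / 2).
Hypothesis Er : forall t, unit_interval t -> r t * r t = (a t * a t + b t * b t) / 4 - c t.

(** Constancy of the centre fixes both a and b, which is already two independent relations. *)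
Lemma centre_not_constant s1 s2 om : 0 <= s1 < s2 -> s2 <= 1 -> (forall t, s1 < t < s2 -> m t = om) -> False.
Proof.
move=> H1 H2 E.
apply: (NP 1 0 0 (2 * Re om) 0 1 0 (2 * Im om)).
- by move=> x y; lra.
- apply: (AE s1 s2) => // t Ht; have := f_equal Re (E t Ht); rewrite Em /Re /=; lra.
- apply: (AE s1 s2) => // t Ht; have := f_equal Im (E t Ht); rewrite Em /Im /=; lra.
Qed.

(** Since |m|^2 - r^2 = c, the real and imaginary parts are affine relations. Only the real part
    involves c, so without a pencil the imaginary one must be trivial. Then W = conj om, and the
    real part says that om lies on every circle. *)
Lemma reflection_point_on_circles s1 s2 om W : 0 <= s1 < s2 -> s2 <= 1 ->
  (forall t, s1 < t < s2 -> ((W - Cconj (m t)) * (om - m t) = RtoC (r t * r t))%C) ->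
  relI (Re om) (Im om) 1 (Re om * Re om + Im om * Im om).
Proof.
move=> H1 H2 E.
have E1 : forall t, s1 < t < s2 -> (Re W + Re om) / 2 * a t + (Im om - Im W) / 2 * b t + 1 * c t + (Re W * Re om - Im W * Im om) = 0.
  move=> t Ht; have := f_equal Re (E t Ht); rewrite Em /Re /Im /= Er /=; last by rewrite /unit_interval; lra.
  lra.
have E2 : forall t, s1 < t < s2 -> (Im W + Im om) / 2 * a t + (Re W - Re om) / 2 * b t + 0 * c t + (Re W * Im om + Im W * Re om) = 0.
  move=> t Ht; have := f_equal Im (E t Ht); rewrite Em /Im /Re /=; lra.
have D : Im W + Im om = 0 /\ Re W - Re om = 0.
  apply: NNPP => N.
  apply: (NP ((Re W + Re om) / 2) ((Im om - Im W) / 2) 1 (Re W * Re om - Im W * Im om)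
    ((Im W + Im om) / 2) ((Re W - Re om) / 2) 0 (Re W * Im om + Im W * Re om)).
  - move=> x y X1 X2 X3 X4; have x0 : x = 0 by lra.
    split => //; apply: NNPP => y0; apply: N; rewrite x0 in X1 X2.
    by split; apply: (Rmult_eq_reg_l y) => //; lra.
  - by apply: (AE s1 s2).
  - by apply: (AE s1 s2) => // t Ht; have := E2 t Ht; lra.
have [D1 D2] := D.
apply: (AE s1 s2) => // t Ht; have := E1 t Ht.
have -> : Re W = Re om by lra.
have -> : Im W = - Im om by lra.
lra.
Qed.

(** Passing through a point is an affine relation with coefficient 1 at c; distinct points give
    independent relations. *)
Lemma common_point_unique om om' :
  relI (Re om) (Im om) 1 (Re om * Re om + Im om * Im om) ->
  relI (Re om') (Im om') 1 (Re om' * Re om' + Im om' * Im om') -> om = om'.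
Proof.
move=> H H'; apply: NNPP => N; apply: (NP _ _ _ _ _ _ _ _ _ H H').
move=> x y X1 X2 X3 X4; have Ey : y = - x by lra.
rewrite Ey in X1 X2 *.
suff x0 : x = 0 by split; lra.
apply: NNPP => x0; apply: N; apply: C_eq; apply: (Rmult_eq_reg_l x) => //; lra.
Qed.

(** A relation between the coordinates of the centre has no c term, so it is independent of the
    relation expressing that om lies on the circles, unless it is trivial. *)
Lemma centre_affine_indep om s1 s2 al be de :
  relI (Re om) (Im om) 1 (Re om * Re om + Im om * Im om) -> 0 <= s1 < s2 -> s2 <= 1 ->
  (forall t, s1 < t < s2 -> al * Re (m t - om)%C + be * Im (m t - om)%C + de = 0) -> al = 0 /\ be = 0 /\ de = 0.
Proof.
move=> H H1 H2 E.
have D : al = 0 /\ be = 0.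
  apply: NNPP => N.
  apply: (NP _ _ _ _ (- al / 2) (- be / 2) 0 (de - al * Re om - be * Im om) _ H).
    move=> x y X1 X2 X3 X4; have x0 : x = 0 by lra.
    split => //; apply: NNPP => y0; apply: N; rewrite x0 in X1 X2.
    by split; apply: (Rmult_eq_reg_l y) => //; lra.
  apply: (AE s1 s2) => // t Ht; have := E t Ht; rewrite Em /Re /Im /=; lra.
have [D1 D2] := D; do ! split => //.
have := E ((s1 + s2) / 2) ltac:(lra); rewrite D1 D2; lra.
Qed.
End Relations.

Module RationalCoefficients.
Import mathcomp.boot.all_boot mathcomp.algebra.all_algebra mathcomp.real_closed.complex mathcomp.reals_stdlib.Rstruct mathcomp.zify.zify.
Import GRing.Theory.
Delimit Scope R_scope with R.
Delimit Scope nat_scope with N.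
Delimit Scope C_scope with C.
Delimit Scope ring_scope with Ri.
Local Open Scope ring_scope.

(** * Polynomials over the complex numbers *)

Notation RC := (complex.complex R).

Definition toRC (z : C) : RC := complex.Complex (fst z) (snd z).
Definition ofRC (x : RC) : C := (complex.Re x, complex.Im x).

Lemma toRCK z : ofRC (toRC z) = z. Proof. by case: z. Qed.
Lemma ofRCK x : toRC (ofRC x) = x. Proof. by case: x. Qed.

Lemma ofRC0 : ofRC 0 = RtoC 0%R. Proof. by []. Qed.
Lemma ofRC1 : ofRC 1 = RtoC 1%R. Proof. by []. Qed.
Lemma ofRCD x y : ofRC (x + y) = Cplus (ofRC x) (ofRC y). Proof. by case: x; case: y. Qed.
Lemma ofRCM x y : ofRC (x * y) = Cmult (ofRC x) (ofRC y).
Proof. by case: x; case: y. Qed.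
Lemma ofRCN x : ofRC (- x) = Copp (ofRC x). Proof. by case: x. Qed.

(** The bridge between the two copies of the complex numbers: derivatives and integrals are taken in
    [C], polynomial algebra is done over [RC]. *)
Definition peval (P : {poly RC}) (z : C) : C := ofRC P.[toRC z].

Lemma pevalD P Q z : peval (P + Q) z = Cplus (peval P z) (peval Q z).
Proof. by rewrite /peval hornerD ofRCD. Qed.
Lemma pevalN P z : peval (- P) z = Copp (peval P z).
Proof. by rewrite /peval hornerN ofRCN. Qed.
Lemma pevalM P Q z : peval (P * Q) z = Cmult (peval P z) (peval Q z).
Proof. by rewrite /peval hornerM ofRCM. Qed.
Lemma pevalC c z : peval (toRC c)%:P z = c.
Proof. by rewrite /peval hornerC toRCK. Qed.
Lemma pevalX z : peval 'X z = z.
Proof. by rewrite /peval hornerX toRCK. Qed.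
Lemma peval0 z : peval 0 z = RtoC 0%R.
Proof. by rewrite /peval horner0. Qed.
Lemma pevalXn P n z : peval (P ^+ n) z = Cpow (peval P z) n.
Proof.
elim: n => [|n IH]; first by rewrite expr0 /peval hornerC.
by rewrite exprS pevalM IH.
Qed.
Lemma peval_comp P Q z : peval (P \Po Q) z = peval P (peval Q z).
Proof. by rewrite /peval horner_comp ofRCK. Qed.

Lemma toRC_inj z w : toRC z = toRC w -> z = w.
Proof. by move=> E; rewrite -(toRCK z) E toRCK. Qed.

Lemma peval_eq0 P z : (peval P z = RtoC 0%R) -> root P (toRC z).
Proof. by move=> E; apply/rootP; rewrite -(ofRCK P.[_]) -/(peval P z) E. Qed.

Lemma poly_eq0_inf (P : {poly RC}) (g : nat -> C) :
  injective g -> (forall n, peval P (g n) = RtoC 0%R) -> P = 0.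
Proof.
move=> inj H; apply/eqP; apply: contraT => nz.
have := @max_poly_roots _ P [seq toRC (g i) | i <- seq.iota 0 (size P)] nz.
rewrite size_map size_iota ltnn => -> //.
  by apply/allP => x /mapP[i _ ->]; apply: peval_eq0.
by rewrite map_inj_uniq ?iota_uniq // => i j /toRC_inj/inj.
Qed.

Lemma cis_inj s t : (Rabs (s - t) < 2 * PI)%R -> cis s = cis t -> s = t.
Proof.
move=> L E.
have [Ec Es] : cos s = cos t /\ sin s = sin t by case: E.
have C1 : cos (s - t) = 1%R by rewrite cos_minus Ec Es; have := sin2_cos2 t; rewrite /Rsqr; lra.
have S0 : sin ((s - t) / 2) = 0%R.
  have := cos_2a_sin ((s - t) / 2).
  rewrite (_ : (2 * ((s - t) / 2) = s - t)%R); last by field.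
  rewrite C1; nra.
have [B1 B2] := Rabs_def2 _ _ L.
case: (Rtotal_order (s - t) 0) => [K|[K|K]]; last first.
- by have := sin_gt_0 ((s - t) / 2)%R ltac:(lra) ltac:(lra); lra.
- lra.
- have := sin_gt_0 (- ((s - t) / 2))%R ltac:(lra) ltac:(lra); rewrite sin_neg; lra.
Qed.

(** Infinitely many distinct angles of an open arc: a polynomial vanishing there is zero, and they
    also serve as interpolation nodes. The summand 2 keeps the node i = 0 away from th2. *)
Definition arc_node (th1 th2 : R) (i : nat) : R := (th1 + (th2 - th1) / (INR i + 2))%R.

Lemma arc_node_in th1 th2 i : (th1 < th2)%R -> (th1 < arc_node th1 th2 i < th2)%R.
Proof.
move=> H; have I := pos_INR i; rewrite /arc_node.
have P : (0 < (th2 - th1) / (INR i + 2))%R by apply: Rdiv_lt_0_compat; lra.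
suff : ((th2 - th1) / (INR i + 2) < th2 - th1)%R by lra.
by apply/Rlt_div_l; [lra|nra].
Qed.

Lemma arc_node_inj th1 th2 : (th1 < th2)%R -> injective (arc_node th1 th2).
Proof.
move=> H i j; rewrite /arc_node => E.
have I := pos_INR i; have J := pos_INR j.
have {}E : ((th2 - th1) / (INR i + 2) = (th2 - th1) / (INR j + 2))%R by lra.
apply: INR_eq.
have A : ((th2 - th1) = (th2 - th1) / (INR i + 2) * (INR i + 2))%R by field; lra.
have B : ((th2 - th1) = (th2 - th1) / (INR j + 2) * (INR j + 2))%R by field; lra.
have N : ((th2 - th1) / (INR j + 2) <> 0)%R.
  by apply: Rgt_not_eq; apply: Rdiv_lt_0_compat; lra.
have : ((th2 - th1) / (INR j + 2) * (INR i + 2) = (th2 - th1) / (INR j + 2) * (INR j + 2))%R by rewrite -B -{1}E -A.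
move/(Rmult_eq_reg_l _ _ _) => /(_ N) K; lra.
Qed.

Lemma arc_cis_inj th1 th2 : (th1 < th2)%R -> (th2 - th1 < PI)%R ->
  injective (fun i => cis (arc_node th1 th2 i)).
Proof.
move=> H L i j E; apply: (arc_node_inj th1 th2 H); apply: cis_inj E.
have := arc_node_in th1 th2 i H; have := arc_node_in th1 th2 j H => A B.
by apply: Rabs_def1; lra.
Qed.

Lemma poly_eq0_arc (P : {poly RC}) (m : C) (r th1 th2 : R) : (th1 < th2)%R -> (th2 - th1 < PI)%R -> r <> 0%R ->
  (forall t, (th1 < t < th2)%R -> peval P (Cplus m (Cmult (RtoC r) (cis t))) = RtoC 0%R) -> P = 0.
Proof.
move=> H L r0 Z; apply: (poly_eq0_inf _ (fun i => Cplus m (Cmult (RtoC r) (cis (arc_node th1 th2 i))))); last first.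
  by move=> n; apply: Z; apply: arc_node_in.
move=> i j E; apply: (arc_cis_inj th1 th2 H L).
have rc : RtoC r <> RtoC 0%R by move/RtoC_inj.
have F : forall u : C, (u = (m + r * u - m) / r)%C by move=> u; field.
by rewrite (F (cis _)) E -F.
Qed.

Lemma ofRC_sum n (F : nat -> RC) : ofRC (\sum_(i < n) F i) = csum (fun i => ofRC (F i)) n.
Proof.
elim: n => [|n IH]; first by rewrite big_ord0.
by rewrite big_ord_recr ofRCD IH.
Qed.

Lemma rcd_csum n (f : nat -> R -> C) (d : nat -> C) t :
  (forall i, rcd (f i) t (d i)) -> rcd (fun s => csum (fun i => f i s) n) t (csum d n).
Proof.
move=> H; elim: n => [|n IH] /=; first exact: rcd_const.
exact: rcd_plus.
Qed.

Lemma csum_ext n f g : (forall i, f i = g i) -> csum f n = csum g n.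
Proof. by move=> E; elim: n => [|n IH] //=; rewrite IH E. Qed.

(* A polynomial family of bounded degree is determined by its values at fixed nodes (Lagrange), so its
   derivative in the parameter is again polynomial of the same degree, with no regularity of the
   coefficients assumed. *)
Lemma poly_family_derivative (d : nat) (th1 th2 t1 t2 : R) (W W' : R -> R -> C) :
  (th1 < th2)%R -> (th2 - th1 < PI)%R ->
  (forall t, (t1 < t < t2)%R -> exists P : {poly RC}, (size P <= d)%N /\
     forall th, (th1 < th < th2)%R -> W th t = peval P (cis th)) ->
  (forall th t, (th1 < th < th2)%R -> (t1 < t < t2)%R -> rcd (W th) t (W' th t)) ->
  forall t, (t1 < t < t2)%R -> exists P : {poly RC}, (size P <= d.+1)%N /\
     forall th, (th1 < th < th2)%R -> W' th t = peval P (cis th).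
Proof.
move=> H L HP D t Ht.
pose x i := toRC (cis (arc_node th1 th2 i)).
have xi : injective x by move=> i j /toRC_inj/(arc_cis_inj th1 th2 H L).
pose Li (i : nat) : {poly RC} := (d.+1.-lagrange x)`_i.
(* The Lagrange polynomials do not depend on s, so differentiating in s touches only the values of W
   at the nodes. *)
have interp : forall th s, (th1 < th < th2)%R -> (t1 < s < t2)%R ->
    W th s = csum (fun i => Cmult (W (arc_node th1 th2 i) s) (peval (Li i) (cis th))) d.+1.
  move=> th s Hth Hs; have [P [Ps E]] := HP s Hs.
  rewrite (E th Hth) /peval {1}(@lagrange_gen _ d.+1 x _ xi P) //; last by apply: leq_trans Ps _.
  rewrite horner_sum (eq_bigr (fun i : 'I_d.+1 => (P.[x i]) * (Li i).[toRC (cis th)])); last first.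
    by move=> i _; rewrite hornerM hornerC /Li nth_lagrange.
  rewrite (ofRC_sum d.+1 (fun i => P.[x i] * (Li i).[toRC (cis th)])).
  apply: csum_ext => i; rewrite ofRCM (E (arc_node th1 th2 i)) //; exact: arc_node_in.
exists (\sum_(i < d.+1) (toRC (W' (arc_node th1 th2 i) t))%:P * Li i); split.
  apply: (leq_trans (size_sum _ _ _)); apply/bigmax_leqP => i _.
  apply: (leq_trans (size_polyMleq _ _)).
  rewrite /Li nth_lagrange size_lagrange_ //.
  by rewrite size_polyC; case: (_ != _).
move=> th Hth.
rewrite /peval horner_sum (eq_bigr (fun i : 'I_d.+1 => toRC (W' (arc_node th1 th2 i) t) * (Li i).[toRC (cis th)])); last first.
  by move=> i _; rewrite hornerM hornerC.
rewrite (ofRC_sum d.+1 (fun i => toRC (W' (arc_node th1 th2 i) t) * (Li i).[toRC (cis th)])).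
apply: (rcd_unique (W th) t); first exact: D.
apply: (rcd_ext_loc (fun s => csum (fun i => Cmult (W (arc_node th1 th2 i) s) (peval (Li i) (cis th))) d.+1)).
  have Lo : locally t (fun s => (t1 < s < t2)%R) by apply: filter_and; [exact: (open_gt _ t (proj1 Ht))|exact: (open_lt _ t (proj2 Ht))].
  by apply: filter_imp Lo => s Hs; rewrite -interp.
apply: rcd_csum => i; apply: rcd_eq.
  by apply: rcd_mult; [apply: D => //; apply: arc_node_in|apply: rcd_const].
by rewrite ofRCM toRCK /peval; cring.
Qed.

Local Close Scope ring_scope.
Local Open Scope R_scope.
Notation Re := Coquelicot.Complex.Re.
Notation Im := Coquelicot.Complex.Im.

(** * Functions rational along the circles *)

Lemma size_polyM_le (P Q : {poly RC}) a b : (size P <= a)%N -> (size Q <= b)%N -> (size (P * Q)%Ri <= a + b)%N.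
Proof.
by move=> H1 H2; apply: leq_trans (size_polyMleq _ _) _; apply: leq_trans (leq_pred _) (leq_add H1 H2).
Qed.

Lemma size_deriv_leq (P : {poly RC}) : (size (P^`())%Ri <= size P)%N.
Proof. by have [->|/lt_size_deriv/ltnW //] := eqVneq P 0%Ri; rewrite deriv0. Qed.

Lemma size_polyD_le (P Q : {poly RC}) a b : (size P <= a)%N -> (size Q <= b)%N -> (size (P + Q)%Ri <= a + b)%N.
Proof.
move=> H1 H2; apply: leq_trans (size_polyD _ _) _; rewrite geq_max.
by rewrite (leq_trans H1 (leq_addr _ _)) (leq_trans H2 (leq_addl _ _)).
Qed.

Lemma Cdiv_r_move (a b c : C) : c <> 0%C -> (a * c = b)%C -> a = (b / c)%C.
Proof. by move=> H <-; field. Qed.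

Lemma cdiff_peval (P : {poly RC}) (z : C) : cdiff (peval P) z (peval (P^`())%Ri z).
Proof.
elim/poly_ind: P => [|P c IH].
  rewrite deriv0 peval0; have := cdiff_const 0%C z.
  by case=> [H1 H2]; split; [apply: diff2_ext H1|apply: diff2_ext H2] => u v; rewrite peval0.
have D := cdiff_plus _ _ _ _ _ (cdiff_mult _ _ _ _ _ IH (cdiff_id z)) (cdiff_const (ofRC c) z).
rewrite derivMXaddC pevalD pevalM pevalX.
have E : forall u, peval (P * 'X + c%:P)%Ri u = (peval P u * u + ofRC c)%C.
  by move=> u; rewrite pevalD pevalM pevalX /peval hornerC.
have D' : cdiff (peval (P * 'X + c%:P)%Ri) z (peval (P^`())%Ri z * z + peval P z * 1 + 0)%C.
  by case: D => [H1 H2]; split; [apply: diff2_ext H1|apply: diff2_ext H2] => u v; rewrite E.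
by apply: (cdiff_eq _ _ _ _ D'); cring.
Qed.

Lemma rcd_pow f t d n : rcd f t d -> rcd (fun s => f s ^ n)%C t (dpow (f t) n * d)%C.
Proof.
move=> H; elim: n => [|n IH]; first by apply: rcd_eq; [exact: rcd_const|rewrite /=; cring].
apply: rcd_eq; first by apply: (rcd_mult f (fun s => f s ^ n)%C); [exact: H|exact: IH].
by rewrite /=; cring.
Qed.

Lemma dpow_mul z n : (dpow z n * z = RtoC (INR n) * z ^ n)%C.
Proof. by case: n => [|n]; [rewrite /=; cring|rewrite dpowS /=; cring]. Qed.

Lemma cis_conj t : Cconj (cis t) = (/ cis t)%C.
Proof.
have H : (Cconj (cis t) * cis t = 1)%C.
  apply: C_eq; rewrite /cis /Re /Im /=; have := sin2_cos2 t; rewrite /Rsqr; lra.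
by rewrite (Cdiv_r_move _ _ _ (cis_neq0 t) H); field; apply: cis_neq0.
Qed.

Lemma Cpow_add z a b : (z ^ (a + b)%N = z ^ a * z ^ b)%C.
Proof. by elim: a => [|a IH]; [rewrite add0n /=; cring|rewrite addSn !CpowS IH; cring]. Qed.

Section Family.
Variables (th1 th2 t1 t2 : R) (m m1 m2 : R -> C) (r r1 r2 : R -> R).
Hypothesis Hth : th1 < th2.
Hypothesis Hpi : th2 - th1 < PI.
Hypothesis Hm : forall t, t1 < t < t2 -> rcd m t (m1 t).
Hypothesis Hm1 : forall t, t1 < t < t2 -> rcd m1 t (m2 t).
Hypothesis Hr : forall t, t1 < t < t2 -> is_derive r t (r1 t).
Hypothesis Hr1 : forall t, t1 < t < t2 -> is_derive r1 t (r2 t).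
Hypothesis r_pos : forall t, t1 < t < t2 -> 0 < r t.

(** The degree bound is uniform in t, as interpolation at fixed nodes requires; the dependence of
    the coefficients on t is left arbitrary. *)
Definition polyfam (W : R -> R -> C) : Prop :=
  exists d : nat, forall t, t1 < t < t2 -> exists P : {poly RC}, (size P <= d)%N /\
    forall th, th1 < th < th2 -> W th t = peval P (cis th).

Lemma polyfam_ext W W' : (forall th t, th1 < th < th2 -> t1 < t < t2 -> W th t = W' th t) -> polyfam W -> polyfam W'.
Proof.
move=> E [d H]; exists d => t Ht; have [P [Ps HP]] := H t Ht; exists P; split => // th Hh.
by rewrite -E // HP.
Qed.

Lemma polyfam_plus V W : polyfam V -> polyfam W -> polyfam (fun th t => V th t + W th t)%C.
Proof.
move=> [d H] [e K]; exists (d + e)%N => t Ht; have [P [Ps HP]] := H t Ht; have [Q [Qs HQ]] := K t Ht.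
exists (P + Q)%Ri; split; first exact: size_polyD_le.
by move=> th Hh; rewrite pevalD HP // HQ.
Qed.

Lemma polyfam_mult V W : polyfam V -> polyfam W -> polyfam (fun th t => V th t * W th t)%C.
Proof.
move=> [d H] [e K]; exists (d + e)%N => t Ht; have [P [Ps HP]] := H t Ht; have [Q [Qs HQ]] := K t Ht.
exists (P * Q)%Ri; split; first exact: size_polyM_le.
by move=> th Hh; rewrite pevalM HP // HQ.
Qed.

Lemma polyfam_coef (c : R -> C) : polyfam (fun _ t => c t).
Proof.
exists 1%N => t _; exists (toRC (c t))%:P%Ri; split; first by rewrite size_polyC; case: (_ != _).
by move=> th _; rewrite pevalC.
Qed.

Lemma polyfam_cis : polyfam (fun th _ => cis th).
Proof. by exists 2%N => t _; exists 'X%Ri; split; [rewrite size_polyX|move=> th _; rewrite pevalX]. Qed.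

Lemma polyfam_pow W n : polyfam W -> polyfam (fun th t => W th t ^ n)%C.
Proof.
move=> H; elim: n => [|n IH] /=; first exact: (polyfam_coef (fun _ => 1%C)).
exact: polyfam_mult.
Qed.

Lemma polyfam_dt W W' : polyfam W ->
  (forall th t, th1 < th < th2 -> t1 < t < t2 -> rcd (W th) t (W' th t)) -> polyfam W'.
Proof.
move=> [d H] D; exists d.+1 => t Ht.
exact: (poly_family_derivative d th1 th2 t1 t2 W W' Hth Hpi H D t Ht).
Qed.

Lemma polyfam_dth W W' : polyfam W ->
  (forall th t, th1 < th < th2 -> t1 < t < t2 -> rcd (fun s => W s t) th (W' th t)) -> polyfam W'.
Proof.
move=> [d H] D; exists (2 + d)%N => t Ht; have [P [Ps HP]] := H t Ht.
exists ((toRC Ci *: 'X) * P^`())%Ri; split.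
  apply: size_polyM_le; first by apply: leq_trans (size_scale_leq _ _) _; rewrite size_polyX.
  exact: leq_trans (size_deriv_leq P) Ps.
move=> th Hh; apply: (rcd_unique (fun s => W s t) th); first exact: D.
have Lo : locally th (fun s => th1 < s < th2) by apply: filter_and; [exact: (open_gt _ th (proj1 Hh))|exact: (open_lt _ th (proj2 Hh))].
apply: (rcd_ext_loc (fun s => peval P (cis s))); first by apply: filter_imp Lo => s Hs; rewrite HP.
apply: rcd_eq; first exact: (rcd_comp _ cis th _ _ (cdiff_peval P (cis th)) (rcd_cis th)).
rewrite pevalM (_ : peval (_ *: 'X)%Ri (cis th) = Ci * cis th)%C; first by cring.
by rewrite /peval hornerZ hornerX ofRCM !toRCK.
Qed.

(* S = 2 cis^2 (r1 + Re (conj m1 * cis)): twice the normal speed of the circle at the angle th, cleared of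
   negative powers of cis. *)
Let S (th t : R) : C := (cis th * (m1 t + (RtoC (2 * r1 t) * cis th + Cconj (m1 t) * (cis th * cis th))))%C.
Let St (th t : R) : C := (cis th * (m2 t + (RtoC (2 * r2 t) * cis th + Cconj (m2 t) * (cis th * cis th))))%C.

Local Lemma polyfam_S : polyfam S.
Proof.
apply: polyfam_mult; first exact: polyfam_cis.
apply: polyfam_plus; first exact: polyfam_coef.
apply: polyfam_plus; first by apply: polyfam_mult; [exact: (polyfam_coef (fun t => RtoC (2 * r1 t)))|exact: polyfam_cis].
by apply: polyfam_mult; [exact: (polyfam_coef (fun t => Cconj (m1 t)))|apply: polyfam_mult; exact: polyfam_cis].
Qed.

Local Lemma polyfam_St : polyfam St.
Proof.
apply: polyfam_mult; first exact: polyfam_cis.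
apply: polyfam_plus; first exact: polyfam_coef.
apply: polyfam_plus; first by apply: polyfam_mult; [exact: (polyfam_coef (fun t => RtoC (2 * r2 t)))|exact: polyfam_cis].
by apply: polyfam_mult; [exact: (polyfam_coef (fun t => Cconj (m2 t)))|apply: polyfam_mult; exact: polyfam_cis].
Qed.

Local Lemma rcd_St th t : t1 < t < t2 -> rcd (S th) t (St th t).
Proof.
move=> Ht; apply: rcd_scal; apply: rcd_plus; first exact: Hm1.
apply: rcd_plus.
  apply: rcd_eq.
    apply: rcd_mult; last exact: rcd_const.
    by apply: rcd_real; apply: is_derive_scal; apply: Hr1.
  by rewrite /scal /= /mult /=; cring.
apply: rcd_eq; first by apply: rcd_mult; [apply: rcd_conj; exact: Hm1|exact: rcd_const].
by cring.
Qed.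

Let Sth (th t : R) : C :=
  (Ci * cis th * (m1 t + (RtoC (2 * r1 t) * cis th + Cconj (m1 t) * (cis th * cis th)))
  + cis th * (RtoC (2 * r1 t) * (Ci * cis th) + Cconj (m1 t) * (2 * Ci * cis th * cis th)))%C.

Local Lemma rcd_Sth th t : rcd (fun s => S s t) th (Sth th t).
Proof.
apply: rcd_eq.
  apply: rcd_mult; first exact: rcd_cis.
  apply: rcd_plus; first exact: rcd_const.
  apply: rcd_plus; first by apply: rcd_scal; exact: rcd_cis.
  by apply: rcd_scal; apply: rcd_mult; exact: rcd_cis.
by rewrite /Sth; cring.
Qed.

(* The class of functions that are rational in cis th for each t, with a power of S as denominator. *)
Definition inG (G : R -> R -> C) : Prop := exists n, polyfam (fun th t => S th t ^ n * G th t)%C.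

Lemma inG_ext G G' : (forall th t, th1 < th < th2 -> t1 < t < t2 -> G th t = G' th t) -> inG G -> inG G'.
Proof. by move=> E [n H]; exists n; apply: polyfam_ext H => th t H1 H2; rewrite E. Qed.

Lemma inG_plus G H : inG G -> inG H -> inG (fun th t => G th t + H th t)%C.
Proof.
move=> [n HG] [k HH]; exists (n + k)%N.
apply: (polyfam_ext (fun th t => S th t ^ k * (S th t ^ n * G th t) + S th t ^ n * (S th t ^ k * H th t))%C).
  by move=> th t _ _; rewrite Cpow_add; cring.
by apply: polyfam_plus; apply: polyfam_mult => //; apply: polyfam_pow; exact: polyfam_S.
Qed.

Lemma inG_mult_poly W G : polyfam W -> inG G -> inG (fun th t => W th t * G th t)%C.
Proof.
move=> HW [n HG]; exists n.
apply: (polyfam_ext (fun th t => W th t * (S th t ^ n * G th t))%C); first by move=> th t _ _; cring.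
exact: polyfam_mult.
Qed.

Lemma inG_div G G' : (forall th t, th1 < th < th2 -> t1 < t < t2 -> (S th t * G' th t)%C = G th t) -> inG G -> inG G'.
Proof.
move=> E [n HG]; exists n.+1.
by apply: polyfam_ext HG => th t H1 H2; rewrite -E //=; cring.
Qed.

(** S^(n+1) G_t = S (S^n G)_t - n S_t (S^n G), so one more power of S clears the denominators of the
    derivative. *)
Lemma inG_dt G G' : inG G ->
  (forall th t, th1 < th < th2 -> t1 < t < t2 -> rcd (G th) t (G' th t)) -> inG G'.
Proof.
move=> [n HG] D; exists n.+1.
have HD : polyfam (fun th t => dpow (S th t) n * St th t * G th t + S th t ^ n * G' th t)%C.
  apply: (polyfam_dt _ _ HG) => th t H1 H2; apply: rcd_mult; last exact: D.
  by apply: rcd_pow; exact: rcd_St.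
apply: (polyfam_ext (fun th t => S th t * (dpow (S th t) n * St th t * G th t + S th t ^ n * G' th t)
   + (- RtoC (INR n)) * (St th t * (S th t ^ n * G th t)))%C).
  move=> th t _ _; rewrite [(_ ^ n.+1)%C]/=.
  rewrite (_ : (S th t * (dpow (S th t) n * St th t * G th t + S th t ^ n * G' th t) =
    (dpow (S th t) n * S th t) * St th t * G th t + S th t * S th t ^ n * G' th t)%C); last by cring.
  by rewrite dpow_mul; cring.
apply: polyfam_plus; first by apply: polyfam_mult; [exact: polyfam_S|exact: HD].
apply: polyfam_mult; first exact: (polyfam_coef (fun _ => - RtoC (INR n))%C).
by apply: polyfam_mult; [exact: polyfam_St|exact: HG].
Qed.

Lemma inG_dth G G' : inG G ->
  (forall th t, th1 < th < th2 -> t1 < t < t2 -> rcd (fun s => G s t) th (G' th t)) -> inG G'.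
Proof.
move=> [n HG] D; exists n.+1.
have HD : polyfam (fun th t => dpow (S th t) n * Sth th t * G th t + S th t ^ n * G' th t)%C.
  apply: (polyfam_dth _ _ HG) => th t H1 H2; apply: rcd_mult; last exact: D.
  by apply: (rcd_pow (fun s => S s t)); exact: rcd_Sth.
have HS : polyfam Sth by apply: (polyfam_dth _ _ polyfam_S) => th t H1 H2; exact: rcd_Sth.
apply: (polyfam_ext (fun th t => S th t * (dpow (S th t) n * Sth th t * G th t + S th t ^ n * G' th t)
   + (- RtoC (INR n)) * (Sth th t * (S th t ^ n * G th t)))%C).
  move=> th t _ _; rewrite [(_ ^ n.+1)%C]/=.
  rewrite (_ : (S th t * (dpow (S th t) n * Sth th t * G th t + S th t ^ n * G' th t) =
    (dpow (S th t) n * S th t) * Sth th t * G th t + S th t * S th t ^ n * G' th t)%C); last by cring.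
  by rewrite dpow_mul; cring.
apply: polyfam_plus; first by apply: polyfam_mult; [exact: polyfam_S|exact: HD].
apply: polyfam_mult; first exact: (polyfam_coef (fun _ => - RtoC (INR n))%C).
by apply: polyfam_mult; [exact: HS|exact: HG].
Qed.

(* The two parameter derivatives of a function of the point are the combinations of its Wirtinger derivatives
   p and q with the velocities of the point; solving the 2x2 system has determinant proportional to S. *)
Lemma inG_wirtinger G p q : inG G ->
  (forall th t, th1 < th < th2 -> t1 < t < t2 ->
    rcd (fun s => G s t) th (p th t * (RtoC (r t) * (Ci * cis th)) + q th t * Cconj (RtoC (r t) * (Ci * cis th)))%C) ->
  (forall th t, th1 < th < th2 -> t1 < t < t2 ->
    rcd (G th) t (p th t * (m1 t + RtoC (r1 t) * cis th) + q th t * Cconj (m1 t + RtoC (r1 t) * cis th))%C) ->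
  inG p /\ inG q.
Proof.
move=> HG Dth Dt; have Gth := inG_dth _ _ HG Dth; have Gt := inG_dt _ _ HG Dt.
have Ci0 := Ci_neq0.
have CC : (Ci * Ci = - 1)%C by apply: C_eq; rewrite /Re /Im /=; ring.
have conj1 : forall th t, Cconj (RtoC (r t) * (Ci * cis th)) = (- (RtoC (r t) * (Ci / cis th)))%C.
  by move=> th t; rewrite !Cmult_conj cis_conj; apply: C_eq; rewrite /Cdiv; move: (/ cis th)%C => x; rewrite /Re /Im /=; ring.
have conj2 : forall th t, Cconj (m1 t + RtoC (r1 t) * cis th) = (Cconj (m1 t) + RtoC (r1 t) / cis th)%C.
  move=> th t; rewrite Cplus_conj Cmult_conj cis_conj; congr (_ + _ * _)%C.
  by apply: C_eq; rewrite /Re /Im /=; ring.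
have Hp : inG p.
  (* The multiplier of the angular derivative is chosen to cancel q; what remains is S p. *)
  apply: (inG_div (fun th t => cis th * (p th t * (m1 t + RtoC (r1 t) * cis th) + q th t * Cconj (m1 t + RtoC (r1 t) * cis th))
     + (/ (Ci * RtoC (r t)) * (cis th * (Cconj (m1 t) * cis th + RtoC (r1 t)))) *
       (p th t * (RtoC (r t) * (Ci * cis th)) + q th t * Cconj (RtoC (r t) * (Ci * cis th))))%C).
    move=> th t H1 H2; rewrite conj1 conj2 /S RtoC_mult; have r0 := r_pos t H2.
    have rc : RtoC (r t) <> 0%C by move/RtoC_inj; lra.
    have e0 := cis_neq0 th.
    by field; do ! split.
  apply: inG_plus; first by apply: inG_mult_poly Gt; exact: polyfam_cis.
  apply: inG_mult_poly Gth; apply: polyfam_mult; first exact: (polyfam_coef (fun t => / (Ci * RtoC (r t)))%C).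
  apply: polyfam_mult; first exact: polyfam_cis.
  apply: polyfam_plus; last exact: (polyfam_coef (fun t => RtoC (r1 t))).
  by apply: polyfam_mult; [exact: (polyfam_coef (fun t => Cconj (m1 t)))|exact: polyfam_cis].
split => //.
apply: (inG_ext (fun th t => (cis th * cis th) * p th t + (- / (Ci * RtoC (r t)) * cis th) *
   (p th t * (RtoC (r t) * (Ci * cis th)) + q th t * Cconj (RtoC (r t) * (Ci * cis th))))%C).
  move=> th t H1 H2; rewrite conj1; have r0 := r_pos t H2.
  have rc : RtoC (r t) <> 0%C by move/RtoC_inj; lra.
  have e0 := cis_neq0 th.
  by field; do ! split.
apply: inG_plus; first by apply: inG_mult_poly Hp; apply: polyfam_mult; exact: polyfam_cis.
apply: inG_mult_poly Gth; apply: polyfam_mult; last exact: polyfam_cis.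
exact: (polyfam_coef (fun t => - / (Ci * RtoC (r t)))%C).
Qed.

Definition circle_pt (th t : R) : C := (m t + RtoC (r t) * cis th)%C.

Lemma rcd_circle_pt_t th t : t1 < t < t2 -> rcd (circle_pt th) t (m1 t + RtoC (r1 t) * cis th)%C.
Proof.
move=> Ht; apply: rcd_plus; first exact: Hm.
apply: rcd_eq; first by apply: rcd_mult; [apply: rcd_real; exact: Hr|exact: rcd_const].
by cring.
Qed.

Lemma rcd_circle_pt_th th t : rcd (fun s => circle_pt s t) th (RtoC (r t) * (Ci * cis th))%C.
Proof.
apply: rcd_eq; first by apply: rcd_plus; [exact: rcd_const|apply: rcd_scal; exact: rcd_cis].
by cring.
Qed.

Variable U : C -> Prop.
Variables (F : R -> R -> R) (Fz a b : C -> C) (L : C -> R).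
Hypothesis PF : dF_rule U F Fz.
Hypothesis PFz : dFz_rule U Fz a b L.
Hypothesis Ha : hol1 U a.
Hypothesis Hb : hol1 U b.
Hypothesis HU : forall th t, th1 < th < th2 -> t1 < t < t2 -> U (circle_pt th t).
Hypothesis HL : forall t, t1 < t < t2 -> exists al be ga : R, forall th, th1 < th < th2 ->
  F (Re (circle_pt th t)) (Im (circle_pt th t)) = al * Re (circle_pt th t) + be * Im (circle_pt th t) + ga.

Lemma Re2_conj z : RtoC (2 * Re z) = (z + Cconj z)%C.
Proof. by apply: C_eq; rewrite /Re /Im /=; ring. Qed.

(** A linear function on a circle is a trigonometric polynomial of degree one, so multiplication by
    [cis th] makes it a quadratic polynomial in [cis th]. *)
Lemma inG_F : inG (fun th t => RtoC (F (Re (circle_pt th t)) (Im (circle_pt th t)))).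
Proof.
have H : polyfam (fun th t => cis th * RtoC (F (Re (circle_pt th t)) (Im (circle_pt th t))))%C.
  exists (2 + (1 + (2 + 4)))%N => t Ht; have [al [be [ga E]]] := HL t Ht.
  (* With this w, al Re u + be Im u = Re (w u) = (w u + conj w conj u) / 2. *)
  pose w : C := (al, - be).
  exists ('X * ((toRC (RtoC (al * Re (m t) + be * Im (m t) + ga)))%:P) +
    (((toRC (RtoC (r t / 2) * Cconj w)%C)%:P + (toRC (RtoC (r t / 2) * w)%C)%:P * ('X * 'X))))%Ri; split.
    apply: leq_trans (size_polyD_le _ _ (2 + 1) (1 + (1 + (2 + 2))) _ _) _ => //.
      by apply: size_polyM_le; rewrite ?size_polyX // size_polyC; case: (_ != _).
    apply: size_polyD_le; first by rewrite size_polyC; case: (_ != _).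
    apply: size_polyM_le; first by rewrite size_polyC; case: (_ != _).
    by apply: size_polyM_le; rewrite size_polyX.
  move=> th Hh; rewrite E // !(pevalD, pevalM, pevalX, pevalC).
  have sc : sin th * sin th = 1 - cos th * cos th by have := sin2_cos2 th; rewrite /Rsqr; lra.
  have Er : r t = 2 * (r t / 2) by field.
  rewrite /w /circle_pt /cis; move: (r t / 2) Er => h Er; rewrite Er.
  by apply: C_eq; rewrite /Re /Im /=; ring [sc].
(* S contains the factor [cis th] needed to clear the negative power; its other factor is a harmless
   polynomial. *)
exists 1%N.
apply: (polyfam_ext (fun th t => (m1 t + (RtoC (2 * r1 t) * cis th + Cconj (m1 t) * (cis th * cis th))) * (cis th * RtoC (F (Re (circle_pt th t)) (Im (circle_pt th t)))))%C).
  by move=> th t _ _; rewrite /S /=; cring.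
apply: polyfam_mult H.
apply: polyfam_plus; first exact: polyfam_coef.
apply: polyfam_plus; first by apply: polyfam_mult; [exact: (polyfam_coef (fun t => RtoC (2 * r1 t)))|exact: polyfam_cis].
by apply: polyfam_mult; [exact: (polyfam_coef (fun t => Cconj (m1 t)))|apply: polyfam_mult; exact: polyfam_cis].
Qed.

(** Three rounds of [inG_wirtinger]: F gives F_z, then F_z gives F_zz = conj z * a + b, and the
    derivative of the latter in the conjugate variable is a. *)
Lemma inG_second_third :
  inG (fun th t => Cconj (circle_pt th t) * a (circle_pt th t) + b (circle_pt th t))%C /\
  inG (fun th t => a (circle_pt th t)).
Proof.
have [I1 _] : inG (fun th t => Fz (circle_pt th t)) /\ inG (fun th t => Cconj (Fz (circle_pt th t))).
  apply: (inG_wirtinger _ _ _ inG_F) => th t H1 H2.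
    apply: rcd_eq; first by apply: rcd_real; apply: (PF (fun s => circle_pt s t) th); [exact: HU|exact: rcd_circle_pt_th].
    by rewrite Re2_conj Cmult_conj.
  apply: rcd_eq; first by apply: rcd_real; apply: (PF (circle_pt th) t); [exact: HU|exact: rcd_circle_pt_t].
  by rewrite Re2_conj Cmult_conj.
have [I2 _] : inG (fun th t => Cconj (circle_pt th t) * a (circle_pt th t) + b (circle_pt th t))%C /\ inG (fun th t => RtoC (L (circle_pt th t))).
  apply: (inG_wirtinger _ _ _ I1) => th t H1 H2.
    by apply: (PFz (fun s => circle_pt s t) th); [exact: HU|exact: rcd_circle_pt_th].
  by apply: (PFz (circle_pt th) t); [exact: HU|exact: rcd_circle_pt_t].
split => //.
have dF : forall g t d, U (g t) -> rcd g t d -> rcd (fun s => Cconj (g s) * a (g s) + b (g s))%C t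
    ((Cconj (g t) * Cd a (g t) + Cd b (g t)) * d + a (g t) * Cconj d)%C.
  move=> g t d Hg Hd; have [Da _] := Ha _ Hg; have [Db _] := Hb _ Hg.
  apply: rcd_eq.
    apply: rcd_plus; last exact: (rcd_comp b g t _ _ Db Hd).
    apply: rcd_mult; first exact: rcd_conj Hd.
    exact: (rcd_comp a g t _ _ Da Hd).
  by cring.
have [_ I3] : inG (fun th t => Cconj (circle_pt th t) * Cd a (circle_pt th t) + Cd b (circle_pt th t))%C /\ inG (fun th t => a (circle_pt th t)).
  apply: (inG_wirtinger _ _ _ I2) => th t H1 H2.
    by apply: (dF (fun s => circle_pt s t) th); [exact: HU|exact: rcd_circle_pt_th].
  by apply: (dF (circle_pt th) t); [exact: HU|exact: rcd_circle_pt_t].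
exact: I3.
Qed.
End Family.

(** * Rationality of the second derivatives *)

Lemma peval_hol1 U P : openU U -> hol1 U (peval P).
Proof.
move=> HU; apply: (hol1_intro U HU _ (peval (P^`())%Ri)) => z _; first exact: cdiff_peval.
exact: (cdiff_ccont _ _ _ (cdiff_peval _ z)).
Qed.

Lemma hol1_opp U h : openU U -> hol1 U h -> hol1 U (fun z => - h z)%C.
Proof.
move=> HU H; apply: (hol1_intro U HU _ (fun z => RtoC (-1) * Cd h z)%C) => z Hz; have [D K] := H z Hz.
  have := cdiff_mult _ _ _ _ _ (cdiff_const (RtoC (-1)) z) D; case=> [H1 H2].
  have E : forall u, (RtoC (-1) * h u = - h u)%C by move=> u; cring.
  apply: (cdiff_eq _ _ (0 * h z + RtoC (-1) * Cd h z)%C); last by cring.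
  by split; [apply: diff2_ext H1|apply: diff2_ext H2] => u v; rewrite E.
by apply: ccont_mult => //; exact: ccont_const.
Qed.

(** The point om may belong to U; there the value follows by continuity from a nearby point. *)
Lemma hol1_cancel U h om : openU U -> hol1 U h ->
  (forall z, U z -> (z - om) * h z = 0)%C -> forall z, U z -> h z = 0%C.
Proof.
move=> HU H Z z Hz; have [E|E] := classic (z = om); last first.
  case: (Cmult_integral _ _ (Z z Hz)) => // /Csub_eq0 K; by [].
apply: NNPP => N.
have [D _] := H z Hz.
have [r [Hr Hd]] := ccont_disc _ _ (cdiff_ccont _ _ _ D) _ (proj1 (Cmod_gt_0 _) N).
have [s [Hs Hu]] := open_disc U z HU Hz.
pose e := Rmin r s / 2.
have m0 : 0 < Rmin r s by apply: Rmin_pos.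
have e0 : 0 < e by rewrite /e; lra.
have e1 : e < r by rewrite /e; have := Rmin_l r s; lra.
have e2 : e < s by rewrite /e; have := Rmin_r r s; lra.
have Ee : (z + RtoC e - z = RtoC e)%C by cring.
have Ne : Cmod (z + RtoC e - z) = e by rewrite Ee Cmod_R Rabs_pos_eq; lra.
have K1 := Hd (z + RtoC e)%C ltac:(rewrite /disc Ne; lra).
have K2 := Z (z + RtoC e)%C (Hu (z + RtoC e)%C ltac:(rewrite /disc Ne; lra)).
case: (Cmult_integral _ _ K2) => [X|X].
  by move: X; rewrite -E Ee => /RtoC_inj; lra.
by move: K1; rewrite X (_ : (0 - h z = - h z)%C); [rewrite Cmod_opp; lra|cring].
Qed.

Lemma root_factor (P : {poly RC}) om : peval P om = 0%C -> exists Q, P = (Q * ('X - (toRC om)%:P))%Ri.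
Proof. by move/peval_eq0/factor_theorem. Qed.

Lemma peval_XsubC om z : peval ('X - (toRC om)%:P)%Ri z = (z - om)%C.
Proof. by rewrite pevalD pevalN pevalX pevalC. Qed.

(** Common roots of the denominator and both numerators are divided out one at a time, which lowers
    the size of q. A single denominator is kept for a and b so that its roots can be treated
    once. *)
Lemma reduce_fraction U (a b : C -> C) : openU U -> hol1 U a -> hol1 U b -> forall n (q p1 p2 : {poly RC}),
  (size q <= n)%N -> q != 0%Ri ->
  (forall z, U z -> (peval q z * a z = peval p1 z)%C /\ (peval q z * b z = peval p2 z)%C) ->
  exists q p1 p2 : {poly RC}, q != 0%Ri /\
  (forall z, U z -> (peval q z * a z = peval p1 z)%C /\ (peval q z * b z = peval p2 z)%C) /\
  (forall om, peval q om = 0%C -> peval p1 om = 0%C -> peval p2 om = 0%C -> False).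
Proof.
move=> HU Ha Hb; elim=> [|n IH] q p1 p2 Hs Hq H.
  by move: Hs; rewrite leqn0 size_poly_eq0 (negbTE Hq).
have [[om [Z0 [Z1 Z2]]]|N] := classic (exists om, peval q om = 0%C /\ peval p1 om = 0%C /\ peval p2 om = 0%C); last first.
  exists q, p1, p2; split => //; split => // om K0 K1 K2.
  by apply: N; exists om.
have [q' Eq] := root_factor _ _ Z0; have [p1' E1] := root_factor _ _ Z1; have [p2' E2] := root_factor _ _ Z2.
have q'0 : q' != 0%Ri by apply: contraNneq Hq => K; rewrite Eq K mul0r.
apply: (IH q' p1' p2') => //.
  by move: Hs; rewrite Eq size_Mmonic ?monicXsubC // size_XsubC addn2 /= ltnS.
have key : forall (h : C -> C) (P : {poly RC}), hol1 U h -> (forall z, U z -> (peval q z * h z = peval (P * ('X - (toRC om)%:P))%Ri z)%C) ->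
   forall z, U z -> (peval q' z * h z = peval P z)%C.
  move=> h P Hh K z Hz; apply: Csub_eq0.
  apply: (hol1_cancel U (fun z => peval q' z * h z - peval P z)%C om HU _ _ z Hz).
    by apply: hol1_plus => //; [apply: hol1_mult => //; exact: peval_hol1|apply: hol1_opp => //; exact: peval_hol1].
  move=> u Hu; have := K u Hu; rewrite Eq !pevalM peval_XsubC => E.
  rewrite (_ : ((u - om) * (peval q' u * h u - peval P u) = peval q' u * (u - om) * h u - peval P u * (u - om))%C); last by cring.
  by rewrite E; cring.
move=> z Hz; split; apply: key => // u Hu; [rewrite -E1|rewrite -E2]; by case: (H u Hu).
Qed.

Section Rational.
Variables (th1 th2 t1 t2 : R) (m m1 m2 : R -> C) (r r1 r2 : R -> R).
Hypothesis Hth : th1 < th2.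
Hypothesis Hpi : th2 - th1 < PI.
Hypothesis r_pos : forall t, t1 < t < t2 -> 0 < r t.
Variable U : C -> Prop.
Hypothesis HU : openU U.
Hypothesis conn : connU U.
Variables (a b : C -> C).
Hypothesis Ha : hol1 U a.
Hypothesis Hb : hol1 U b.
Let pt := circle_pt m r.
Hypothesis HUpt : forall th t, th1 < th < th2 -> t1 < t < t2 -> U (pt th t).
Hypothesis G2 : inG th1 th2 t1 t2 m1 r1 (fun th t => Cconj (pt th t) * a (pt th t) + b (pt th t))%C.
Hypothesis G3 : inG th1 th2 t1 t2 m1 r1 (fun th t => a (pt th t)).

(** S at time t as a polynomial in [cis th]; composed with [Aff], which recovers [cis th] from the
    point of the circle, it becomes a polynomial in z. *)
Let Sp (t : R) : {poly RC} := ('X * ((toRC (m1 t))%:P + ((toRC (RtoC (2 * r1 t)))%:P * 'X + (toRC (Cconj (m1 t)))%:P * ('X * 'X))))%Ri.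
Let Aff (t : R) : {poly RC} := ((toRC (/ RtoC (r t))%C)%:P * ('X - (toRC (m t))%:P))%Ri.

Local Lemma Aff_pt th t : t1 < t < t2 -> peval (Aff t) (pt th t) = cis th.
Proof.
move=> Ht; have r0 := r_pos t Ht; rewrite pevalM pevalC peval_XsubC /pt /circle_pt.
by field; move/RtoC_inj; lra.
Qed.

Local Lemma inG_poly G : inG th1 th2 t1 t2 m1 r1 G -> exists n, forall t, t1 < t < t2 -> exists P : {poly RC},
  forall th, th1 < th < th2 -> (peval ((Sp t ^+ n) \Po Aff t)%Ri (pt th t) * G th t = peval P (pt th t))%C.
Proof.
move=> [n [d H]]; exists n => t Ht; have [P [_ HP]] := H t Ht.
exists (P \Po Aff t)%Ri => th Hh; rewrite !peval_comp Aff_pt // -HP //.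
by rewrite pevalXn !(pevalM, pevalD, pevalX, pevalC).
Qed.

Local Lemma pt_poly0 P t : t1 < t < t2 -> (forall th, th1 < th < th2 -> peval P (pt th t) = 0%C) -> P = 0%Ri.
Proof.
move=> Ht H; apply: (poly_eq0_arc P (m t) (r t) th1 th2 Hth Hpi) => //.
by have := r_pos t Ht; lra.
Qed.

Local Lemma pt_identity h t : t1 < t < t2 -> hol1 U h -> (forall th, th1 < th < th2 -> h (pt th t) = 0%C) ->
  forall z, U z -> h z = 0%C.
Proof.
move=> Ht Hh H; have r0 := r_pos t Ht.
apply: (identity_arc U HU h (fun th => pt th t) (fun th => RtoC (r t) * (Ci * cis th))%C th1 th2) => // th Hth'.
split; first exact: HUpt.
split; first exact: rcd_circle_pt_th.
split; last exact: H.
have Ci0 := Ci_neq0.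
by case/Cmult_integral => [/RtoC_inj|/Cmult_integral [|/cis_neq0]] //; lra.
Qed.

Local Lemma Sp_neq0 t : (m1 t <> 0%C \/ r1 t <> 0) -> Sp t != 0%Ri.
Proof.
move=> H; apply/negP => /eqP E.
have E' : ((toRC (m1 t))%:P + ((toRC (RtoC (2 * r1 t)))%:P * 'X + (toRC (Cconj (m1 t)))%:P * ('X * 'X)) = 0)%Ri.
  by apply/eqP; move/eqP: E; rewrite /Sp mulf_eq0 polyX_eq0.
have c0 := f_equal (fun P : {poly RC} => P`_0)%Ri E'; have c1 := f_equal (fun P : {poly RC} => P`_1)%Ri E'.
move: c0 c1; rewrite !coefD !coefCM -expr2 !coefXn !coefX !coefC /= !mulr0 !mulr1 !addr0 ?add0r => c0 c1.
case: H => H; apply: H.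
  by apply: toRC_inj; rewrite c0.
have : RtoC (2 * r1 t) = RtoC 0 by apply: toRC_inj; rewrite c1.
by move/RtoC_inj; lra.
Qed.

Local Lemma comp_Aff_neq0 P t : t1 < t < t2 -> P != 0%Ri -> (P \Po Aff t)%Ri != 0%Ri.
Proof.
move=> Ht; apply: contraNneq => E; have r0 := r_pos t Ht.
apply/eqP; apply: (poly_eq0_arc P (RtoC 0) 1 th1 th2 Hth Hpi) => [|th Hh]; first by lra.
rewrite (_ : (0 + RtoC 1 * cis th)%C = cis th); last by cring.
by rewrite -(Aff_pt th t Ht) -peval_comp E peval0.
Qed.

(** One circle that really moves yields the fraction, because its S is not the zero polynomial. The
    other circles then constrain the roots of q: their own denominators must account for each of
    them. *)
Lemma rational_second : (exists t, t1 < t < t2 /\ (m1 t <> 0%C \/ r1 t <> 0)) ->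
  exists q p1 p2 : {poly RC}, q != 0%Ri /\
  (forall z, U z -> (peval q z * a z = peval p1 z)%C /\ (peval q z * b z = peval p2 z)%C) /\
  (forall om, peval q om = 0%C -> peval p1 om = 0%C -> peval p2 om = 0%C -> False) /\
  (forall om t, peval q om = 0%C -> t1 < t < t2 ->
    ((om - m t) * (m1 t * RtoC (r t * r t) + (RtoC (2 * (r t * r1 t)) * (om - m t) + Cconj (m1 t) * ((om - m t) * (om - m t)))) = 0)%C \/
    ((Cconj (m t) * (om - m t) + RtoC (r t * r t)) * peval p1 om + (om - m t) * peval p2 om = 0)%C).
Proof.
move=> [t0 [Ht0 nz]].
have [n HA] := inG_poly _ G3; have [k HF] := inG_poly _ G2.
(* The equation of the circle, used to eliminate the conjugate of z at the price of a factor z -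
   m. *)
have circ : forall th t, ((pt th t - m t) * Cconj (pt th t) = Cconj (m t) * (pt th t - m t) + RtoC (r t * r t))%C.
  move=> th t; rewrite /pt /circle_pt Cplus_conj Cmult_conj cis_conj RtoC_mult.
  have e0 := cis_neq0 th; rewrite (_ : Cconj (RtoC (r t)) = RtoC (r t)); last by apply: C_eq; rewrite /Re /Im /=; ring.
  by field.
have [q [p1 [p2 [q0 [Hq Hred]]]]] : exists q p1 p2 : {poly RC}, q != 0%Ri /\
  (forall z, U z -> (peval q z * a z = peval p1 z)%C /\ (peval q z * b z = peval p2 z)%C) /\
  (forall om, peval q om = 0%C -> peval p1 om = 0%C -> peval p2 om = 0%C -> False).
  have [PA HPA] := HA t0 Ht0; have [PF HPF] := HF t0 Ht0.
  pose D1 := ((Sp t0 ^+ n) \Po Aff t0)%Ri; pose D2 := ((Sp t0 ^+ k) \Po Aff t0)%Ri.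
  pose mm : {poly RC} := ('X - (toRC (m t0))%:P)%Ri.
  have D10 : D1 != 0%Ri by apply: comp_Aff_neq0 => //; apply: expf_neq0; exact: Sp_neq0.
  have D20 : D2 != 0%Ri by apply: comp_Aff_neq0 => //; apply: expf_neq0; exact: Sp_neq0.
  have mm0 : mm != 0%Ri by rewrite polyXsubC_eq0.
  have Ea : forall z, U z -> (peval D1 z * a z - peval PA z = 0)%C.
    apply: (pt_identity (fun z => peval D1 z * a z - peval PA z)%C t0 Ht0).
      by apply: hol1_plus => //; [apply: hol1_mult => //; exact: peval_hol1|apply: hol1_opp => //; exact: peval_hol1].
    by move=> th Hh; rewrite HPA //; cring.
  pose cc : {poly RC} := ((toRC (Cconj (m t0)))%:P * mm + (toRC (RtoC (r t0 * r t0)))%:P)%Ri.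
  have Emm : forall z, peval mm z = (z - m t0)%C by move=> z; exact: peval_XsubC.
  have Ecc : forall z, peval cc z = (Cconj (m t0) * (z - m t0) + RtoC (r t0 * r t0))%C.
    by move=> z; rewrite /cc pevalD (pevalM _ mm) Emm !pevalC.
  (* This is the formula for F_zz on the arc, multiplied by z - m. Being free of conjugates, it
     extends to U by the identity theorem. *)
  have Eb : forall z, U z -> (peval (D2 * mm)%Ri z * b z + (peval (D2 * cc)%Ri z * a z - peval (PF * mm)%Ri z) = 0)%C.
    apply: (pt_identity (fun z => peval (D2 * mm)%Ri z * b z + (peval (D2 * cc)%Ri z * a z - peval (PF * mm)%Ri z))%C t0 Ht0).
      apply: hol1_plus => //; first by apply: hol1_mult => //; exact: peval_hol1.
      by apply: hol1_plus => //; [apply: hol1_mult => //; exact: peval_hol1|apply: hol1_opp => //; exact: peval_hol1].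
    by move=> th Hh; rewrite (pevalM PF) (pevalM D2 mm) (pevalM D2 cc) -HPF // -/D2 Ecc Emm -circ; cring.
  apply: (reduce_fraction U a b HU Ha Hb _ (D1 * (D2 * mm))%Ri (D2 * mm * PA)%Ri (D1 * (PF * mm) - (D2 * cc) * PA)%Ri (leqnn _)).
    by rewrite !mulf_neq0.
  move=> z Hz; have Ea' := Csub_eq0 _ _ (Ea z Hz); have Eb' := Eb z Hz.
  split; first by rewrite !pevalM -Ea'; cring.
  rewrite pevalD pevalN (pevalM D1 (D2 * mm)%Ri) (pevalM D1 (PF * mm)%Ri) (pevalM _ PA) -Ea'.
  apply: Csub_eq0; rewrite -[RHS](Cmult_0_r (peval D1 z)) -Eb'; cring.
exists q, p1, p2; split => //; split => //; split => //.
move=> om t Z Ht; have r0 := r_pos t Ht.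
have rc : RtoC (r t) <> 0%C by move/RtoC_inj; lra.
have [P HP] := HF t Ht.
pose mm : {poly RC} := ('X - (toRC (m t))%:P)%Ri.
pose M := (((toRC (Cconj (m t)))%:P * mm + (toRC (RtoC (r t * r t)))%:P) * p1 + mm * p2)%Ri.
have Emm : forall z, peval mm z = (z - m t)%C by move=> z; exact: peval_XsubC.
have EM : forall z, peval M z = ((Cconj (m t) * (z - m t) + RtoC (r t * r t)) * peval p1 z + (z - m t) * peval p2 z)%C.
  by move=> z; rewrite /M pevalD (pevalM _ p1) (pevalM _ p2) pevalD (pevalM _ mm) Emm !pevalC.
(* An equality of polynomials for this t. At a root om of q the right hand product vanishes, so
   either S or M vanishes at om; these are the two alternatives. *)
have E : (((Sp t ^+ k) \Po Aff t) * M - q * (mm * P) = 0)%Ri.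
  apply: (pt_poly0 _ t Ht) => th Hh.
  have [H1 H2] := Hq _ (HUpt th t Hh Ht).
  rewrite pevalD pevalN (pevalM q) (pevalM mm) -HP // (pevalM _ M) EM Emm -H1 -H2.
  by rewrite -circ; cring.
have := f_equal (fun P => peval P om) E; rewrite pevalD pevalN (pevalM q) Z peval0 (pevalM _ M) => E'.
have {}E' : (peval ((Sp t ^+ k) \Po Aff t)%Ri om * peval M om = 0)%C by rewrite -[RHS]E'; cring.
case: (Cmult_integral _ _ E') => [K|K]; [left|right].
  move: K; rewrite peval_comp pevalXn => K.
  have {}K : peval (Sp t) (peval (Aff t) om) = 0%C.
    elim: k K {HF HP E E'} => [|k IH] /=; last by case/Cmult_integral.
    by move/RtoC_inj; lra.
  move: K; rewrite !(pevalM, pevalD, pevalN, pevalX, pevalC) => K.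
  rewrite -[RHS](Cmult_0_r (RtoC (r t) * RtoC (r t) * RtoC (r t))%C) -K !RtoC_mult; by field.
by rewrite -EM.
Qed.
End Rational.

(** * Laurent polynomials real on a circle *)

Lemma size_oneX (K : fieldType) : size (1 + 'X : {poly K})%Ri = 2%N.
Proof. by rewrite addrC -polyC1 size_XaddC. Qed.

Lemma oneX_neq0 (K : fieldType) : (1 + 'X : {poly K})%Ri != 0%Ri.
Proof. by rewrite -size_poly_eq0 size_oneX. Qed.

(** Both sums are divisible by (1 + X)^j0. After cancelling it, evaluation at -1 leaves only the
    terms j = j0. *)
Lemma low_coef (K : fieldType) (N j0 e1 e2 : nat) (al be : nat -> K) (a c : K) :
  (j0 <= N)%N -> (forall j, (j < j0)%N -> al j = 0%Ri /\ be j = 0%Ri) ->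
  (a%:P * 'X^e1 * (\sum_(j < N.+1) (al j)%:P * (1 + 'X) ^+ j) =
   c%:P * 'X^e2 * (\sum_(j < N.+1) (be j)%:P * ((1 + 'X) ^+ j * 'X^(N - j))))%Ri ->
  (a * (-1) ^+ e1 * al j0 = c * (-1) ^+ e2 * (be j0 * (-1) ^+ (N - j0)))%Ri.
Proof.
move=> jN Z E.
have fac : forall (g : nat -> K) (h : nat -> {poly K}), (forall j, (j < j0)%N -> g j = 0%Ri) ->
  (\sum_(j < N.+1) (g j)%:P * ((1 + 'X) ^+ j * h j) = (1 + 'X) ^+ j0 * \sum_(j < N.+1) (g j)%:P * ((1 + 'X) ^+ (j - j0) * h j))%Ri.
  move=> g h Zg; rewrite mulr_sumr; apply: eq_bigr => j _.
  have [L|L] := ltnP j j0; first by rewrite Zg // polyC0 !mul0r mulr0.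
  have -> : ((1 + 'X) ^+ j = (1 + 'X) ^+ j0 * (1 + 'X) ^+ (j - j0) :> {poly K})%Ri by rewrite -exprD subnKC.
  by rewrite -mulrA mulrCA.
have ev : forall (g : nat -> K) (h : nat -> {poly K}), (forall j, (j < j0)%N -> g j = 0%Ri) ->
  ((\sum_(j < N.+1) (g j)%:P * ((1 + 'X) ^+ (j - j0) * h j)).[-1] = g j0 * (h j0).[-1])%Ri.
  move=> g h Zg; have jN' : (j0 < N.+1)%N by [].
  rewrite horner_sum (bigD1 (Ordinal jN')) //= big1 ?addr0.
    by rewrite hornerM hornerC subnn expr0 mul1r.
  move=> j Hj; have [L|L] := ltnP j j0; first by rewrite Zg // hornerM hornerC mul0r.
  have L' : (0 < j - j0)%N.
    rewrite subn_gt0 ltn_neqAle L andbT; apply: contra_neq Hj => Ej; apply: val_inj; by rewrite /= Ej.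
  have E1 : ((1 + 'X : {poly K}).[-1] = 0)%Ri by rewrite hornerD hornerX -polyC1 hornerC subrr.
  by rewrite !hornerM horner_exp E1 expr0n eqn0Ngt L' /= mul0r mulr0.
have nz : ((1 + 'X) ^+ j0 : {poly K})%Ri != 0%Ri by rewrite expf_neq0 // oneX_neq0.
have E1 := fac al (fun _ => 1%Ri) (fun j Hj => proj1 (Z j Hj)).
have E2 := fac be (fun j => 'X^(N - j))%Ri (fun j Hj => proj2 (Z j Hj)).
have E1' : (\sum_(j < N.+1) (al j)%:P * (1 + 'X) ^+ j = \sum_(j < N.+1) (al j)%:P * ((1 + 'X) ^+ j * 1))%Ri.
  by apply: eq_bigr => j _; rewrite mulr1.
move: E; rewrite E1' E1 E2 !(mulrCA _ ((1 + 'X) ^+ j0)%Ri) => /(mulfI nz) E.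
have := f_equal (fun P : {poly K} => P.[-1])%Ri E.
rewrite !(hornerM (_ * _)%Ri) (ev al (fun _ => 1%Ri) (fun j Hj => proj1 (Z j Hj))) (ev be (fun j => 'X^(N - j))%Ri (fun j Hj => proj2 (Z j Hj))).
by rewrite !(hornerM, hornerC, horner_exp, hornerX) mulr1.
Qed.

Lemma peval_csum (P : {poly RC}) d z : (size P <= d)%N -> peval P z = csum (fun j => ofRC (P`_j)%Ri * z ^ j)%C d.
Proof.
move=> Hs; rewrite /peval (horner_coef_wide _ Hs) (ofRC_sum d (fun j => P`_j * toRC z ^+ j)%Ri).
apply: csum_ext => j; rewrite ofRCM; congr (_ * _)%C.
by elim: j => [|j IH]; [rewrite expr0|rewrite exprS ofRCM IH toRCK].
Qed.

Lemma peval_sum_csum (c : nat -> C) (G : nat -> {poly RC}) d z :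
  peval (\sum_(j < d) (toRC (c j))%:P * G j)%Ri z = csum (fun j => c j * peval (G j) z)%C d.
Proof.
rewrite /peval horner_sum (eq_bigr (fun j : 'I_d => (toRC (c j)) * (G j).[toRC z])%Ri); last by move=> j _; rewrite hornerM hornerC.
by rewrite (ofRC_sum d (fun j => toRC (c j) * (G j).[toRC z])%Ri); apply: csum_ext => j; rewrite ofRCM toRCK.
Qed.

Lemma csum_conj f n : Cconj (csum f n) = csum (fun j => Cconj (f j)) n.
Proof. by elim: n => [|n IH] /=; [apply: C_eq; rewrite /Re /Im /=; ring|rewrite Cplus_conj IH]. Qed.

Lemma csum_scal c f n : (c * csum f n)%C = csum (fun j => c * f j)%C n.
Proof. by elim: n => [|n IH] /=; [cring|rewrite -IH; cring]. Qed.

Lemma csum_ext_lt f g n : (forall j, (j < n)%N -> f j = g j) -> csum f n = csum g n.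
Proof.
elim: n => [|n IH] H //=; rewrite (H n) // IH // => j Hj; apply: H; exact: ltn_trans Hj _.
Qed.

Lemma Cpow_conj (z : C) n : Cconj (z ^ n)%C = (Cconj z ^ n)%C.
Proof. by elim: n => [|n IH] /=; [apply: C_eq; rewrite /Re /Im /=; ring|rewrite Cmult_conj IH]. Qed.

Lemma Cpow_neq0 (z : C) n : z <> 0%C -> (z ^ n)%C <> 0%C.
Proof. by move=> z0; elim: n => [|n IH] /=; [move/RtoC_inj; lra|case/Cmult_integral]. Qed.

Lemma Cinv_neq0 (z : C) : z <> 0%C -> (/ z)%C <> 0%C.
Proof.
move=> z0 E; have : (z * / z)%C = RtoC 1 by field.
by rewrite E Cmult_0_r => /RtoC_inj; lra.
Qed.

Lemma Cpow_inv (z : C) n : z <> 0%C -> ((/ z) ^ n = / (z ^ n))%C.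
Proof.
move=> z0; elim: n => [|n IH] /=; first by field.
by rewrite IH; field; split => //; exact: Cpow_neq0.
Qed.

Lemma Im0_conj (z : C) : Im z = 0 -> Cconj z = z.
Proof. by case: z => x y /= H; apply: C_eq => /=; lra. Qed.

Lemma Cpow_sub (z : C) j N : z <> 0%C -> (j <= N)%N -> ((/ z) ^ j * z ^ N = z ^ (N - j)%N)%C.
Proof.
move=> z0 L; rewrite -{1}(subnKC L) Cpow_add Cpow_inv //; field; exact: Cpow_neq0.
Qed.

(** On the unit circle X^2 k has only exponents at least 2, and its conjugate only exponents at most
    -2. Multiplied by X^(d+2), the equality of the two contradicts the sizes unless k = 0. *)
Lemma real_on_arc_square (k : {poly RC}) th1 th2 : th1 < th2 -> th2 - th1 < PI ->
  (forall th, th1 < th < th2 -> Im (cis th * cis th * peval k (cis th))%C = 0) -> k = 0%Ri.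
Proof.
move=> H L Z; pose d := size k.
pose Rv : {poly RC} := (\sum_(j < d) (toRC (Cconj (ofRC k`_j)))%:P * 'X^(d - j))%Ri.
have E : ('X^(d + 4) * k - Rv = 0)%Ri.
  apply: (poly_eq0_arc _ (RtoC 0) 1 th1 th2 H L) => [|th Hh]; first by lra.
  rewrite (_ : (0 + RtoC 1 * cis th)%C = cis th); last by cring.
  rewrite pevalD pevalN pevalM /Rv (peval_sum_csum (fun j => Cconj (ofRC (k`_j)%Ri)) (fun j => 'X^(d - j))%Ri) pevalXn pevalX.
  have e0 := cis_neq0 th.
  have K := Im0_conj _ (Z th Hh); rewrite !Cmult_conj cis_conj (peval_csum k d) // csum_conj in K.
  rewrite Cpow_add (_ : (cis th ^ d * cis th ^ 4 * peval k (cis th))%C =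
    (cis th ^ d * (cis th * cis th) * (cis th * cis th * peval k (cis th)))%C); last by rewrite /=; cring.
  rewrite (peval_csum k d) // -K.
  rewrite (_ : (cis th ^ d * (cis th * cis th) * (/ cis th * / cis th * csum (fun j => Cconj (ofRC (k`_j)%Ri * cis th ^ j)) d))%C =
     (cis th ^ d * csum (fun j => Cconj (ofRC (k`_j)%Ri * cis th ^ j)) d)%C); last by field.
  rewrite csum_scal (csum_ext_lt _ (fun j => Cconj (ofRC (k`_j)%Ri) * peval 'X^(d - j)%Ri (cis th))%C); first by cring.
  move=> j Hj; rewrite pevalXn pevalX Cmult_conj Cpow_conj cis_conj -(Cpow_sub (cis th) j d) //; last exact: ltnW.
  by cring.
apply/eqP; apply: contraT => k0.
have S1 : size ('X^(d + 4) * k)%Ri = (d + 4 + d)%N.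
  by rewrite mulrC size_mulXn.
have S2 : (size Rv <= d.+1)%N.
  apply: (leq_trans (size_sum _ _ _)); apply/bigmax_leqP => j _.
  apply: (leq_trans (size_polyMleq _ _)); rewrite size_polyXn size_polyC.
  by case: (_ != _) => /=; lia.
by move: S2; rewrite -(subr0_eq E) S1; lia.
Qed.

Section LaurentReality.
Variables (th1 th2 : R) (m : C) (r : R) (n N : nat) (B : {poly RC}).
Hypothesis Hth : th1 < th2.
Hypothesis Hpi : th2 - th1 < PI.
Hypothesis r0 : 0 < r.
Hypothesis Hmr : (m * Cconj m = RtoC (r * r))%C.
Hypothesis HN : (size B <= N.+1)%N.
Hypothesis HB : forall th, th1 < th < th2 -> exists K, Im K = 0 /\
  ((m + RtoC r * cis th) ^ n.+1 * K = (RtoC r * cis th) ^ 2 * peval B (m + RtoC r * cis th))%C.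

Local Lemma m_neq0 : m <> 0%C.
Proof. by move=> E; move: Hmr; rewrite E Cmult_0_l => /RtoC_inj; nra. Qed.

Local Lemma mc_neq0 : Cconj m <> 0%C.
Proof. by move=> E; move: Hmr; rewrite E Cmult_0_r => /RtoC_inj; nra. Qed.

(** The circle passes through 0, since |m| = r. Writing z = m (1 + eta) with |eta| = 1 puts 0 at eta
    = -1 and gives conj z = conj m (1 + eta) / eta; [al] and [be] are the coefficients of B and of
    its conjugate in powers of 1 + eta. *)
Let al (j : nat) : RC := toRC (ofRC (B`_j)%Ri * m ^ j)%C.
Let be (j : nat) : RC := toRC (Cconj (ofRC (B`_j)%Ri) * Cconj m ^ j)%C.
Let ca : RC := toRC (Cconj m ^ n.+1 * m ^ 2)%C.
Let cb : RC := toRC (m ^ n.+1 * Cconj m ^ 2)%C.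

(** Eliminating the real number K between the hypothesis and its conjugate leaves an identity in
    eta. The exponent 4 comes from u^2 against the square of its conjugate, N from clearing the
    conjugate of B. *)
Local Lemma laurent_identity :
  (ca%:P * 'X^(N + 4) * (\sum_(j < N.+1) (al j)%:P * (1 + 'X) ^+ j) =
   cb%:P * 'X^(n.+1) * (\sum_(j < N.+1) (be j)%:P * ((1 + 'X) ^+ j * 'X^(N - j))))%Ri.
Proof.
have m0 := m_neq0; have mc0 := mc_neq0.
have nz : ((1 + 'X) ^+ n.+1 : {poly RC})%Ri != 0%Ri by rewrite expf_neq0 // oneX_neq0.
(* The common factor (1 + eta)^(n+1) is restored, so that evaluation needs no division by a power of
   z, which may vanish on the arc. *)
apply: (mulfI nz); apply: subr0_eq.
have rc : RtoC r <> 0%C by move/RtoC_inj; lra.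
pose eta th := (RtoC r / m * cis th)%C.
apply: (poly_eq0_inf _ (fun i => eta (arc_node th1 th2 i))).
  move=> i j E; apply: (arc_cis_inj th1 th2 Hth Hpi).
  have F : forall u : C, (u = RtoC r / m * u / (RtoC r / m))%C by move=> u; field.
  by rewrite (F (cis _)) -/(eta _) E /eta -F.
move=> i; have Hh := arc_node_in th1 th2 i Hth; move: (arc_node th1 th2 i) Hh => th Hh.
have [K [K0 EK]] := HB th Hh; have Kc := Im0_conj _ K0.
have e0 := cis_neq0 th.
have h0 : eta th <> 0%C by rewrite /eta /Cdiv; case/Cmult_integral => [/Cmult_integral [|] //|//]; exact: Cinv_neq0.
have Ez : (m + RtoC r * cis th = m * (1 + eta th))%C by rewrite /eta; field.
have Eu : (RtoC r * cis th = m * eta th)%C by rewrite /eta; field.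
have Erc : Cconj (RtoC r) = RtoC r by apply: C_eq; rewrite /Re /Im /=; ring.
have Euc : (Cconj (m * eta th) = Cconj m / eta th)%C.
  rewrite -Eu Cmult_conj Erc cis_conj /eta.
  rewrite (_ : (Cconj m / (RtoC r / m * cis th))%C = (m * Cconj m) / (RtoC r * cis th))%C; last by field.
  by rewrite Hmr RtoC_mult; field.
have Ehc : (Cconj (1 + eta th) = (1 + eta th) / eta th)%C.
  rewrite Cplus_conj (_ : Cconj (RtoC 1) = RtoC 1); last by apply: C_eq; rewrite /Re /Im /=; ring.
  rewrite (_ : Cconj (eta th) = / eta th)%C; first by field.
  by move: Euc; rewrite Cmult_conj => E; rewrite (_ : Cconj (eta th) = Cconj m * Cconj (eta th) / Cconj m)%C; [rewrite E; field|field].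
move: EK; rewrite Ez Eu => EK.
have EKc := f_equal Cconj EK; rewrite Cmult_conj Kc Cpow_conj Cmult_conj Ehc (Cmult_conj (_ ^ 2)%C) Cpow_conj Euc in EKc.
(* eliminate K between the identity and its conjugate *)
have main : ((Cconj m * ((1 + eta th) / eta th)) ^ n.+1 * ((m * eta th) ^ 2 * peval B (m * (1 + eta th))) =
   (m * (1 + eta th)) ^ n.+1 * ((Cconj m / eta th) ^ 2 * Cconj (peval B (m * (1 + eta th)))))%C.
  by rewrite -EK -EKc; cring.
have S1 : peval B (m * (1 + eta th))%C = csum (fun j => ofRC (al j) * (1 + eta th) ^ j)%C N.+1.
  rewrite (peval_csum B N.+1) //; apply: csum_ext => j; rewrite /al toRCK.
  by rewrite -Cmult_assoc; congr (_ * _)%C; elim: j => [|j IH] /=; [cring|rewrite IH; cring].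
have S2 : (eta th ^ N * Cconj (peval B (m * (1 + eta th))))%C = csum (fun j => ofRC (be j) * ((1 + eta th) ^ j * eta th ^ (N - j)%N))%C N.+1.
  rewrite (peval_csum B N.+1) // csum_conj csum_scal; apply: csum_ext_lt => j Hj; rewrite /be toRCK.
  rewrite Cmult_conj Cpow_conj Cmult_conj Ehc -(Cpow_sub (eta th) j N) //.
  have X : forall u v : C, ((u * v) ^ j = u ^ j * v ^ j)%C by move=> u v; elim: (j) => [|k IH] /=; [cring|rewrite IH; cring].
  by rewrite /Cdiv !X; cring.
rewrite pevalD pevalN !(pevalM ((1 + 'X) ^+ n.+1)%Ri) !(pevalM (_ * _)%Ri) !(pevalM _ 'X^_%Ri).
have PX : forall k, peval 'X^k%Ri (eta th) = (eta th ^ k)%C by move=> k; rewrite pevalXn pevalX.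
have P1 : forall k, peval ((1 + 'X) ^+ k)%Ri (eta th) = ((1 + eta th) ^ k)%C.
  by move=> k; rewrite pevalXn pevalD pevalX /peval hornerC.
have A1 : peval (\sum_(j < N.+1) (al j)%:P * (1 + 'X) ^+ j)%Ri (eta th) = peval B (m * (1 + eta th))%C.
  rewrite S1 (eq_bigr (fun j : 'I_N.+1 => (toRC (ofRC (al j)))%:P * (1 + 'X) ^+ j)%Ri); last by move=> j _; rewrite ofRCK.
  by rewrite (peval_sum_csum (fun j => ofRC (al j)) (fun j => (1 + 'X) ^+ j)%Ri); apply: csum_ext => j; rewrite P1.
have A2 : peval (\sum_(j < N.+1) (be j)%:P * ((1 + 'X) ^+ j * 'X^(N - j)))%Ri (eta th) = (eta th ^ N * Cconj (peval B (m * (1 + eta th))))%C.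
  rewrite S2 (eq_bigr (fun j : 'I_N.+1 => (toRC (ofRC (be j)))%:P * ((1 + 'X) ^+ j * 'X^(N - j)))%Ri); last by move=> j _; rewrite ofRCK.
  by rewrite (peval_sum_csum (fun j => ofRC (be j)) (fun j => (1 + 'X) ^+ j * 'X^(N - j))%Ri); apply: csum_ext => j; rewrite pevalM P1 PX.
rewrite A1 A2 P1 !PX !pevalC {A1 A2 P1 PX S1 S2 EK EKc}.
have X : forall (u v : C) k, ((u * v) ^ k = u ^ k * v ^ k)%C by move=> u v k; elim: k => [|k IH] /=; [cring|rewrite IH; cring].
have D : (((1 + eta th) / eta th) ^ n.+1 = (1 + eta th) ^ n.+1 / eta th ^ n.+1)%C by rewrite /Cdiv X Cpow_inv.
move: main; rewrite (X (Cconj m) ((1 + eta th) / eta th)%C) D (X m (1 + eta th)%C); have hk := Cpow_neq0 _ n.+1 h0.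
move: (peval B _) (Cconj (peval B _)) (eta th ^ n.+1)%C hk ((1 + eta th) ^ n.+1)%C (m ^ n.+1)%C (Cconj m ^ n.+1)%C => u uc hk hk0 w mk mck.
rewrite Cpow_add; move: (eta th ^ N)%C => hN main2.
have -> : (w * (mck * m ^ 2 * (hN * eta th ^ 4) * u) = hN * hk * eta th ^ 2 * (mck * (w / hk) * ((m * eta th) ^ 2 * u)))%C.
  by rewrite /=; field.
have -> : (- (w * (mk * Cconj m ^ 2 * hk * (hN * uc))) = - (hN * hk * eta th ^ 2 * (mk * w * ((Cconj m / eta th) ^ 2 * uc))))%C.
  by rewrite /=; field.
by rewrite main2; cring.
Qed.

(** The two sides of [laurent_identity] have size N + 4 + size B and at most n + N + 2. *)
Lemma laurent_degree : (size B + 2 <= n)%N \/ B = 0%Ri.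
Proof.
have m0 := m_neq0; have mc0 := mc_neq0.
have [E|nz] := eqVneq B 0%Ri; [by right|left].
have I := laurent_identity.
have toRC_neq0 : forall z : C, z <> 0%C -> toRC z != 0%Ri.
  by move=> z z0; apply/eqP => E; apply: z0; rewrite -(toRCK z) E.
have ca0 : ca != 0%Ri.
  by apply: toRC_neq0 => /Cmult_integral [|]; apply: Cpow_neq0.
have S0 : (\sum_(j < N.+1) (al j)%:P * (1 + 'X) ^+ j)%Ri = (B \Po ((toRC m)%:P * (1 + 'X)))%Ri.
  rewrite comp_polyE (big_ord_widen N.+1 (fun j => B`_j *: ((toRC m)%:P * (1 + 'X)) ^+ j)%Ri HN).
  rewrite [RHS]big_mkcond /=; apply: eq_bigr => j _; rewrite /al.
  have -> : toRC (ofRC (B`_j)%Ri * m ^ j)%C = (B`_j * toRC m ^+ j)%Ri.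
    have Mj : forall k, toRC (m ^ k)%C = (toRC m ^+ k)%Ri.
      by elim=> [|k IH]; [rewrite expr0|rewrite exprS -IH].
    by rewrite -Mj -{2}(ofRCK (B`_j)%Ri).
  case: ltnP => L; last by rewrite nth_default // mul0r polyC0 mul0r.
  by rewrite exprMn polyCM -mul_polyC rmorphXn mulrA.
have sz2 : size ((toRC m)%:P * (1 + 'X) : {poly RC})%Ri = 2%N.
  by rewrite mul_polyC size_scale ?toRC_neq0 // size_oneX.
have Ssz : size (ca%:P * 'X^(N + 4) * (\sum_(j < N.+1) (al j)%:P * (1 + 'X) ^+ j))%Ri = (N + 4 + size B)%N.
  rewrite S0 -mulrA mul_polyC size_scale // mulrC size_mulXn.
    by rewrite size_comp_poly2.
  by rewrite -size_poly_eq0 size_comp_poly2 // size_poly_eq0.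
have Rsz : (size (cb%:P * 'X^(n.+1) * (\sum_(j < N.+1) (be j)%:P * ((1 + 'X) ^+ j * 'X^(N - j))))%Ri <= n.+1 + N.+1)%N.
  rewrite -mulrA mul_polyC; apply: leq_trans (size_scale_leq _ _) _.
  set W := (\sum_(j < N.+1) _)%Ri.
  have W1 : (size W <= N.+1)%N.
    apply: (leq_trans (size_sum _ _ _)); apply/bigmax_leqP => j _.
    rewrite mul_polyC; apply: leq_trans (size_scale_leq _ _) _.
    have jN : (j <= N)%N by rewrite -ltnS.
    apply: leq_trans (size_polyMleq _ _) _; rewrite size_polyXn addnS /=.
    have := size_poly_exp_leq (1 + 'X : {poly RC})%Ri j; rewrite size_oneX /= mul1n => L.
    by apply: leq_trans (leq_add L (leqnn _)) _; rewrite addSn subnKC.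
  by apply: leq_trans (size_polyMleq _ _) _; rewrite size_polyXn addSn /= leq_add2l.
by move: Rsz; rewrite -I Ssz; lia.
Qed.

(** Comparison of the leading behaviour of both sides at eta = -1, that is, at the pole z = 0. *)
Lemma laurent_low j0 : (j0 <= N)%N -> (forall j, (j < j0)%N -> B`_j = 0)%Ri ->
  (Cconj m ^ n.+1 * m ^ 2 * RtoC ((- 1) ^ (N + 4)%N) * (ofRC (B`_j0)%Ri * m ^ j0) =
   m ^ n.+1 * Cconj m ^ 2 * RtoC ((- 1) ^ n.+1) * (Cconj (ofRC (B`_j0)%Ri) * Cconj m ^ j0 * RtoC ((- 1) ^ (N - j0)%N)))%C.
Proof.
move=> L Z.
have Zab : forall j, (j < j0)%N -> al j = 0%Ri /\ be j = 0%Ri.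
  move=> j Hj; rewrite /al /be Z // ofRC0; split; first by rewrite Cmult_0_l.
  by rewrite (_ : Cconj (RtoC 0) = RtoC 0) ?Cmult_0_l //; apply: C_eq; rewrite /Re /Im /=; ring.
have := low_coef _ N j0 (N + 4) n.+1 al be ca cb L Zab laurent_identity.
have sg : forall k, ((-1) ^+ k : RC)%Ri = toRC (RtoC ((- 1) ^ k)).
  elim=> [|k IH]; first by rewrite expr0.
  rewrite exprS IH -[LHS]ofRCK ofRCM toRCK ofRCN ofRC1; congr toRC.
  by apply: C_eq; rewrite /Re /Im /=; ring.
rewrite !sg => E; have := f_equal ofRC E.
by rewrite /al /be /ca /cb !ofRCM !toRCK.
Qed.
End LaurentReality.

(** * The reality condition on the circles *)

Lemma is_derive_Re g t d : rcd g t d -> is_derive (fun s => 2 * Re (g s)) t (2 * Re d).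
Proof. by move=> [H _]; apply: is_derive_scal. Qed.

Lemma is_derive_arc (f g : R -> R) th1 th2 th df dg : th1 < th < th2 ->
  (forall s, th1 < s < th2 -> f s = g s) -> is_derive f th df -> is_derive g th dg -> df = dg.
Proof.
move=> H E Df Dg; rewrite -(is_derive_unique _ _ _ Df) -(is_derive_unique _ _ _ Dg).
by apply: Derive_ext_loc; apply: filter_imp (locally_interval _ _ _ H) => s Hs; exact: E.
Qed.

(* Along a circle every linear function satisfies f''' + f' = 0 in the angle; for the biharmonic function F
   this combination is twice the imaginary part of a holomorphic expression in z. *)
Lemma real_on_circle (U : C -> Prop) (F : R -> R -> R) (Fz a b : C -> C) (L : C -> R) (m : C) (r th1 th2 al be ga : R) :
  dF_rule U F Fz ->
  dFz_rule U Fz a b L ->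
  dL_rule U L a ->
  hol1 U a -> hol1 U b ->
  (forall th, th1 < th < th2 -> U (m + RtoC r * cis th)%C) ->
  (forall th, th1 < th < th2 -> F (Re (m + RtoC r * cis th)%C) (Im (m + RtoC r * cis th)%C)
     = al * Re (m + RtoC r * cis th)%C + be * Im (m + RtoC r * cis th)%C + ga) ->
  forall th, th1 < th < th2 ->
  let z := (m + RtoC r * cis th)%C in let u := (RtoC r * cis th)%C in
  Im (3 * (u * u) * (Cconj z * a z + b z) + u * u * u * (Cconj z * Cd a z + Cd b z) - 3 * u * RtoC (r * r) * a z)%C = 0.
Proof.
move=> P1 P2 P3 Ha Hb HU HF.
pose z th := (m + RtoC r * cis th)%C; pose u th := (RtoC r * cis th)%C.
have Dz : forall th, rcd z th (Ci * u th)%C.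
  move=> th; apply: rcd_eq; first by apply: rcd_plus; [exact: rcd_const|apply: rcd_scal; exact: rcd_cis].
  by rewrite /u; cring.
have Du : forall th, rcd u th (Ci * u th)%C.
  by move=> th; apply: rcd_eq; [apply: rcd_scal; exact: rcd_cis|rewrite /u; cring].
have uc : forall th, (Cconj (Ci * u th) * u th = - (Ci * RtoC (r * r)))%C.
  move=> th; rewrite /u !Cmult_conj cis_conj RtoC_mult.
  rewrite (_ : Cconj (RtoC r) = RtoC r); last by apply: C_eq; rewrite /Re /Im /=; ring.
  rewrite (_ : Cconj Ci = (- Ci)%C); last by apply: C_eq; rewrite /Re /Im /=; ring.
  by field; exact: cis_neq0.
pose Fzz th := (Cconj (z th) * a (z th) + b (z th))%C.
pose Fzzz th := (Cconj (z th) * Cd a (z th) + Cd b (z th))%C.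
have DF : forall th, th1 < th < th2 -> is_derive (fun s => F (Re (z s)) (Im (z s))) th (2 * Re (Ci * (Fz (z th) * u th))%C).
  move=> th Hh; apply: is_derive_eq; first by apply: (P1 z th); [exact: HU|exact: Dz].
  by congr (2 * Re _); cring.
have DS : forall th, th1 < th < th2 -> rcd (fun s => Fz (z s) * u s)%C th
    (Ci * (Fzz th * (u th * u th) - RtoC (L (z th)) * RtoC (r * r) + Fz (z th) * u th))%C.
  move=> th Hh; apply: rcd_eq.
    by apply: rcd_mult; [apply: (P2 z th); [exact: HU|exact: Dz]|exact: Du].
  rewrite (_ : (((Cconj (z th) * a (z th) + b (z th)) * (Ci * u th) + RtoC (L (z th)) * Cconj (Ci * u th)) * u th + Fz (z th) * (Ci * u th))%C
     = (Ci * (Fzz th * (u th * u th) + Fz (z th) * u th) + RtoC (L (z th)) * (Cconj (Ci * u th) * u th))%C); last by rewrite /Fzz; cring.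
  by rewrite uc; cring.
have DFzz : forall th, th1 < th < th2 -> rcd (fun s => Fzz s * (u s * u s))%C th
    (Ci * (Fzzz th * (u th * u th * u th) - a (z th) * RtoC (r * r) * u th + 2 * Fzz th * (u th * u th)))%C.
  move=> th Hh; have [Da _] := Ha _ (HU th Hh); have [Db _] := Hb _ (HU th Hh).
  apply: rcd_eq.
    apply: rcd_mult; last by apply: rcd_mult; exact: Du.
    apply: rcd_plus; last exact: (rcd_comp b z th _ _ Db (Dz th)).
    by apply: rcd_mult; [apply: rcd_conj; exact: Dz|exact: (rcd_comp a z th _ _ Da (Dz th))].
  rewrite (_ : ((Cconj (Ci * u th) * a (z th) + Cconj (z th) * (Cd a (z th) * (Ci * u th)) + Cd b (z th) * (Ci * u th)) * (u th * u th)
      + (Cconj (z th) * a (z th) + b (z th)) * (Ci * u th * u th + u th * (Ci * u th)))%C =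
    (Ci * (Fzzz th * (u th * u th * u th) + 2 * Fzz th * (u th * u th)) + (Cconj (Ci * u th) * u th) * a (z th) * u th)%C).
    by rewrite uc; cring.
  by rewrite /Fzz /Fzzz /z; cring.
pose f1 th := al * Re (Ci * u th)%C + be * Im (Ci * u th)%C.
pose f0 th := al * Re (u th) + be * Im (u th).
have Dlin : forall g d th, rcd g th d -> is_derive (fun s => al * Re (g s) + be * Im (g s)) th (al * Re d + be * Im d).
  move=> g d th [G1 G2]; apply: (is_derive_plus (fun s => al * Re (g s)) (fun s => be * Im (g s))); apply: is_derive_scal => //.
have E1 : forall th, th1 < th < th2 -> 2 * Re (Ci * (Fz (z th) * u th))%C = f1 th.
  move=> th Hh; apply: (is_derive_arc (fun s => F (Re (z s)) (Im (z s))) (fun s => al * Re (z s) + be * Im (z s) + ga) th1 th2 th) => //.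
    exact: DF.
  apply: is_derive_eq.
    by apply: (is_derive_plus (fun s => al * Re (z s) + be * Im (z s)) (fun _ => ga)); [exact: Dlin (Dz th)|exact: is_derive_const].
  by rewrite /plus /zero /= Rplus_0_r.
have E2 : forall th, th1 < th < th2 -> 2 * Re (Ci * (Ci * (Fzz th * (u th * u th) - RtoC (L (z th)) * RtoC (r * r) + Fz (z th) * u th)))%C = - f0 th.
  move=> th Hh; apply: (is_derive_arc (fun s => 2 * Re (Ci * (Fz (z s) * u s))%C) f1 th1 th2 th) => //.
    by apply: is_derive_Re; apply: rcd_scal; exact: DS.
  apply: is_derive_eq; first by apply: (Dlin (fun s => Ci * u s)%C); apply: rcd_scal; exact: Du.
  by rewrite /f0; case: (u th) => x y; rewrite /Re /Im /=; ring.
move=> th Hh z0 u0.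
have DL := P3 z th _ (HU th Hh) (Dz th).
(* The third angular derivative. Added to the first one, the terms with Fz cancel, and the real
   number L drops out because its factor is imaginary. *)
have E3 : 2 * Re (Ci * (Ci * (Ci * (Fzzz th * (u th * u th * u th) - a (z th) * RtoC (r * r) * u th + 2 * Fzz th * (u th * u th))
    - RtoC (2 * Re (a (z th) * (Ci * u th))%C) * RtoC (r * r) + Ci * (Fzz th * (u th * u th) - RtoC (L (z th)) * RtoC (r * r) + Fz (z th) * u th))))%C = - f1 th.
  apply: (is_derive_arc (fun s => 2 * Re (Ci * (Ci * (Fzz s * (u s * u s) - RtoC (L (z s)) * RtoC (r * r) + Fz (z s) * u s)))%C) (fun s => - f0 s) th1 th2 th) => //.
    apply: is_derive_Re; apply: rcd_scal; apply: rcd_scal; apply: rcd_plus; last exact: DS.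
    apply: rcd_minus; first exact: DFzz.
    apply: rcd_eq; first by apply: rcd_mult; [apply: rcd_real; exact: DL|exact: rcd_const].
    by cring.
  by apply: (is_derive_opp f0); exact: Dlin (Du th).
have := E1 th Hh; move: E3; rewrite /z0 /u0 -/(z th) -/(u th) -/(Fzz th) -/(Fzzz th).
move: (f1 th) (Fzzz th) (Fzz th) (a (z th)) (Fz (z th)) (L (z th)) (u th) => f [A1 A2] [B1 B2] [a1 a2] [z1 z2] l [u1 u2].
by rewrite /Re /Im /=; lra.
Qed.

(** Where the curve moves, differentiating p(g) = 0 passes the equation on to p', of smaller degree;
    the descent can only end in a nonzero constant, which is absurd. A subinterval is all that can
    be claimed along the way. *)
Lemma poly_of_curve_constant (p : {poly RC}) : forall n (t1 t2 : R) (g g1 : R -> C), (size p <= n)%N -> t1 < t2 -> p != 0%Ri ->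
  (forall t, t1 < t < t2 -> rcd g t (g1 t) /\ rcont g1 t) ->
  (forall t, t1 < t < t2 -> peval p (g t) = 0%C) ->
  exists s1 s2 c, t1 <= s1 < s2 /\ s2 <= t2 /\ forall t, s1 < t < s2 -> g t = c.
Proof.
move=> n; elim: n p => [|n IH] p t1 t2 g g1 Hs H12 p0 D Z.
  by move: Hs; rewrite leqn0 size_poly_eq0 (negbTE p0).
have [All|[u [Hu Nu]]] : (forall u, t1 < u < t2 -> g1 u = 0%C) \/ exists u, t1 < u < t2 /\ g1 u <> 0%C.
  have [K|K] := classic (exists u, t1 < u < t2 /\ g1 u <> 0%C); [by right|left => u Hu].
  by apply: NNPP => Nu; apply: K; exists u.
  exists t1, t2, (g ((t1 + t2) / 2)); do ! split; try lra.
  move=> t Ht.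
  apply: (rcd0_const g t1 t2) => // [s Hs'|]; last lra.
  by rewrite -(All s Hs'); case: (D s Hs').
have [v1 [v2 [V1 [V2 [V3 V4]]]]] := locally_subinterval _ _ _ _ Hu (rcont_neq0_near _ _ (proj2 (D u Hu)) Nu).
have Z' : forall t, v1 < t < v2 -> peval (p^`())%Ri (g t) = 0%C.
  move=> t Ht; have Ht' : t1 < t < t2 by lra.
  have [Dg _] := D t Ht'.
  have K1 := rcd_comp _ g t _ _ (cdiff_peval p (g t)) Dg.
  have K2 : rcd (fun s => peval p (g s)) t 0%C.
    apply: (rcd_ext_loc (fun _ => 0%C)); last exact: rcd_const.
    by apply: filter_imp (locally_interval _ _ _ Ht') => s Hs'; rewrite Z.
  by case: (Cmult_integral _ _ (rcd_unique _ _ _ _ K1 K2)) => // K; case: (V4 t Ht).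
have [E0|N0] := eqVneq (p^`())%Ri 0%Ri; last first.
  have [s1 [s2 [c [S1 [S2 S3]]]]] := IH _ v1 v2 g g1 (leq_trans (lt_size_deriv p0) Hs) ltac:(lra) N0
    (fun t Ht => D t ltac:(lra)) Z'.
  by exists s1, s2, c; do ! split; try lra.
have Sp : (size p <= 1)%N.
  rewrite leqNgt; apply/negP => S1.
  have := f_equal (fun q : {poly RC} => (q`_((size p).-2))%Ri) E0; rewrite coef_deriv coef0.
  have -> : ((size p).-2.+1 = (size p).-1)%N by move: S1; case: (size p) => [|[|k]].
  move/eqP; rewrite -mulr_natr mulf_eq0 -lead_coefE lead_coef_eq0 (negbTE p0) /=.
  by rewrite Num.Theory.pnatr_eq0; move: S1; case: (size p) => [|[|k]].
have pc := size1_polyC Sp.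
have := Z u Hu; rewrite pc /peval hornerC => E.
by case/negP: p0; apply/eqP; rewrite pc -(ofRCK (p`_0)%Ri) E.
Qed.

Lemma ofRC_nat k : ofRC (k%:R)%Ri = RtoC (INR k).
Proof. by elim: k => [|k IH] //; rewrite mulrS ofRCD IH S_INR RtoC_plus ofRC1; cring. Qed.

Lemma pevalZ c P z : peval (toRC c *: P)%Ri z = (c * peval P z)%C.
Proof. by rewrite /peval hornerZ ofRCM toRCK. Qed.

Lemma pevalMn P n z : peval (P *+ n)%Ri z = (RtoC (INR n) * peval P z)%C.
Proof. by rewrite /peval hornerMn -mulr_natl ofRCM ofRC_nat. Qed.

(* z P' - n P, so that a = P / z^n has derivative (z P' - n P) / z^(n+1). *)
Definition euler (n : nat) (P : {poly RC}) : {poly RC} := ('X * P^`() - P *+ n)%Ri.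

(* With a = P / z^n and b = Q / z^n, and |m| = r, this is z^(n+1) times the factor
   3 H + u H' + r^2 a' of [real_form_on_circle], where H = conj m * a + b and u = z - m. *)
Definition laurent_poly (m : C) (n : nat) (P Q : {poly RC}) : {poly RC} :=
  ('X * ((toRC (Cconj m) *: P + Q) *+ 3 + (toRC (Cconj m) *: euler n P + euler n Q)) - toRC m *: euler n Q)%Ri.

Definition cf (P : {poly RC}) (i : nat) : C := ofRC (P`_i)%Ri.

Lemma coef_euler n P i : cf (euler n P) i = (RtoC (INR i - INR n) * cf P i)%C.
Proof.
rewrite [LHS]/cf /euler coefB coefMn ofRCD ofRCN -(mulr_natl _ n) ofRCM ofRC_nat RtoC_minus coefXM.
case: i => [|i]; first by rewrite eqxx ofRC0 (_ : INR 0 = 0%R) // -!/(cf P 0); cring.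
by rewrite [i.+1 == 0%N]/= [i.+1.-1]/= coef_deriv -mulr_natl ofRCM ofRC_nat -!/(cf P i.+1); cring.
Qed.

Lemma coef_laurent_poly0 m n P Q : cf (laurent_poly m n P Q) 0 = (RtoC (INR n) * m * cf Q 0)%C.
Proof.
rewrite [LHS]/cf /laurent_poly coefB coefXM eqxx coefZ sub0r ofRCN ofRCM toRCK -/(cf (euler n Q) 0) coef_euler RtoC_minus (_ : INR 0 = 0%R) //; cring.
Qed.

Lemma coef_laurent_polyS m n P Q i : cf (laurent_poly m n P Q) i.+1 =
  (RtoC (INR i + 3 - INR n) * (Cconj m * cf P i + cf Q i) + RtoC (INR n - INR i.+1) * m * cf Q i.+1)%C.
Proof.
rewrite [LHS]/cf /laurent_poly coefB coefXM [i.+1 == 0%N]/= [i.+1.-1]/= coefD coefMn (coefD (_ *: P)%Ri) (coefD (_ *: euler n P)%Ri) !coefZ -mulr_natl.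
rewrite ofRCD ofRCN ofRCD (ofRCM 3%:R%Ri) ofRC_nat !(ofRCD, ofRCM, toRCK) -!/(cf _ _) !coef_euler !RtoC_minus RtoC_plus.
by rewrite (_ : INR 3 = 3%R); [cring|rewrite /=; ring].
Qed.

Lemma RtoC_neq0 (x : R) : x <> 0 -> RtoC x <> 0%C.
Proof. by move=> H /RtoC_inj. Qed.

Lemma Cmult_cancel (a x y : C) : a <> 0%C -> (a * x = a * y)%C -> x = y.
Proof.
by move=> a0 E; rewrite (_ : x = a * x / a)%C; [rewrite E; field|field].
Qed.

Lemma sign_cases k : (- 1) ^ k = 1 \/ (- 1) ^ k = - 1.
Proof. by elim: k => [|k [E|E]]; [left|right|left]; rewrite /= ?E; ring. Qed.

Section Vanishing.
Variables (th1 th2 t1 t2 : R) (m m1 m2 : R -> C) (r : R -> R) (n : nat) (P Q : {poly RC}).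
Hypothesis Hth : th1 < th2.
Hypothesis Hpi : th2 - th1 < PI.
Hypothesis Ht : t1 < t2.
Hypothesis Hm : forall t, t1 < t < t2 -> rcd m t (m1 t).
Hypothesis Hm1 : forall t, t1 < t < t2 -> rcd m1 t (m2 t).
Hypothesis r_pos : forall t, t1 < t < t2 -> 0 < r t.
Hypothesis Hmr : forall t, t1 < t < t2 -> (m t * Cconj (m t) = RtoC (r t * r t))%C.
Hypothesis LI : forall s1 s2 al be de, t1 <= s1 < s2 -> s2 <= t2 ->
  (forall t, s1 < t < s2 -> al * Re (m t) + be * Im (m t) + de = 0) -> al = 0 /\ be = 0 /\ de = 0.
Hypothesis HK : forall t th, t1 < t < t2 -> th1 < th < th2 -> exists K, Im K = 0 /\
  ((m t + RtoC (r t) * cis th) ^ n.+1 * K = (RtoC (r t) * cis th) ^ 2 * peval (laurent_poly (m t) n P Q) (m t + RtoC (r t) * cis th))%C.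

Let p i : C := cf P i.
Let q i : C := cf Q i.
Let B t := laurent_poly (m t) n P Q.

(** The real independence of 1, Re m and Im m gives the complex independence of 1, m and conj m. *)
Local Lemma complex_indep (A D G : C) : (forall t, t1 < t < t2 -> A * Cconj (m t) + D + G * m t = 0)%C ->
  A = 0%C /\ D = 0%C /\ G = 0%C.
Proof.
move=> H.
have [R1 [R2 R3]] : Re A + Re G = 0 /\ Im A - Im G = 0 /\ Re D = 0.
  apply: (LI t1 t2) => //; try lra.
  by move=> t Hh; have := f_equal Re (H t Hh); rewrite /Re /Im /=; lra.
have [I1 [I2 I3]] : Im A + Im G = 0 /\ Re G - Re A = 0 /\ Im D = 0.
  apply: (LI t1 t2) => //; try lra.
  by move=> t Hh; have := f_equal Im (H t Hh); rewrite /Re /Im /=; lra.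
by do ! split; apply: C_eq => /=; lra.
Qed.

(** A generous size bound for [B t], the same for every t. *)
Let N : nat := (size P + size Q + n + 10)%N.

Local Lemma size_B t : (size (B t) <= N.+1)%N.
Proof.
have E : forall (U : {poly RC}) k, (size (euler k U) <= (size U).+1)%N.
  move=> U k; rewrite /euler; apply: leq_trans (size_polyD _ _) _; rewrite geq_max size_polyN; apply/andP; split.
    apply: leq_trans (size_polyMleq _ _) _; rewrite size_polyX /=.
    exact: size_deriv_leq.
  by rewrite -scaler_nat; apply: leq_trans (size_scale_leq _ _) _.
have Z : forall (c : RC) (U : {poly RC}) k, (size U <= k)%N -> (size (c *: U)%Ri <= k)%N.
  by move=> c U k; apply: leq_trans; exact: size_scale_leq.
have A : forall (U V : {poly RC}) k, (size U <= k)%N -> (size V <= k)%N -> (size (U + V)%Ri <= k)%N.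
  by move=> U V k HU HV; apply: leq_trans (size_polyD _ _) _; rewrite geq_max HU.
have EP := E P n; have EQ := E Q n.
have sP : (size P <= N.-1)%N by rewrite /N; lia.
have sQ : (size Q <= N.-1)%N by rewrite /N; lia.
have eP : (size (euler n P) <= N.-1)%N by apply: leq_trans EP _; rewrite /N; lia.
have eQ : (size (euler n Q) <= N.-1)%N by apply: leq_trans EQ _; rewrite /N; lia.
have N0 : (N.-1 <= N.+1)%N by rewrite /N; lia.
apply: (A _ _ _); last by rewrite size_polyN; apply: (Z _ _ _); apply: leq_trans eQ N0.
apply: leq_trans (size_polyMleq _ _) _; rewrite size_polyX /=.
suff L : (size ((toRC (Cconj (m t)) *: P + Q) *+ 3 + (toRC (Cconj (m t)) *: euler n P + euler n Q))%Ri <= N.-1)%N.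
  by rewrite ltnS; apply: leq_trans L _; rewrite /N; lia.
apply: (A _ _ _); last by apply: (A _ _ _) => //; apply: (Z _ _ _).
by rewrite -scaler_nat; apply: (Z _ _ _); apply: (A _ _ _) => //; apply: (Z _ _ _).
Qed.

(** By [laurent_degree] the coefficient i + 1 of [B t] vanishes for every t. It is a combination of
    1, m and conj m, and the factor i + 3 - n is not zero in this range. *)
Local Lemma high_vanish i : (n <= i + 2)%N -> p i = 0%C /\ q i = 0%C.
Proof.
move=> Hi.
have H : forall t, t1 < t < t2 -> (RtoC (INR i + 3 - INR n) * p i * Cconj (m t) + RtoC (INR i + 3 - INR n) * q i + RtoC (INR n - INR i.+1) * q i.+1 * m t = 0)%C.
  move=> t Hh.
  have E : ((B t)`_i.+1 = 0)%Ri.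
    case: (laurent_degree th1 th2 (m t) (r t) n N (B t) Hth Hpi (r_pos t Hh) (Hmr t Hh) (size_B t) (fun th => HK t th Hh)).
      by move=> L; rewrite nth_default // -(leq_add2r 2); apply: leq_trans L _; lia.
    by move=> ->; rewrite coef0.
  have := coef_laurent_polyS (m t) n P Q i; rewrite -/(B t) {1}/cf E ofRC0 => E'.
  by rewrite [RHS]E' /p /q; cring.
have [A [D _]] := complex_indep _ _ _ H.
have N0 : INR i + 3 - INR n <> 0.
  have : INR n <= INR (i + 2) by apply: le_INR; lia.
  by rewrite plus_INR /=; lra.
have := RtoC_neq0 _ N0 => N1.
by split; [case: (Cmult_integral _ _ A)|case: (Cmult_integral _ _ D)].
Qed.

(** Once the earlier coefficients are gone, the lowest possible one of [B t] is conj m * pp + m *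
    ss. Then [laurent_low] becomes a polynomial equation for x = m / conj m, which is not constant
    on any interval. *)
Local Lemma low_vanish : forall j, (j + 3 <= n)%N -> q j = 0%C /\ forall i, i.+1 = j -> p i = 0%C.
Proof.
elim/ltn_ind => j IH Hj.
have low : forall t, t1 < t < t2 -> forall k, (k < j)%N -> ((B t)`_k = 0)%Ri.
  move=> t Hh k Hk; rewrite -(ofRCK ((B t)`_k)%Ri) -/(cf (B t) k) (_ : cf _ _ = 0%C) //.
  case: k Hk => [|k] Hk.
    by rewrite coef_laurent_poly0 -/(q 0%N) (proj1 (IH 0%N Hk ltac:(lia))); cring.
  have [q1 p1] := IH k.+1 Hk ltac:(lia); have [q0 _] := IH k ltac:(lia) ltac:(lia).
  by rewrite coef_laurent_polyS -/(p k) -/(q k) -/(q k.+1) q1 q0 (p1 k erefl); cring.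
pose pp : C := match j with O => 0%C | i.+1 => (RtoC (INR i + 3 - INR n) * p i)%C end.
pose ss : C := (RtoC (INR n - INR j) * q j)%C.
have Bj : forall t, t1 < t < t2 -> cf (B t) j = (Cconj (m t) * pp + m t * ss)%C.
  move=> t Hh; rewrite /pp /ss; case: (j) IH Hj low => [|i] IH Hj low.
    by rewrite coef_laurent_poly0 -/(q 0%N) /= Rminus_0_r; cring.
  have [q0 _] := IH i ltac:(lia) ltac:(lia).
  by rewrite coef_laurent_polyS -/(p i) -/(q i) -/(q i.+1) q0; cring.
pose d := (n - j)%N.
have Ed : n = (j + d)%N by rewrite /d; lia.
have d3 : (3 <= d)%N by rewrite /d; lia.
pose s1 : R := (- 1) ^ (N + 4)%N; pose s2 : R := (- 1) ^ n.+1 * (- 1) ^ (N - j)%N.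
have s1n : s1 <> 0 by rewrite /s1; case: (sign_cases (N + 4)) => ->; lra.
pose x t := (m t / Cconj (m t))%C.
(* Here d = n - j is what remains of the exponents after the common powers of m and conj m are
   cancelled. As d >= 3, the exponents 0 and 1 do not interfere with d - 1 and d. *)
pose e : {poly RC} := ((toRC (RtoC s1 * pp)%C)%:P + (toRC (RtoC s1 * ss)%C)%:P * 'X
   - ((toRC (RtoC s2 * Cconj pp)%C)%:P * 'X^d + (toRC (RtoC s2 * Cconj ss)%C)%:P * 'X^(d.-1)))%Ri.
have mc : forall t, t1 < t < t2 -> m t <> 0%C /\ Cconj (m t) <> 0%C.
  move=> t Hh; have r0 := r_pos t Hh; split => E; have := Hmr t Hh; rewrite E ?Cmult_0_l ?Cmult_0_r => /RtoC_inj; nra.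
have ex : forall t, t1 < t < t2 -> peval e (x t) = 0%C.
  move=> t Hh; have [m0 c0] := mc t Hh.
  have := laurent_low th1 th2 (m t) (r t) n N (B t) Hth Hpi (r_pos t Hh) (Hmr t Hh) (size_B t) (fun th => HK t th Hh) j ltac:(rewrite /N; lia) (low t Hh).
  rewrite -/(cf (B t) j) Bj // (Cplus_conj (_ * pp)%C) !(Cmult_conj _ pp) !(Cmult_conj _ ss) Cconj_conj.
  rewrite /e !(pevalD, pevalN, pevalM, pevalC, pevalX) !pevalXn !pevalX /x.
  have X : forall k, ((m t / Cconj (m t)) ^ k = m t ^ k / Cconj (m t) ^ k)%C.
    move=> k; rewrite /Cdiv -Cpow_inv //; elim: k => [|k IHk] /=; [cring|rewrite IHk; cring].
  rewrite !X -/s1 => E.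
  have [k Ek] : exists k, d = k.+1 by exists d.-1; move: d3; case: (d).
  have {}E : (Cconj (m t) ^ j * m t ^ j * (m t * m t) * (Cconj (m t) * Cconj (m t)) *
     (Cconj (m t) ^ k * RtoC s1 * (Cconj (m t) * pp + m t * ss)) =
     Cconj (m t) ^ j * m t ^ j * (m t * m t) * (Cconj (m t) * Cconj (m t)) *
     (m t ^ k * RtoC s2 * (m t * Cconj pp + Cconj (m t) * Cconj ss)))%C.
    have En : n.+1 = (j + (k + 2))%N by rewrite Ed Ek; lia.
    have P2 : forall w : C, (w ^ 2 = w * w)%C by move=> w; rewrite /=; cring.
    move: E; rewrite {1 2}En !Cpow_add !P2 /s2 RtoC_mult => E.
    set lhs := (LHS); set rhs := (RHS).
    have -> : lhs = (Cconj (m t) ^ j * (Cconj (m t) ^ k * (Cconj (m t) * Cconj (m t))) * (m t * m t) * RtoC s1 * ((Cconj (m t) * pp + m t * ss) * m t ^ j))%C by rewrite /lhs; cring.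
    by rewrite E /rhs; cring.
  have {}E := Cmult_cancel _ _ _ _ E.
  have {}E : (Cconj (m t) ^ k * RtoC s1 * (Cconj (m t) * pp + m t * ss) = m t ^ k * RtoC s2 * (m t * Cconj pp + Cconj (m t) * Cconj ss))%C.
    apply: E.
    have := Cpow_neq0 _ j m0; have := Cpow_neq0 _ j c0 => K1 K2.
    by do ! (case/Cmult_integral => //).
  rewrite Ek [k.+1.-1]/= !CpowS.
  have ck0 := Cpow_neq0 _ k c0.
  move: (m t ^ k)%C (Cconj (m t) ^ k)%C ck0 E => mk ck ck0 E.
  set tgt := (LHS).
  have -> : tgt = ((ck * RtoC s1 * (Cconj (m t) * pp + m t * ss) - mk * RtoC s2 * (m t * Cconj pp + Cconj (m t) * Cconj ss)) / (ck * Cconj (m t)))%C.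
    by rewrite /tgt; cfield.
  by rewrite E; cfield.
have e0 : e = 0%Ri.
  apply/eqP; apply: contraT => e0.
  have Dx : forall t, t1 < t < t2 -> rcd x t (m1 t * / Cconj (m t) + m t * (- Cconj (m1 t) / (Cconj (m t) * Cconj (m t))))%C /\ rcont (fun t => m1 t * / Cconj (m t) + m t * (- Cconj (m1 t) / (Cconj (m t) * Cconj (m t))))%C t.
    move=> t Hh; have [m0 c0] := mc t Hh.
    have Dc := rcd_conj _ _ _ (Hm t Hh).
    split; first by apply: rcd_mult; [exact: Hm|exact: rcd_inv Dc c0].
    apply: rcont_plus.
      by apply: rcont_mult; apply: rcd_rcont; [exact: Hm1|exact: rcd_inv Dc c0].
    apply: rcont_mult; first by apply: rcd_rcont; exact: Hm.
    apply: rcont_mult; first by apply: rcd_rcont; apply: rcd_opp; apply: rcd_conj; exact: Hm1.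
    apply: rcd_rcont; apply: rcd_inv; first by apply: rcd_mult; exact: Dc.
    by case/Cmult_integral.
  have [s1' [s2' [k [S1 [S2 S3]]]]] := poly_of_curve_constant e _ t1 t2 x _ (leqnn _) Ht e0 Dx ex.
  (* A constant x would make the real and imaginary parts of m linearly dependent. By independence,
     the real part gives Re k = 1 and the imaginary part Re k = -1. *)
  have E : forall t, s1' < t < s2' -> m t = (k * Cconj (m t))%C.
    move=> t Hh; have [m0 c0] := mc t ltac:(lra).
    by rewrite -(S3 t Hh) /x; field.
  have [A1 [A2 _]] : (1 - Re k) = 0 /\ - Im k = 0 /\ 0 = 0.
    apply: (LI s1' s2') => // t Hh; have := f_equal Re (E t Hh); rewrite /Re /Im /=; lra.
  have [B1 [B2 _]] : - Im k = 0 /\ 1 + Re k = 0 /\ 0 = 0.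
    apply: (LI s1' s2') => // t Hh; have := f_equal Im (E t Hh); rewrite /Re /Im /=; lra.
  lra.
have c0 := f_equal (fun U : {poly RC} => (U`_0)%Ri) e0; have c1 := f_equal (fun U : {poly RC} => (U`_1)%Ri) e0.
have [k Ek] : exists k, d = k.+3 by exists (d - 3)%N; lia.
move: c0 c1; rewrite /e Ek !coefB !coefD !coefCM !coefC !coefX !coefXn /= !mulr0 !mulr1 ?addr0 ?add0r ?subr0 => c0 c1.
have {}c0 : (RtoC s1 * pp = 0)%C by apply: toRC_inj; rewrite c0.
have {}c1 : (RtoC s1 * ss = 0)%C by apply: toRC_inj; rewrite c1.
have sc := RtoC_neq0 _ s1n.
have pp0 : pp = 0%C by case: (Cmult_integral _ _ c0).
have ss0 : ss = 0%C by case: (Cmult_integral _ _ c1).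
split.
  case: (Cmult_integral _ _ ss0) => // /RtoC_inj K.
  have : INR j < INR n by apply: lt_INR; lia.
  by lra.
move=> i Ei; move: pp0; rewrite /pp -Ei; case/Cmult_integral => // /RtoC_inj K.
have : INR i + 3 < INR n by rewrite (_ : 3%R = INR 3); [rewrite -plus_INR; apply: lt_INR; lia|rewrite /=; ring].
by lra.
Qed.

(** The high and the low range cover every index except i = n - 3 in P, where the factor i + 3 - n
    vanishes. That coefficient is the pole of order three of a. *)
Lemma laurent_coefs_vanish : (forall i, (i + 3)%N <> n -> (P`_i = 0)%Ri) /\ forall i, (Q`_i = 0)%Ri.
Proof.
have toP : forall (U : {poly RC}) i, cf U i = 0%C -> (U`_i = 0)%Ri.
  by move=> U i E; rewrite -(ofRCK (U`_i)%Ri) -/(cf U i) E.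
split=> i.
  move=> Ni; apply: toP; have [L|L] := leqP n (i + 2)%N; first by case: (high_vanish i L).
  by have [_ H] := low_vanish i.+1 ltac:(lia); exact: H.
apply: toP; have [L|L] := leqP n (i + 2)%N; first by case: (high_vanish i L).
by have [H _] := low_vanish i ltac:(lia).
Qed.
End Vanishing.

(** * The remaining functions *)

Lemma cf_eq0 (P : {poly RC}) : (forall i, cf P i = 0%C) -> P = 0%Ri.
Proof. by move=> H; apply/polyP => i; rewrite coef0 -(ofRCK (P`_i)%Ri) -/(cf P i) H. Qed.

(* The factor 3 H + u H' + r^2 a' of [real_form_on_circle] for a = P and b = Q. *)
Definition poly_real_form (m : C) (r : R) (P Q : {poly RC}) : {poly RC} :=
  ((toRC (Cconj m) *: P + Q) *+ 3 + ('X * (toRC (Cconj m) *: P + Q)^`() + (toRC (RtoC (r * r)) *: P^`() - toRC m *: (toRC (Cconj m) *: P + Q)^`())))%Ri.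

Section PolynomialCase.
Variables (th1 th2 : R) (P Q : {poly RC}).
Hypothesis Hth : th1 < th2.
Hypothesis Hpi : th2 - th1 < PI.

(** After rescaling the circle to the unit circle, [real_on_arc_square] applies. *)
Lemma poly_real_form_eq0 m r : 0 < r ->
  (forall th, th1 < th < th2 -> Im ((RtoC r * cis th) * (RtoC r * cis th) * peval (poly_real_form m r P Q) (m + RtoC r * cis th))%C = 0) ->
  poly_real_form m r P Q = 0%Ri.
Proof.
move=> r0 H.
pose A : {poly RC} := ((toRC m)%:P + (toRC (RtoC r))%:P * 'X)%Ri.
have EA : forall z, peval A z = (m + RtoC r * z)%C by move=> z; rewrite pevalD pevalM !pevalC pevalX.
have Z : (poly_real_form m r P Q \Po A)%Ri = 0%Ri.
  apply: (real_on_arc_square _ th1 th2 Hth Hpi) => th Hh; rewrite peval_comp EA.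
  have := H th Hh; move: (cis th) (peval (poly_real_form m r P Q) (m + RtoC r * cis th)%C) => e X E.
  have {}E : (r * r) * Im (e * e * X)%C = 0.
    by rewrite -E; move: e X {E} => [e1 e2] [x1 x2]; rewrite /Im /=; ring.
  by case: (Rmult_integral _ _ E) => //; nra.
have rc : RtoC r <> 0%C by apply: RtoC_neq0; lra.
apply: (poly_eq0_arc _ m r th1 th2 Hth Hpi) => [|th Hh]; first lra.
by rewrite -EA -peval_comp Z peval0.
Qed.

Lemma coef_poly_real_form m r i : cf (poly_real_form m r P Q) i =
  (RtoC (INR i + 3) * (Cconj m * cf P i + cf Q i) +
   RtoC (INR i.+1) * (RtoC (r * r) * cf P i.+1 - m * (Cconj m * cf P i.+1 + cf Q i.+1)))%C.
Proof.
pose H : {poly RC} := (toRC (Cconj m) *: P + Q)%Ri.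
have EH : forall k, cf H k = (Cconj m * cf P k + cf Q k)%C.
  by move=> k; rewrite [LHS]/cf /H coefD coefZ ofRCD ofRCM toRCK.
have ED : forall (V : {poly RC}) k, cf (V^`())%Ri k = (RtoC (INR k.+1) * cf V k.+1)%C.
  by move=> V k; rewrite [LHS]/cf coef_deriv -mulr_natl ofRCM ofRC_nat.
have EX : cf ('X * H^`())%Ri i = (RtoC (INR i) * cf H i)%C.
  rewrite [LHS]/cf coefXM; case: (i) => [|k]; first by rewrite eqxx ofRC0 (_ : INR 0 = 0%R) //; cring.
  by rewrite [k.+1 == 0%N]/= [k.+1.-1]/= -/(cf (H^`())%Ri k) ED.
rewrite -!EH [LHS]/cf /poly_real_form -/H coefD coefMn (coefD ('X * _)%Ri) coefB !coefZ -mulr_natl.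
rewrite ofRCD (ofRCM 3%:R%Ri) ofRC_nat ofRCD ofRCD ofRCN !ofRCM !toRCK -/(cf H i) -/(cf ('X * H^`())%Ri i) -/(cf (H^`())%Ri i) -/(cf (P^`())%Ri i).
rewrite EX !ED RtoC_plus (_ : INR 3 = 3%R); last by rewrite /=; ring.
by cring.
Qed.

(** Descending from the top degree, each circle gives conj m * p_i + q_i = 0 once the coefficients
    of index i + 1 vanish; two different centres force p_i = q_i = 0. *)
Lemma polynomial_case (m m' : C) r r' : 0 < r -> 0 < r' -> m <> m' ->
  (forall th, th1 < th < th2 -> Im ((RtoC r * cis th) * (RtoC r * cis th) * peval (poly_real_form m r P Q) (m + RtoC r * cis th))%C = 0) ->
  (forall th, th1 < th < th2 -> Im ((RtoC r' * cis th) * (RtoC r' * cis th) * peval (poly_real_form m' r' P Q) (m' + RtoC r' * cis th))%C = 0) ->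
  P = 0%Ri /\ Q = 0%Ri.
Proof.
move=> r0 r0' N K K'; have Z := poly_real_form_eq0 m r r0 K; have Z' := poly_real_form_eq0 m' r' r0' K'.
have cf0 : forall i, cf 0%Ri i = 0%C by move=> i; rewrite /cf coef0.
have N' : (Cconj m - Cconj m')%C <> 0%C.
  move=> /Csub_eq0 E; apply: N; rewrite -(Cconj_conj m) E; exact: Cconj_conj.
have main : forall k i, (size P <= i + k)%N -> (size Q <= i + k)%N -> cf P i = 0%C /\ cf Q i = 0%C.
  elim=> [|k IH] i SP SQ.
    by rewrite addn0 in SP SQ; rewrite /cf !nth_default.
  have [p1 q1] := IH i.+1 ltac:(by rewrite addSnnS) ltac:(by rewrite addSnnS).
  have I3 : RtoC (INR i + 3) <> 0%C by apply: RtoC_neq0; have := pos_INR i; lra.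
  have E : (Cconj m * cf P i + cf Q i = 0)%C.
    apply: (Cmult_cancel _ _ _ I3); have := coef_poly_real_form m r i; rewrite Z cf0 p1 q1 => E.
    by rewrite Cmult_0_r {1}E; cring.
  have E' : (Cconj m' * cf P i + cf Q i = 0)%C.
    apply: (Cmult_cancel _ _ _ I3); have := coef_poly_real_form m' r' i; rewrite Z' cf0 p1 q1 => E'.
    by rewrite Cmult_0_r {1}E'; cring.
  have p0 : cf P i = 0%C.
    apply: (Cmult_cancel _ _ _ N'); rewrite Cmult_0_r.
    by rewrite (_ : (Cconj m - Cconj m') * cf P i = (Cconj m * cf P i + cf Q i) - (Cconj m' * cf P i + cf Q i))%C; [rewrite E E'; cring|cring].
  by split => //; move: E; rewrite p0 => <-; cring.
by split; apply: cf_eq0 => i; [case: (main (size P + size Q)%N i _ _)|case: (main (size P + size Q)%N i _ _)] => //; lia.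
Qed.
End PolynomialCase.

(** The quotient rule multiplied out, so that it also holds at om. Since [Cd h] is known to exist, a
    derivative along the real direction determines it. *)
Lemma deriv_quotient (U : C -> Prop) om n h P : openU U -> hol1 U h ->
  (forall z, U z -> ((z - om) ^ n * h z = peval P (z - om))%C) ->
  forall z, U z -> ((z - om) ^ n.+1 * Cd h z = peval (euler n P) (z - om))%C.
Proof.
move=> HU Hh H z Hz; have [D _] := Hh z Hz.
pose g (s : R) : C := (z + RtoC s)%C.
have g0 : g 0 = z by rewrite /g; cring.
have Dg : forall s, rcd g s 1%C.
  move=> s; apply: rcd_eq; first by apply: rcd_plus; [exact: rcd_const|apply: rcd_real; exact: is_derive_id].
  by rewrite /Hierarchy.one /=; cring.
have Dgo : rcd (fun s => g s - om)%C 0 1%C.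
  by apply: rcd_eq; [apply: rcd_minus; [exact: Dg|exact: rcd_const]|cring].
have D1 : rcd (fun s => (g s - om) ^ n * h (g s))%C 0 (dpow (z - om) n * h z + (z - om) ^ n * Cd h z)%C.
  have := rcd_mult _ _ _ _ _ (rcd_pow _ _ _ n Dgo) (rcd_comp h g 0 _ _ (eq_ind_r (fun u => cdiff h u (Cd h z)) D g0) (Dg 0)).
  by rewrite g0 => K; apply: (rcd_eq _ _ _ _ K); cring.
have D2 : rcd (fun s => (g s - om) ^ n * h (g s))%C 0 (peval (P^`())%Ri (z - om)).
  apply: (rcd_ext_loc (fun s => peval P (g s - om)%C)).
    have [r [Hr Hd]] := open_disc U z HU Hz.
    exists (mkposreal r Hr) => s Hs; rewrite H //; apply: Hd; rewrite /disc /g.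
    rewrite (_ : (z + RtoC s - z)%C = RtoC s); last by cring.
    rewrite Cmod_R; move: Hs; rewrite /ball /= /AbsRing_ball /Hierarchy.abs /Hierarchy.minus /Hierarchy.plus /Hierarchy.opp /= => Hs.
    by have -> : s = s + - 0 by exact: esym (Rminus_0_r s).
  have := rcd_comp _ (fun s => g s - om)%C 0 _ _ (cdiff_peval P (g 0 - om)%C) Dgo.
  by rewrite g0 => K; apply: (rcd_eq _ _ _ _ K); cring.
have E := rcd_unique _ _ _ _ D1 D2.
rewrite /euler pevalD pevalN pevalM pevalX pevalMn -E -H // CpowS.
have := dpow_mul (z - om)%C n => Ed.
rewrite (_ : ((z - om) * (dpow (z - om) n * h z + (z - om) ^ n * Cd h z) + - (RtoC (INR n) * ((z - om) ^ n * h z)))%C =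
  ((dpow (z - om) n * (z - om)) * h z + (z - om) * (z - om) ^ n * Cd h z - RtoC (INR n) * (z - om) ^ n * h z)%C); last by cring.
by rewrite Ed; cring.
Qed.

Lemma hol1_cancel_pow (U : C -> Prop) om n : openU U -> forall h, hol1 U h ->
  (forall z, U z -> (z - om) ^ n * h z = 0)%C -> forall z, U z -> h z = 0%C.
Proof.
move=> HU; elim: n => [|n IH] h Hh H z Hz; first by have := H z Hz; rewrite /= Cmult_1_l.
apply: (hol1_cancel U h om HU Hh) => // u Hu.
apply: (IH (fun u => (u - om) * h u)%C) => // [|v Hv].
  apply: hol1_mult => //; apply: hol1_plus => //; [exact: hol1_id|exact: hol1_const].
by have := H v Hv; rewrite CpowS => <-; cring.
Qed.

Section Integration.
Variables (U : C -> Prop) (F : R -> R -> R) (Fz a b : C -> C) (L : C -> R).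
Hypothesis HU : openU U.
Hypothesis conn : connU U.
Hypothesis P1 : dF_rule U F Fz.
Hypothesis P2 : dFz_rule U Fz a b L.
Hypothesis P3 : dL_rule U L a.
Hypothesis Ha : hol1 U a.
Variables (om ka : C) (p0 : C).
Hypothesis Hp0 : U p0.
Hypothesis Ea : forall z, U z -> ((z - om) ^ 3 * a z = ka)%C.
Hypothesis Eb : forall z, U z -> (b z + Cconj om * a z = 0)%C.

Local Lemma Fzz_shift z : U z -> (Cconj z * a z + b z = Cconj (z - om) * a z)%C.
Proof.
move=> Hz; rewrite Cminus_conj (_ : (Cconj z * a z + b z)%C = ((Cconj z - Cconj om) * a z + (b z + Cconj om * a z))%C); last by cring.
by rewrite Eb //; cring.
Qed.

(** With a = b = 0 the rules integrate in turn: L is a constant A, F_z = A conj z + c, and F = A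
    |z|^2 + 2 Re (c z) + e. *)
Lemma special_form_zero : ka = 0%C -> special_form_on U F.
Proof.
move=> k0.
have a0 : forall z, U z -> a z = 0%C.
  by apply: (hol1_cancel_pow U om 3 HU a Ha) => z Hz; rewrite Ea.
have S1 : forall z, U z -> L z = L p0.
  move=> z Hz; apply: (constant_on_region U HU L p0 z conn) => // g t d Hg Hd.
  by apply: is_derive_eq; [exact: P3 Hg Hd|rewrite a0 // /Re /=; ring].
pose A := L p0.
pose c := (Fz p0 - RtoC A * Cconj p0)%C.
have S2 : forall z, U z -> Fz z = (RtoC A * Cconj z + c)%C.
  move=> z Hz; apply: Csub_eq0.
  rewrite (_ : (Fz z - (RtoC A * Cconj z + c))%C = ((Fz z - RtoC A * Cconj z) - (Fz p0 - RtoC A * Cconj p0))%C); last by rewrite /c; cring.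
  rewrite (constant_on_region_C U HU (fun z => Fz z - RtoC A * Cconj z)%C p0 z conn) //; first by cring.
  move=> g t d Hg Hd; apply: rcd_eq.
    by apply: rcd_minus; [exact: P2 Hg Hd|apply: rcd_scal; apply: rcd_conj; exact: Hd].
  by rewrite Fzz_shift // a0 // S1 // -/A; cring.
pose G z := A * (Re z * Re z + Im z * Im z) + 2 * Re (c * z)%C.
pose e := F (Re p0) (Im p0) - G p0.
have S3 : forall z, U z -> F (Re z) (Im z) = G z + e.
  move=> z Hz; suff : F (Re z) (Im z) - G z = F (Re p0) (Im p0) - G p0 by rewrite /e; lra.
  apply: (constant_on_region U HU (fun z => F (Re z) (Im z) - G z) p0 z conn) => // g t d Hg Hd.
  have [G1 G2] := Hd.
  have [C1 _] := rcd_scal c g t d Hd.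
  apply: is_derive_eq.
    apply: (is_derive_minus (fun s => F (Re (g s)) (Im (g s))) (fun s => G (g s))); first exact: P1 Hg Hd.
    apply: (is_derive_plus (fun s => A * (Re (g s) * Re (g s) + Im (g s) * Im (g s))) (fun s => 2 * Re (c * g s)%C)).
      apply: is_derive_scal; apply: (is_derive_plus (fun s => Re (g s) * Re (g s)) (fun s => Im (g s) * Im (g s))).
        by apply: is_derive_mult; [exact: G1|exact: G1|exact: Rmult_comm].
      by apply: is_derive_mult; [exact: G2|exact: G2|exact: Rmult_comm].
    by apply: is_derive_scal; exact: C1.
  rewrite S2 // /Hierarchy.minus /Hierarchy.plus /Hierarchy.opp /Hierarchy.mult /=; case: (g t) => x y; case: (d) => d1 d2; case: (c) => c1 c2.
  by rewrite /Re /Im /=; ring.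
exists 0, 0, 0, 0, A, 0, 0, 0, (fun x y => 2 * Re c * x + - (2 * Im c) * y + e); split.
  by exists (2 * Re c), (- (2 * Im c)), e.
move=> x y Hxy _; have := S3 (x, y) Hxy; rewrite /G /special_biharmonic.
rewrite (_ : 0 * (x - 0) ^ 2 + 0 * (x - 0) * (y - 0) + 0 * (y - 0) ^ 2 = 0); last by ring.
by rewrite /Re /Im /= /Rdiv Rmult_0_l => ->; ring.
Qed.

(** A nonzero ka keeps om outside U, so all divisions by z - om are legitimate and the primitives
    are single valued on U. *)
Lemma special_form_nonzero : ka <> 0%C -> special_form_on U F.
Proof.
move=> k0.
have z0 : forall z, U z -> (z - om)%C <> 0%C.
  by move=> z Hz E; apply: k0; rewrite -(Ea z Hz) E /=; cring.
have az : forall z, U z -> a z = (ka / ((z - om) * (z - om) * (z - om)))%C.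
  by move=> z Hz; have N := z0 z Hz; rewrite -(Ea z Hz) /=; field.
have zc : forall z, U z -> Cconj (z - om) <> 0%C.
  move=> z Hz E; apply: (z0 z Hz); rewrite -(Cconj_conj (z - om)%C) E; apply: C_eq; rewrite /Re /Im /=; ring.
have Dz : forall g t d, rcd g t d -> rcd (fun s => g s - om)%C t d.
  by move=> g t d H; apply: rcd_eq; [apply: rcd_minus; [exact: H|exact: rcd_const]|cring].
have Dq : forall g t d, U (g t) -> rcd g t d -> rcd (fun s => ka * / ((g s - om) * (g s - om)))%C t
   (- (2 * ka * d / ((g t - om) * (g t - om) * (g t - om))))%C.
  move=> g t d Hg Hd; have N := z0 _ Hg; apply: rcd_eq.
    apply: rcd_scal; apply: rcd_inv; first by apply: rcd_mult; exact: Dz Hd.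
    by case/Cmult_integral.
  by cfield.
(* Since phi' = - 2 a, the sum L + Re phi is constant. *)
pose phi z := (ka * / ((z - om) * (z - om)))%C.
pose A := L p0 + Re (phi p0).
have S1 : forall z, U z -> L z = A - Re (phi z).
  move=> z Hz; suff : L z + Re (phi z) = A by lra.
  apply: (constant_on_region U HU (fun z => L z + Re (phi z)) p0 z conn) => // g t d Hg Hd.
  apply: is_derive_eq.
    by apply: (is_derive_plus (fun s => L (g s)) (fun s => Re (phi (g s)))); [exact: P3 Hg Hd|exact: (proj1 (Dq g t d Hg Hd))].
  rewrite az // (_ : forall u v : R, Hierarchy.plus u v = u + v) //.
  rewrite (_ : (ka / ((g t - om) * (g t - om) * (g t - om)) * d)%C = (ka * d / ((g t - om) * (g t - om) * (g t - om)))%C); last first.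
    by have N := z0 _ Hg; field.
  rewrite (_ : (2 * ka * d / ((g t - om) * (g t - om) * (g t - om)))%C = (2 * (ka * d / ((g t - om) * (g t - om) * (g t - om))))%C); last first.
    by have N := z0 _ Hg; field.
  by move: (_ / _)%C => [w1 w2]; rewrite /Re /=; ring.
have Re_half : forall w : C, RtoC (Re w) = ((w + Cconj w) / 2)%C.
  move=> w; rewrite (_ : (w + Cconj w)%C = (RtoC (2 * Re w))%C); last by apply: C_eq; rewrite /Re /Im /=; ring.
  by rewrite RtoC_mult; field; apply: RtoC_neq0; lra.
have two : RtoC 2 <> 0%C by apply: RtoC_neq0; lra.
have conj2 : forall g t d, rcd g t d -> rcd (fun s => Cconj (g s - om))%C t (Cconj d).
  by move=> g t d Hd; apply: rcd_conj; exact: Dz Hd.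
(* A primitive of F_zz dz + L dw: its z-derivative is conj (z - om) * a, and its derivative in the
   conjugate variable is A - Re phi. *)
pose psi z := (RtoC A * Cconj (z - om) + (- (/ 2) * (Cconj (z - om) * phi z) + Cconj ka * / 2 * / Cconj (z - om)))%C.
pose c := (Fz p0 - psi p0)%C.
have S2 : forall z, U z -> Fz z = (psi z + c)%C.
  move=> z Hz; apply: Csub_eq0.
  rewrite (_ : (Fz z - (psi z + c))%C = ((Fz z - psi z) - (Fz p0 - psi p0))%C); last by rewrite /c; cring.
  rewrite (constant_on_region_C U HU (fun z => Fz z - psi z)%C p0 z conn) //; first by cring.
  move=> g t d Hg Hd; have N := z0 _ Hg; have Nc := zc _ Hg; apply: rcd_eq.
    apply: rcd_minus; first exact: P2 Hg Hd.
    apply: rcd_plus; first by apply: rcd_scal; exact: conj2 Hd.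
    apply: rcd_plus.
      by apply: rcd_scal; apply: rcd_mult; [exact: conj2 Hd|exact: Dq Hg Hd].
    by apply: rcd_scal; apply: rcd_inv; [exact: conj2 Hd|].
  rewrite Fzz_shift // az // S1 // RtoC_minus Re_half.
  have Ephi : Cconj (phi (g t)) = (Cconj ka / (Cconj (g t - om) * Cconj (g t - om)))%C.
    rewrite /phi Cmult_conj Cinv_conj ?Cmult_conj //; by case/Cmult_integral.
  by rewrite Ephi /phi; cfield; do ! split.
pose G z := A * (Re (z - om)%C * Re (z - om)%C + Im (z - om)%C * Im (z - om)%C) + (Re (ka * Cconj (z - om) * / (z - om))%C + 2 * Re (c * (z - om))%C).
pose e := F (Re p0) (Im p0) - G p0.
have S3 : forall z, U z -> F (Re z) (Im z) = G z + e.
  move=> z Hz; suff : F (Re z) (Im z) - G z = F (Re p0) (Im p0) - G p0 by rewrite /e; lra.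
  apply: (constant_on_region U HU (fun z => F (Re z) (Im z) - G z) p0 z conn) => // g t d Hg Hd.
  have N := z0 _ Hg; have Nc := zc _ Hg.
  have [G1 G2] := Dz _ _ _ Hd.
  have [C1 _] := rcd_scal c _ t d (Dz _ _ _ Hd).
  have DG : rcd (fun s => ka * Cconj (g s - om) * / (g s - om))%C t
     (ka * Cconj d * / (g t - om) + ka * Cconj (g t - om) * (- d / ((g t - om) * (g t - om))))%C.
    by apply: rcd_mult; [apply: rcd_scal; exact: conj2 Hd|apply: rcd_inv; [exact: Dz Hd|]].
  apply: is_derive_eq.
    apply: (is_derive_minus (fun s => F (Re (g s)) (Im (g s))) (fun s => G (g s))); first exact: P1 Hg Hd.
    apply: (is_derive_plus (fun s => A * (Re (g s - om)%C * Re (g s - om)%C + Im (g s - om)%C * Im (g s - om)%C)) (fun s => Re (ka * Cconj (g s - om) * / (g s - om))%C + 2 * Re (c * (g s - om))%C)).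
      apply: is_derive_scal; apply: (is_derive_plus (fun s => Re (g s - om)%C * Re (g s - om)%C) (fun s => Im (g s - om)%C * Im (g s - om)%C)).
        by apply: is_derive_mult; [exact: G1|exact: G1|exact: Rmult_comm].
      by apply: is_derive_mult; [exact: G2|exact: G2|exact: Rmult_comm].
    apply: (is_derive_plus (fun s => Re (ka * Cconj (g s - om) * / (g s - om))%C) (fun s => 2 * Re (c * (g s - om))%C)).
      exact: (proj1 DG).
    by apply: is_derive_scal; exact: C1.
  rewrite S2 //.
  have key : Re (psi (g t) * d)%C * 2 = 2 * A * (Re (g t - om)%C * Re d + Im (g t - om)%C * Im d)
     + Re (ka * Cconj d * / (g t - om) + ka * Cconj (g t - om) * (- d / ((g t - om) * (g t - om))))%C.
    have Re_conj : forall w : C, Re (Cconj w) = Re w by [].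
    have -> : (ka * Cconj d * / (g t - om) + ka * Cconj (g t - om) * (- d / ((g t - om) * (g t - om))) =
      ka * Cconj d * / (g t - om) - ka * Cconj (g t - om) * d / ((g t - om) * (g t - om)))%C by field.
    have -> : (psi (g t) * d)%C = (RtoC A * (Cconj (g t - om) * d) + RtoC (/ 2) * (Cconj (ka * Cconj d * / (g t - om)) - ka * Cconj (g t - om) * d / ((g t - om) * (g t - om))))%C.
      rewrite /psi /phi (Cmult_conj (ka * Cconj d)%C) (Cmult_conj ka) Cconj_conj Cinv_conj // RtoC_inv; last lra.
      by field; do ! split.
    move: (ka * Cconj d * / (g t - om))%C (ka * Cconj (g t - om) * d / ((g t - om) * (g t - om)))%C => [x1 x2] [y1 y2].
    by move: (g t - om)%C (d) => [w1 w2] [d1 d2]; rewrite /Re /Im /=; field.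
  move: key; move: (Re (ka * Cconj d * / (g t - om) + _)%C) => X key.
  have E1 : Re ((psi (g t) + c) * d)%C = Re (psi (g t) * d)%C + Re (c * d)%C by rewrite /Re /=; ring.
  match goal with |- ?lhs = _ => change (2 * Re ((psi (g t) + c) * d)%C + - (A * ((Re d * Re (g t - om)%C + Re (g t - om)%C * Re d) + (Im d * Im (g t - om)%C + Im (g t - om)%C * Im d)) + (X + 2 * Re (c * d)%C)) = 0) end.
  by rewrite E1; lra.
(* For v = z - om the term Re (ka conj v / v) equals Re (ka (conj v)^2) / |v|^2, whose numerator has
   these coefficients. *)
exists (Re om), (Im om), (Re om), (Im om), A, (Re ka), (2 * Im ka), (- Re ka),
  (fun x y => 2 * Re c * x + - (2 * Im c) * y + (e - 2 * Re c * Re om + 2 * Im c * Im om)); split.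
  by exists (2 * Re c), (- (2 * Im c)), (e - 2 * Re c * Re om + 2 * Im c * Im om).
move=> x y Hxy _; have := S3 (x, y) Hxy; rewrite /G /special_biharmonic => K.
have N := Cnz_norm _ (z0 _ Hxy).
have E : Re (ka * Cconj ((x, y) - om) * / ((x, y) - om))%C =
  (Re ka * (x - Re om) ^ 2 + 2 * Im ka * (x - Re om) * (y - Im om) + - Re ka * (y - Im om) ^ 2) / ((x - Re om) ^ 2 + (y - Im om) ^ 2).
  move: N; case: (ka) => k1 k2; case: (om) => o1 o2; rewrite /Re /Im /= => N.
  by field; move: N; rewrite /Rminus !Rmult_1_r => N; exact: N.
rewrite E in K; move: K; rewrite {1}/Re {1}/Im /= => ->.
by rewrite /Re /Im /=; ring.
Qed.
End Integration.

(** * Proof of the theorem *)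

Lemma unit_circle_cis (x y : R) : x * x + y * y = 1 -> exists th, cis th = (x, y).
Proof.
move=> H.
have B : -1 <= x <= 1 by split; nra.
have C1 := cos_acos x B; have C2 := sin_acos x B.
have S : 1 - Rsqr x = Rsqr y by rewrite /Rsqr; lra.
rewrite S sqrt_Rsqr_abs in C2.
have [y0|y0] := Rle_dec 0 y.
  by exists (acos x); rewrite /cis C1 C2 Rabs_pos_eq.
exists (- acos x); rewrite /cis cos_neg sin_neg C1 C2 Rabs_left; last lra.
by rewrite Ropp_involutive.
Qed.

(** A parameter rectangle is needed so that one arc of angles stays in U for all nearby t; the
    interpolation nodes are taken on that arc. *)
Lemma circle_pt_rectangle (U : C -> Prop) (m : R -> C) (r : R -> R) th0 t0 s1 s2 : openU U -> U (circle_pt m r th0 t0) ->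
  s1 < t0 < s2 -> rcont m t0 -> continuous r t0 ->
  exists th1 th2 t1 t2, th1 < th2 /\ th2 - th1 < PI /\ s1 <= t1 /\ t1 < t0 < t2 /\ t2 <= s2 /\
    forall th t, th1 < th < th2 -> t1 < t < t2 -> U (circle_pt m r th t).
Proof.
move=> HU Uq Ht [M1 M2] Cr.
have [eps He] := HU _ Uq.
have lift (f : R -> R) : continuous f t0 -> continuous (fun p : R * R => f p.2) (th0, t0).
  by move=> Cf; apply: (continuous_comp snd f); [exact: continuous_snd|exact: Cf].
have trig (f g h : R -> R) : continuous f t0 -> continuous g t0 -> (forall x, continuous h x) ->
    continuous (fun p : R * R => f p.2 + g p.2 * h p.1) (th0, t0).
  move=> Cf Cg Ch; apply: (continuous_plus (fun p : R * R => f p.2) (fun p : R * R => g p.2 * h p.1)).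
    exact: lift.
  apply: (continuous_mult (fun p : R * R => g p.2) (fun p : R * R => h p.1)); first exact: lift.
  by apply: (continuous_comp fst h); [exact: continuous_fst|exact: Ch].
have K1 := trig _ _ cos M1 Cr continuous_cos.
have K2 := trig _ _ sin M2 Cr continuous_sin.
have q1 : Re (m t0) + r t0 * cos th0 = Re (circle_pt m r th0 t0) by rewrite /circle_pt /cis /Re /=; ring.
have q2 : Im (m t0) + r t0 * sin th0 = Im (circle_pt m r th0 t0) by rewrite /circle_pt /cis /Im /=; ring.
have B1 := K1 _ (locally_ball _ eps); have B2 := K2 _ (locally_ball _ eps).
have [d Hd] := @filter_and _ (locally ((th0, t0) : prod_UniformSpace R_UniformSpace R_UniformSpace)) _ _ _ B1 B2.
have d0 := cond_pos d; have P0 := PI_RGT_0.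
(* The cap 1 bounds the length of the arc by 2, which is less than PI. *)
exists (th0 - Rmin d 1), (th0 + Rmin d 1), (Rmax s1 (t0 - d)), (Rmin s2 (t0 + d)).
have E1 := Rmin_l d 1; have E2 := Rmin_r d 1; have E3 : 0 < Rmin d 1 by apply: Rmin_glb_lt; lra.
have A1 := Rmax_l s1 (t0 - d); have A2 := Rmax_r s1 (t0 - d).
have A3 := Rmin_l s2 (t0 + d); have A4 := Rmin_r s2 (t0 + d).
have A5 : Rmax s1 (t0 - d) < t0 by apply: Rmax_lub_lt; lra.
have A6 : t0 < Rmin s2 (t0 + d) by apply: Rmin_glb_lt; lra.
have PI3 := PI2_1; do ! split => //; try lra.
move=> th t Hth Htt; apply: He.
have [] := Hd (th, t).
  by split; rewrite /ball /= /AbsRing_ball /abs /Hierarchy.minus /Hierarchy.plus /Hierarchy.opp /=; apply: Rabs_def1; lra.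
rewrite /= q1 q2 => D1 D2; split.
  by move: D1; congr (ball _ _ _); rewrite /circle_pt /cis /Re /=; ring.
by move: D2; congr (ball _ _ _); rewrite /circle_pt /cis /Im /=; ring.
Qed.

Lemma poly_single_root (q : {poly RC}) om : q != 0%Ri -> (forall z, peval q z = 0%C -> z = om) ->
  exists (n : nat) (c : C), c <> 0%C /\ forall z, peval q z = (c * (z - om) ^ n)%C.
Proof.
move=> q0 H; have [s Es] := closed_field_poly_normal q.
exists (size s), (ofRC (lead_coef q)).
have l0 : lead_coef q != 0%Ri by rewrite lead_coef_eq0.
split.
  by move=> E; move/eqP: l0; apply; rewrite -(ofRCK (lead_coef q)) E.
have all_om : forall x, x \in s -> x = toRC om.
  move=> x xs; rewrite -(ofRCK x) (H (ofRC x)) //.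
  rewrite /peval ofRCK; suff /rootP -> : root q x by [].
  by rewrite Es rootZ // root_prod_XsubC.
move=> z; rewrite {1}Es /peval hornerZ ofRCM; congr Cmult.
rewrite horner_prod; elim: s all_om {Es} => [|x s IH] Hs; first by rewrite big_nil.
rewrite big_cons ofRCM IH; last by move=> y ys; apply: Hs; rewrite in_cons ys orbT.
rewrite (Hs x); last by rewrite in_cons eqxx.
by rewrite hornerXsubC ofRCD ofRCN !toRCK.
Qed.

(** Substituting conj z = conj m + conj u with u conj u = r^2 cancels the term - 3 u r^2 a and
    leaves u^2 times an expression holomorphic in z. *)
Lemma real_form_on_circle (U : C -> Prop) (F : R -> R -> R) (Fz a b : C -> C) (L : C -> R) (m : C) (r th1 th2 : R) :
  dF_rule U F Fz ->
  dFz_rule U Fz a b L ->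
  dL_rule U L a ->
  hol1 U a -> hol1 U b ->
  (forall th, th1 < th < th2 -> U (m + RtoC r * cis th)%C) ->
  (exists al be ga, forall th, th1 < th < th2 ->
    F (Re (m + RtoC r * cis th)%C) (Im (m + RtoC r * cis th)%C) = al * Re (m + RtoC r * cis th)%C + be * Im (m + RtoC r * cis th)%C + ga) ->
  forall th, th1 < th < th2 -> let u := (RtoC r * cis th)%C in let z := (m + u)%C in
  Im (u * u * (3 * (Cconj m * a z + b z) + (u * (Cconj m * Cd a z + Cd b z) + RtoC (r * r) * Cd a z)))%C = 0.
Proof.
move=> P1 P2 P3 Ha Hb HU [al [be [ga HF]]] th Hth u z.
have H : Im (3 * (u * u) * (Cconj z * a z + b z) + u * u * u * (Cconj z * Cd a z + Cd b z) - 3 * u * RtoC (r * r) * a z)%C = 0.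
  exact: (real_on_circle U F Fz a b L m r th1 th2 al be ga P1 P2 P3 Ha Hb HU HF th Hth).
apply: (eq_trans _ H); apply: (f_equal Im).
have E : (u * Cconj u)%C = RtoC (r * r).
  by apply: C_eq; have := sin2_cos2 th; rewrite /u /cis /Re /Im /Rsqr /= => S; [rewrite -(Rmult_1_r (r * r)) -S|]; ring.
have -> : Cconj z = (Cconj m + Cconj u)%C by rewrite /z; apply: C_eq; rewrite /Re /Im /=; ring.
rewrite -E; ring.
Qed.

Lemma polynomial_case_zero (U : C -> Prop) (a b : C -> C) (P Q : {poly RC}) (th1 th2 : R) (m m' : C) (r r' : R) :
  (forall z, U z -> a z = peval P z) -> (forall z, U z -> b z = peval Q z) -> openU U ->
  th1 < th2 -> th2 - th1 < PI -> 0 < r -> 0 < r' -> m <> m' ->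
  (forall th, th1 < th < th2 -> U (m + RtoC r * cis th)%C) ->
  (forall th, th1 < th < th2 -> U (m' + RtoC r' * cis th)%C) ->
  (forall th, th1 < th < th2 -> let u := (RtoC r * cis th)%C in let z := (m + u)%C in
  Im (u * u * (3 * (Cconj m * a z + b z) + (u * (Cconj m * Cd a z + Cd b z) + RtoC (r * r) * Cd a z)))%C = 0) ->
  (forall th, th1 < th < th2 -> let u := (RtoC r' * cis th)%C in let z := (m' + u)%C in
  Im (u * u * (3 * (Cconj m' * a z + b z) + (u * (Cconj m' * Cd a z + Cd b z) + RtoC (r' * r') * Cd a z)))%C = 0) ->
  P = 0%Ri /\ Q = 0%Ri.
Proof.
move=> Ea Eb HU Hth Hpi r0 r0' mm HUm HUm' K K'.
have der (h : C -> C) (A : {poly RC}) z : (forall z, U z -> h z = peval A z) -> U z -> Cd h z = peval A^`() z.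
  move=> E Hz; apply: Cd_correct; have [rho [rho0 Hrho]] := open_disc U z HU Hz.
  apply: (cdiff_ext_disc (peval A) h z _ rho rho0) => [w Hw|]; first by rewrite E //; exact: Hrho.
  exact: cdiff_peval.
have form (m0 : C) (r1 th : R) : let u := (RtoC r1 * cis th)%C in let z := (m0 + u)%C in U z ->
    peval (poly_real_form m0 r1 P Q) z = (3 * (Cconj m0 * a z + b z) + (u * (Cconj m0 * Cd a z + Cd b z) + RtoC (r1 * r1) * Cd a z))%C.
  move=> u z Hz; rewrite (der a P) // (der b Q) // Ea // Eb // /poly_real_form.
  rewrite !(pevalMn, pevalD, pevalM, pevalN, pevalX, pevalZ, derivD, derivZ).
  rewrite (_ : RtoC (INR 3) = 3%C); last by congr RtoC; rewrite /=; ring.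
  have -> : u = (z - m0)%C by rewrite /z; cring.
  by move: (peval P z) (peval Q z) (peval P^`()%Ri z) (peval Q^`()%Ri z) (RtoC (r1 * r1)) (Cconj m0) => *; ring.
apply: (polynomial_case th1 th2 P Q Hth Hpi m m' r r' r0 r0' mm) => th Hh.
  by rewrite form; [exact: K|exact: HUm].
by rewrite form; [exact: K'|exact: HUm'].
Qed.

Lemma cpoly_shift (P : {poly RC}) (c om z : C) :
  peval (toRC c *: (P \Po ('X + (toRC om)%:P)))%Ri (z - om)%C = (c * peval P z)%C.
Proof. by rewrite pevalZ peval_comp pevalD pevalX pevalC; congr (_ * peval _ _)%C; cring. Qed.

(** Moving om to the origin replaces b by b + conj om * a, because conj z * a + b = conj (z - om) *
    a + (b + conj om * a). The circles then pass through 0 and [laurent_coefs_vanish] applies. *)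
Lemma pole_case (U : C -> Prop) (a b : C -> C) (P Q : {poly RC}) (om : C) (n : nat) (th1 th2 t1 t2 : R) (m m1 m2 : R -> C) (r : R -> R) :
  openU U -> hol1 U a -> hol1 U b ->
  (forall z, U z -> ((z - om) ^ n * a z)%C = peval P (z - om)%C) ->
  (forall z, U z -> ((z - om) ^ n * (b z + Cconj om * a z))%C = peval Q (z - om)%C) ->
  th1 < th2 -> th2 - th1 < PI -> t1 < t2 ->
  (forall t, t1 < t < t2 -> rcd m t (m1 t)) -> (forall t, t1 < t < t2 -> rcd m1 t (m2 t)) ->
  (forall t, t1 < t < t2 -> 0 < r t) ->
  (forall t, t1 < t < t2 -> ((m t - om) * Cconj (m t - om))%C = RtoC (r t * r t)) ->
  (forall s1 s2 al be de : R, t1 <= s1 < s2 -> s2 <= t2 ->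
    (forall t, s1 < t < s2 -> al * Re (m t - om)%C + be * Im (m t - om)%C + de = 0) -> al = 0 /\ be = 0 /\ de = 0) ->
  (forall th t, th1 < th < th2 -> t1 < t < t2 -> U (circle_pt m r th t)) ->
  (forall th t, th1 < th < th2 -> t1 < t < t2 -> let u := (RtoC (r t) * cis th)%C in let z := (m t + u)%C in
  Im (u * u * (3 * (Cconj (m t) * a z + b z) + (u * (Cconj (m t) * Cd a z + Cd b z) + RtoC (r t * r t) * Cd a z)))%C = 0) ->
  exists ka : C, (forall z, U z -> ((z - om) ^ 3 * a z)%C = ka) /\ forall z, U z -> (b z + Cconj om * a z)%C = 0%C.
Proof.
move=> HU Ha Hb Ea Eb Hth Hpi Ht Hm Hm1 r0 Hmr LI HUpt HK.
pose bh z := (b z + Cconj om * a z)%C.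
have Hbh : hol1 U bh by apply: hol1_plus => //; apply: hol1_mult => //; exact: hol1_const.
have Da := deriv_quotient U om n a P HU Ha Ea.
have Db := deriv_quotient U om n bh Q HU Hbh Eb.
have Cbh z : U z -> Cd bh z = (Cd b z + Cconj om * Cd a z)%C.
  move=> Hz; apply: Cd_correct; have [D1 _] := Ha z Hz; have [D2 _] := Hb z Hz.
  apply: cdiff_eq; first by apply: cdiff_plus; [exact: D2|apply: cdiff_mult; [exact: cdiff_const|exact: D1]].
  by cring.
have [HP HQ] : (forall i, (i + 3)%N <> n -> (P`_i = 0)%Ri) /\ forall i, (Q`_i = 0)%Ri.
  apply: (laurent_coefs_vanish th1 th2 t1 t2 (fun t => m t - om)%C m1 m2 r n P Q) => //.
    move=> t Htt; apply: rcd_eq; first by apply: rcd_minus; [exact: (Hm t Htt)|exact: rcd_const].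
    by cring.
  move=> t th Htt Hh; have Hz := HUpt th t Hh Htt; have K0 := HK th t Hh Htt.
  rewrite /circle_pt in Hz; move: Hz K0.
  set u := (RtoC (r t) * cis th)%C; set z := (m t + u)%C => Hz /= K0.
  exists (u * u * (3 * (Cconj (m t) * a z + b z) + (u * (Cconj (m t) * Cd a z + Cd b z) + RtoC (r t * r t) * Cd a z)))%C.
  split; first exact: K0.
  have Ez : (m t - om + u)%C = (z - om)%C by rewrite /z; cring.
  have Eu : u = ((z - om) - (m t - om))%C by rewrite /z; cring.
  have Em : Cconj (m t) = (Cconj (m t - om) + Cconj om)%C by apply: C_eq; rewrite /Re /Im /=; ring.
  have H1 := Ea z Hz; have H2 := Eb z Hz; have H3 := Da z Hz; have H4 := Db z Hz.
  rewrite Cbh // in H4.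
  rewrite Ez /laurent_poly; move: (euler n P) (euler n Q) H3 H4 => eP eQ H3 H4.
  rewrite !(pevalMn, pevalD, pevalM, pevalN, pevalX, pevalZ).
  rewrite -H1 -H2 -H3 -H4 -Hmr // Em (_ : RtoC (INR 3) = 3%C); last by congr RtoC; rewrite /=; ring.
  rewrite !CpowS; move: ((z - om) ^ n)%C => Z.
  move: (a z) (b z) (Cd a z) (Cd b z) (Cconj om) (Cconj (m t - om)%C) => A B A' B' co cm.
  by rewrite Eu; move: (z - om)%C (m t - om)%C => *; cring.
have Q0 : Q = 0%Ri by apply/polyP => i; rewrite coef0.
have Zb z : U z -> bh z = 0%C.
  by apply: (hol1_cancel_pow U om n HU bh Hbh) => w Hw; rewrite Eb // Q0 peval0.
(* For n < 3 the exceptional index n - 3 does not exist, so P = 0 and ka = 0. *)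
have [Hn|Hn] := leqP 3 n; last first.
  have P0 : P = 0%Ri by apply/polyP => i; rewrite coef0 HP //; lia.
  exists 0%C; split => // z Hz.
  by rewrite (hol1_cancel_pow U om n HU a Ha _ z Hz) => [|w Hw]; [cring|rewrite Ea // P0 peval0].
have EP : P = ((P`_(n - 3)) *: 'X^(n - 3))%Ri.
  apply/polyP => i; rewrite coefZ coefXn; case: eqP => [->|N]; first by rewrite mulr1.
  by rewrite mulr0 HP //; lia.
exists (cf P (n - 3)); split => // z Hz; apply: Csub_eq0.
pose A : {poly RC} := (('X - (toRC om)%:P) ^+ 3)%Ri.
have EA w : peval A w = ((w - om) ^ 3)%C by rewrite pevalXn pevalD pevalN pevalX pevalC.
pose h w := (peval A w * a w + - cf P (n - 3))%C.
rewrite -(EA z); change (h z = 0%C); apply: (hol1_cancel_pow U om (n - 3) HU h) => // [|w Hw].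
  by apply: hol1_plus => //; [apply: hol1_mult => //; exact: peval_hol1|exact: hol1_const].
rewrite /h EA; have := Ea w Hw; rewrite {1}EP -{1}(subnK Hn) -(ofRCK (P`_(n - 3))%Ri) pevalZ -/(cf P (n - 3)) pevalXn pevalX Cpow_add.
move: ((w - om) ^ (n - 3))%C ((w - om) ^ 3)%C => X Y E.
by rewrite (_ : (X * (Y * a w + - cf P (n - 3)))%C = (X * Y * a w - cf P (n - 3) * X)%C); [rewrite E|]; cring.
Qed.

Lemma pencil_or_special_form :
  forall (U : R * R -> Prop) (F : R -> R -> R) (a b c : R -> R),
    region U ->
    biharmonic_on U F ->
    analytic_on unit_interval a ->
    analytic_on unit_interval b ->
    analytic_on unit_interval c ->
    (forall t, unit_interval t -> Defs.proper (circle (a t) (b t) (c t))) ->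
    (forall t, unit_interval t ->
       exists x y, U (x, y) /\ on_cl (circle (a t) (b t) (c t)) x y) ->
    (forall t, unit_interval t ->
       exists l : R -> R -> R, linear_function l /\
         forall x y, U (x, y) -> on_cl (circle (a t) (b t) (c t)) x y ->
           F x y = l x y) ->
    pencil_on unit_interval (fun t => circle (a t) (b t) (c t)) \/
    special_form_on U F.
Proof.
move=> U F a b c [HU conn] HF Aa Ab Ac HS Hmeet Hlin.
case: (classic (pencil_on unit_interval (fun t => circle (a t) (b t) (c t)))) => NPen; [by left|right].
pose relI a1 b1 c1 d1 := forall t, unit_interval t -> a1 * a t + b1 * b t + c1 * c t + d1 = 0.
have NP : forall a1 b1 c1 d1 a2 b2 c2 d2, lin_indep4 a1 b1 c1 d1 a2 b2 c2 d2 ->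
    relI a1 b1 c1 d1 -> relI a2 b2 c2 d2 -> False.
  move=> a1 b1 c1 d1 a2 b2 c2 d2 I R1 R2; apply: NPen.
  exact: pencil_of_relations I HS R1 R2.
have AE : forall s1 s2 a1 b1 c1 d1, 0 <= s1 < s2 -> s2 <= 1 ->
    (forall t, s1 < t < s2 -> a1 * a t + b1 * b t + c1 * c t + d1 = 0) -> relI a1 b1 c1 d1.
  move=> s1 s2 a1 b1 c1 d1 Hs1 Hs2 H; apply: (analytic_identity _ s1 s2 _ Hs1 Hs2 H).
  apply: analytic_plus; last exact: analytic_const.
  by apply: analytic_plus; [apply: analytic_plus|]; apply: analytic_scal.
pose rad t := (a t * a t + b t * b t) / 4 - c t.
have rad0 t : unit_interval t -> 0 < rad t.
  by move=> Ht; have := HS t Ht; rewrite /Defs.proper /circle /rad /=; lra.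
pose m t : C := (- a t / 2, - b t / 2).
pose r t := sqrt (rad t).
have Er : forall t, unit_interval t -> r t * r t = (a t * a t + b t * b t) / 4 - c t.
  by move=> t Ht; rewrite /r sqrt_sqrt //; have := rad0 t Ht; lra.
have Em : forall t, m t = (- a t / 2, - b t / 2) by [].
have inI t : 0 < t < 1 -> unit_interval t by rewrite /unit_interval; lra.
have r0 t : 0 < t < 1 -> 0 < r t by move=> Ht; apply: sqrt_lt_R0; apply: rad0; exact: inI.
pose m1 t : C := (- Derive a t / 2, - Derive b t / 2).
pose m2 t : C := (- Derive (Derive a) t / 2, - Derive (Derive b) t / 2).
pose r1 t := ((2 * a t * Derive a t + 2 * b t * Derive b t) / 4 - Derive c t) / (2 * r t).
pose r2 t := Derive r1 t.
have eta (f : R -> R) t : Derive (fun x => f x) t = Derive f t by [].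
have dhalf (f : R -> R) t : ex_derive f t -> is_derive (fun s => - f s / 2) t (- Derive f t / 2).
  by move=> E; auto_derive => //; rewrite eta; field.
have Hm : forall t, 0 < t < 1 -> rcd m t (m1 t).
  move=> t Ht; have [Da _] := analytic_derivable a t Aa Ht; have [Db _] := analytic_derivable b t Ab Ht.
  by split; apply: dhalf.
have Hm1 : forall t, 0 < t < 1 -> rcd m1 t (m2 t).
  move=> t Ht; have [_ Da] := analytic_derivable a t Aa Ht; have [_ Db] := analytic_derivable b t Ab Ht.
  by split; apply: dhalf.
have Hr : forall t, 0 < t < 1 -> is_derive r t (r1 t).
  move=> t Ht; have [Da _] := analytic_derivable a t Aa Ht; have [Db _] := analytic_derivable b t Ab Ht.
  have [Dc _] := analytic_derivable c t Ac Ht; have rt := r0 t Ht; have R0 := rad0 t (inI t Ht).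
  rewrite /r1; move: rt R0; rewrite /r /rad => rt R0.
  auto_derive; first by do ! split => //; lra.
  rewrite !eta (_ : (a t * a t + b t * b t) * / 4 + - c t = (a t * a t + b t * b t) / 4 - c t); last by field.
  by field; lra.
have Hr1 : forall t, 0 < t < 1 -> is_derive r1 t (r2 t).
  move=> t Ht; apply: Derive_correct.
  have [Da Da2] := analytic_derivable a t Aa Ht; have [Db Db2] := analytic_derivable b t Ab Ht.
  have [Dc Dc2] := analytic_derivable c t Ac Ht; have rt := r0 t Ht.
  have Dr : ex_derive r t by exists (r1 t); exact: Hr.
  by rewrite /r1; auto_derive; do ! split => //; lra.
have NC s1 s2 (om : C) : 0 <= s1 < s2 -> s2 <= 1 -> (forall t, s1 < t < s2 -> m t = om) -> False.
  exact: (centre_not_constant a b c m NP AE Em s1 s2 om).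
(* A centre that never moves would give a pencil; so some circle has a moving centre, and its S is
   not the zero polynomial. *)
have [t0 [Ht0 m10]] : exists t0, 0 < t0 < 1 /\ m1 t0 <> 0%C.
  apply: NNPP => N; apply: (NC 0 1 (m (1 / 2))); try lra.
  move=> t Ht; apply: (rcd0_const m 0 1) => //; last lra.
  move=> s Hs; have E : m1 s = 0%C by apply: NNPP => E; apply: N; exists s.
  by rewrite -E; exact: Hm.
have on_circle th t : unit_interval t -> on_cl (circle (a t) (b t) (c t)) (Re (circle_pt m r th t)) (Im (circle_pt m r th t)).
  move=> Ht; have E := Er t Ht; have S := sin2_cos2 th; rewrite /Rsqr in S.
  rewrite /on_cl /circle /circle_pt /m /cis /Re /Im /=.
  have -> : c t = (a t * a t + b t * b t) / 4 - r t * r t * (sin th * sin th + cos th * cos th) by rewrite S; lra.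
  by field.
have [x0 [y0 [Uxy Sxy]]] := Hmeet t0 (inI t0 Ht0).
have [th0 Hth0] : exists th0, circle_pt m r th0 t0 = (x0, y0).
  have rt := r0 t0 Ht0; have E := Er t0 (inI t0 Ht0).
  have S : (x0 + a t0 / 2) * (x0 + a t0 / 2) + (y0 + b t0 / 2) * (y0 + b t0 / 2) = r t0 * r t0.
    by move: Sxy; rewrite E /on_cl /circle /=; lra.
  have [|th Hth] := unit_circle_cis ((x0 + a t0 / 2) / r t0) ((y0 + b t0 / 2) / r t0).
    rewrite (_ : _ + _ = ((x0 + a t0 / 2) * (x0 + a t0 / 2) + (y0 + b t0 / 2) * (y0 + b t0 / 2)) / (r t0 * r t0)); last by field; lra.
    by rewrite S; field; lra.
  by exists th; rewrite /circle_pt Hth /m; apply: C_eq; rewrite /Re /Im /=; field; lra.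
have [th1 [th2 [t1 [t2 [Hth [Hpi [H1 [Htt [H2 HUpt]]]]]]]]] := circle_pt_rectangle U m r th0 t0 0 1 HU
  ltac:(by rewrite Hth0) Ht0 (rcd_rcont _ _ _ (Hm t0 Ht0)) (ex_derive_continuous _ _ (ex_intro _ _ (Hr t0 Ht0))).
have Ht12 : t1 < t2 by lra.
have sub t : t1 < t < t2 -> 0 < t < 1 by lra.
have HL : forall t, t1 < t < t2 -> exists al be ga, forall th, th1 < th < th2 ->
    F (Re (circle_pt m r th t)) (Im (circle_pt m r th t)) = al * Re (circle_pt m r th t) + be * Im (circle_pt m r th t) + ga.
  move=> t Ht; have It := inI t (sub t Ht); have [l [[al [be [ga El]]] Hl]] := Hlin t It.
  exists al, be, ga => th Hh; rewrite Hl ?El //; last exact: on_circle.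
  by have := HUpt th t Hh Ht; case: (circle_pt m r th t).
have [Fz [A [B [L [P1 [P2 [P3 [HA HB]]]]]]]] := biharmonic_wirtinger U HU F HF.
have Hm' t : t1 < t < t2 -> rcd m t (m1 t) by move/sub; exact: Hm.
have Hm1' t : t1 < t < t2 -> rcd m1 t (m2 t) by move/sub; exact: Hm1.
have Hr' t : t1 < t < t2 -> is_derive r t (r1 t) by move/sub; exact: Hr.
have Hr1' t : t1 < t < t2 -> is_derive r1 t (r2 t) by move/sub; exact: Hr1.
have r0' t : t1 < t < t2 -> 0 < r t by move/sub; exact: r0.
have [G2 G3] := inG_second_third th1 th2 t1 t2 m m1 m2 r r1 r2 Hth Hpi Hm' Hm1' Hr' Hr1' r0' U F Fz A B L P1 P2 HA HB HUpt HL.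
have [q [p1 [p2 [q0 [Eq [cop alt]]]]]] := rational_second th1 th2 t1 t2 m m1 r r1 Hth Hpi r0' U HU conn A B HA HB HUpt G2 G3
  (ex_intro _ t0 (conj Htt (or_introl m10))).
(* Each root of q lies on all the circles; as two such points would give a pencil, q has at most one
   root. *)
have root_common om : peval q om = 0%C -> relI (Re om) (Im om) 1 (Re om * Re om + Im om * Im om).
  move=> Hom; have [s1 [s2 [Hs1 [Hs2 [K|[W K]]]]]] := pole_alternative t1 t2 m m1 m2 r r1 r2 Hm' Hm1' Hr' Hr1' om _ _ Ht12 (cop om Hom) (fun t => alt om t Hom).
    by case: (NC s1 s2 om); try lra.
  by apply: (reflection_point_on_circles a b c m r NP AE Em Er s1 s2 om W); try lra.
have form th t : th1 < th < th2 -> t1 < t < t2 -> let u := (RtoC (r t) * cis th)%C in let z := (m t + u)%C in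
    Im (u * u * (3 * (Cconj (m t) * A z + B z) + (u * (Cconj (m t) * Cd A z + Cd B z) + RtoC (r t * r t) * Cd A z)))%C = 0.
  move=> Hh Ht; apply: (real_form_on_circle U F Fz A B L (m t) (r t) th1 th2 P1 P2 P3 HA HB _ (HL t Ht) th Hh).
  by move=> th' Hh'; exact: HUpt.
(* If q has no root, om = 0 is a dummy value and n = 0 below. *)
have [om Hom] : exists om, forall z, peval q z = 0%C -> z = om.
  have [[om Hom]|N] := classic (exists om, peval q om = 0%C); last by exists 0%C => z Hz; case: N; exists z.
  by exists om => z Hz; apply: (common_point_unique a b c NP); exact: root_common.
have [n [k [k0 Ek]]] := poly_single_root q om q0 Hom.
have scale z : U z -> ((z - om) ^ n * A z)%C = (/ k * peval p1 z)%C /\ ((z - om) ^ n * B z)%C = (/ k * peval p2 z)%C.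
  by move=> Hz; have [<- <-] := Eq z Hz; rewrite Ek; split; field.
suff [ka [Ea Eb]] : exists ka : C, (forall z, U z -> ((z - om) ^ 3 * A z)%C = ka) /\ forall z, U z -> (B z + Cconj om * A z)%C = 0%C.
  have Hp : U (circle_pt m r th0 t0) by rewrite Hth0.
  have [E|E] := classic (ka = 0%C).
    exact: (special_form_zero U F Fz A B L HU conn P1 P2 P3 HA om ka _ Hp Ea Eb E).
  exact: (special_form_nonzero U F Fz A B L HU conn P1 P2 P3 om ka _ Hp Ea Eb E).
case: n Ek scale => [|n] Ek scale.
  (* Without poles a and b are polynomials, and two circles with different centres already force
     both to vanish. *)
  have [t' [Ht' mm]] : exists t', t1 < t' < t2 /\ m t0 <> m t'.
    apply: NNPP => N; apply: (NC t1 t2 (m t0)); try lra.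
    by move=> t Ht; apply: NNPP => E; apply: N; exists t; split => // E'; apply: E.
  have [Z1 Z2] : (toRC (/ k)%C *: p1 = 0 /\ toRC (/ k)%C *: p2 = 0)%Ri.
    apply: (polynomial_case_zero U A B _ _ th1 th2 (m t0) (m t') (r t0) (r t')) => //.
    - by move=> z Hz; rewrite pevalZ -(proj1 (scale z Hz)); cring.
    - by move=> z Hz; rewrite pevalZ -(proj2 (scale z Hz)); cring.
    - exact: r0'.
    - exact: r0'.
    - by move=> th Hh; exact: HUpt.
    - by move=> th Hh; exact: HUpt.
    - by move=> th Hh; exact: form.
    - by move=> th Hh; exact: form.
  have A0 z : U z -> A z = 0%C.
    by move=> Hz; have [+ _] := scale z Hz; rewrite -pevalZ Z1 peval0 => <-; cring.
  have B0 z : U z -> B z = 0%C.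
    by move=> Hz; have [_ +] := scale z Hz; rewrite -pevalZ Z2 peval0 => <-; cring.
  by exists 0%C; split => z Hz; rewrite A0 // ?B0 //; cring.
have Rom : relI (Re om) (Im om) 1 (Re om * Re om + Im om * Im om).
  by apply: root_common; rewrite Ek CpowS; cring.
(* The numerators as polynomials in z - om, divided by the leading coefficient k of q. *)
pose P : {poly RC} := (toRC (/ k)%C *: (p1 \Po ('X + (toRC om)%:P)))%Ri.
pose Q : {poly RC} := (toRC (/ k)%C *: (p2 \Po ('X + (toRC om)%:P)))%Ri.
apply: (pole_case U A B P (Q + toRC (Cconj om) *: P)%Ri om n.+1 th1 th2 t1 t2 m m1 m2 r) => //.
- by move=> z Hz; rewrite cpoly_shift (proj1 (scale z Hz)).
- move=> z Hz; rewrite pevalD pevalZ !cpoly_shift -(proj1 (scale z Hz)) -(proj2 (scale z Hz)); cring.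
- move=> t Ht; have It := inI t (sub t Ht); rewrite (Er t It); have := Rom t It.
  by move=> E; rewrite /m; apply: C_eq; move: E; rewrite /Re /Im /=; lra.
- move=> s1 s2 al be de Hs1 Hs2; apply: (centre_affine_indep a b c m NP AE Em om s1 s2 al be de Rom); lra.
Qed.

End RationalCoefficients.

Theorem theorem4 :
  forall (U : R * R -> Prop) (F : R -> R -> R) (a b c : R -> R),
    region U ->
    biharmonic_on U F ->
    analytic_on unit_interval a ->
    analytic_on unit_interval b ->
    analytic_on unit_interval c ->
    (forall t, unit_interval t -> proper (circle (a t) (b t) (c t))) ->
    (forall t, unit_interval t ->
       exists x y, U (x, y) /\ on_cl (circle (a t) (b t) (c t)) x y) ->
    (forall t, unit_interval t ->
       exists l : R -> R -> R, linear_function l /\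
         forall x y, U (x, y) -> on_cl (circle (a t) (b t) (c t)) x y ->
           F x y = l x y) ->
    pencil_on unit_interval (fun t => circle (a t) (b t) (c t)) \/
    special_form_on U F.
Proof. exact RationalCoefficients.pencil_or_special_form. Qed.
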